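(* Let $k\geq 2$ be an even integer. For $\alpha\in\mathbb{R}$ let $\lambda_1(\alpha)$ denote the lowest eigenvalue of the self-adjoint operator $Q^{(k)}(\alpha)=-\frac{d^2}{dt^2}+\Bigl(\frac{t^{k+1}}{k+1}-\alpha\Bigr)^2$ in $L^2(\mathbb{R})$. Then $\alpha=0$ is a non-degenerate local minimum of $\alpha\mapsto\lambda_1(\alpha)$.
   Context: For each $\alpha\in\mathbb{R}$ and integer $k\geq1$, $Q^{(k)}(\alpha)$ is the self-adjoint operator on $L^2(\mathbb{R})$ associated with the closed quadratic form $u\mapsto\int_{\mathbb{R}}|u'(t)|^2+\bigl(\frac{t^{k+1}}{k+1}-\alpha\bigr)^2|u(t)|^2\,dt$. It has compact resolvent and simple discrete spectrum; its lowest eigenvalue $\lambda_1(\alpha)$ depends smoothly on $\alpha$. Non-degenerate local minimum means $\partial_\alpha\lambda_1(0)=0$ and $\partial^2_{\alpha\alpha}\lambda_1(0)>0$. *)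

(* Defs.v *)
From Stdlib Require Import Reals Lra.
From Coquelicot Require Import Coquelicot.
Open Scope R_scope.

Definition potential (k : nat) (alpha t : R) : R :=
  (t ^ (k + 1) / INR (k + 1) - alpha) ^ 2.

Definition square_integrable (u : R -> R) : Prop :=
  ex_RInt_gen (fun t => (u t) ^ 2) (Rbar_locally m_infty) (Rbar_locally p_infty).

Definition is_eigenvalue (k : nat) (alpha lam : R) : Prop :=
  exists u : R -> R,
    (forall t, ex_derive u t) /\
    (forall t, ex_derive (Derive u) t) /\
    square_integrable u /\
    (exists t0, u t0 <> 0) /\
    (forall t, - Derive (Derive u) t + potential k alpha t * u t = lam * u t).

Definition lambda1 (k : nat) (alpha : R) : R :=
  real (Glb_Rbar (fun lam => is_eigenvalue k alpha lam)).

(* Main.v *)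
Require Import Defs.
From Stdlib Require Import Reals Arith.
From Coquelicot Require Import Coquelicot.
From Stdlib Require Import Lra Lia Classical Factorial IndefiniteDescription.
Open Scope R_scope.

(** Conjugating by the ground state turns first-order perturbation theory into a
    first-order equation.  If [u] is the positive ground state at [alpha = 0] and
    [p t = t^(k+1)/(k+1)], then the derivative [w] of the ground state in [alpha] satisfies
    [u^2 (w/u)' = G] with [G' = - 2 p u^2], [G -> 0] at both ends, and
    [lambda1''(0) = 2 - 2 (int G^2/u^2) / (int u^2)].  So it suffices that [0 <= G < u^2].
    As [(u^2 - G)' = 2 u (u' + p u)], this follows from [u' + p u < 0] on [t > 0], which holds
    because [e^(-P) (u' + p u)], [P' = p], has derivative [e^(-P) (t^k - lambda1) u]: it starts
    from 0, first decreases, then increases to 0.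

    The ground state comes from the supremum of the energies admitting a positive solution
    on the whole line.  The Wronskian of two ground states gives
    [(lambda1 b - lambda1 a) int u_a u_b = (b - a) int (a + b - 2 p) u_a u_b]; hence [lambda1] is
    Lipschitz, [u_b -> u_a] locally uniformly, and [lambda1' a = 2 int (a - p) u_a^2 / int u_a^2]. *)

(** * Linear equations with entire coefficients *)

(** No spectral theory enters: everything is read off from Wronskians of positive solutions that
    decay at both ends, and Sturm comparison shows that such a solution belongs to the lowest
    eigenvalue. Normalising by [u 0 = 1] instead of the L^2 norm leaves only the energy and the
    slope at 0 as parameters of a ground state, so that its continuity in alpha is stability of an
    initial value problem. The ground state is never differentiated in alpha: the finite-difference
    Wronskian [(u v' - u' v) / b], with [v] the state at [b], stands for [u^2 (w/u)'] and is shown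
    to converge to [G]. The obstacle is the division by [u^2] in the limit formula: this quotient
    must be bounded by a multiple of [u v], uniformly in [b], and not merely by an exponential. The
    inequality [u' + p u < 0] serves a second time there. Evenness of [k] makes [p] odd, hence
    [lambda1] even and [G] zero at both ends. All decay estimates carry constants common to a whole
    interval of alpha, since limits are taken under the integral. *)

Lemma le_of_derive_nonneg (f f' : R -> R) (a b : R) :
  a <= b -> (forall t, a <= t <= b -> is_derive f t (f' t)) ->
  (forall t, a <= t <= b -> 0 <= f' t) -> f a <= f b.
Proof.
  intros Hab Hd Hp.
  destruct (MVT_gen f a b f') as [c [Hc He]].
  - intros x Hx; rewrite Rmin_left, Rmax_right in Hx by lra; apply Hd; lra.
  - intros x Hx; rewrite Rmin_left, Rmax_right in Hx by lra.
    apply continuity_pt_filterlim, (ex_derive_continuous f).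
    exists (f' x); apply Hd; lra.
  - rewrite Rmin_left, Rmax_right in Hc by lra.
    specialize (Hp c Hc); nra.
Qed.

Lemma lt_of_derive_pos (f f' : R -> R) (a b : R) :
  a < b -> (forall t, a <= t <= b -> is_derive f t (f' t)) ->
  (forall t, a < t < b -> 0 < f' t) -> f a < f b.
Proof.
  intros Hab Hd Hp.
  assert (Hc0 : forall x, a <= x <= b -> continuity_pt f x).
  { intros x Hx; apply continuity_pt_filterlim, (ex_derive_continuous f).
    exists (f' x); apply Hd; lra. }
  destruct (MVT_cor2 f f' a b Hab) as [c [He Hc]].
  - intros c Hc; apply is_derive_Reals, Hd; lra.
  - specialize (Hp c Hc); nra.
Qed.

(** The coefficients [potential k alpha - lam] are polynomials, hence entire; for entire
    coefficients the Taylor series of a solution converges on the whole line, which yields global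
    existence at once. *)
Definition entire (f : R -> R) : Prop :=
  exists c, (forall x, Rbar_lt (Rabs x) (CV_radius c)) /\ forall x, PSeries c x = f x.

Lemma CV_radius_infinite (c : nat -> R) :
  (forall r, 0 < r -> exists M, forall n, Rabs (c n * r ^ n) <= M) ->
  forall x, Rbar_lt (Rabs x) (CV_radius c).
Proof.
  intros H x.
  pose proof (Rabs_pos x).
  apply Rbar_lt_le_trans with (Finite (Rabs x + 1)).
  - simpl; lra.
  - apply (CV_radius_bounded c), H; lra.
Qed.

Lemma entire_const (k : R) : entire (fun _ => k).
Proof.
  set (c := fun n : nat => match n with O => k | _ => 0 end).
  assert (Hr : forall x, Rbar_lt (Rabs x) (CV_radius c)).
  { apply CV_radius_infinite; intros r Hr; exists (Rabs k); intros [|n]; simpl.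
    - rewrite Rmult_1_r; lra.
    - rewrite Rmult_0_l, Rabs_R0; apply Rabs_pos. }
  exists c; split; [exact Hr|]; intros x.
  rewrite PSeries_decr_1 by (apply CV_radius_inside, Hr).
  rewrite (PSeries_ext _ (fun _ => 0)) by (intros n; reflexivity).
  rewrite PSeries_const_0; simpl; ring.
Qed.

Lemma entire_mul_id (f : R -> R) : entire f -> entire (fun x => x * f x).
Proof.
  intros [c [Hr Hc]]; exists (PS_incr_1 c); split.
  - intros x; rewrite CV_radius_incr_1; apply Hr.
  - intros x; rewrite PSeries_incr_1, Hc; reflexivity.
Qed.

Lemma entire_plus (f g : R -> R) : entire f -> entire g -> entire (fun x => f x + g x).
Proof.
  intros [c [Hr Hc]] [d [Hs Hd]]; exists (PS_plus c d); split.
  - intros x; eapply Rbar_lt_le_trans; [|apply CV_radius_plus].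
    apply (Rbar_min_case (CV_radius c) (CV_radius d) (fun r => Rbar_lt (Rabs x) r)); auto.
  - intros x; rewrite PSeries_plus by (apply CV_radius_inside; auto).
    rewrite Hc, Hd; reflexivity.
Qed.

Lemma entire_ext (f g : R -> R) : (forall x, f x = g x) -> entire f -> entire g.
Proof. intros E [c [Hr Hc]]; exists c; split; auto; intros x; rewrite <- E; auto. Qed.

Lemma entire_monomial (a : R) (n : nat) : entire (fun x => a * x ^ n).
Proof.
  induction n as [|n IH].
  - apply entire_ext with (fun _ => a); [intros; simpl; ring | apply entire_const].
  - apply entire_ext with (fun x => x * (a * x ^ n)); [intros; simpl; ring|].
    apply entire_mul_id, IH.
Qed.

(** * Power series solutions of [u'' = q u] *)

Section SeriesSolution.
Variables (q : nat -> R) (y0 y1 : R).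

(** Coefficient [j + 2] depends on all coefficients up to [j], so the recursion carries the whole
    table: [coef_history j] is final at the indices up to [S j], and each step overwrites one
    entry. *)
Fixpoint coef_history (j : nat) : nat -> R :=
  match j with
  | O => fun i => match i with O => y0 | _ => y1 end
  | S j' => fun i =>
      if Nat.eqb i (S (S j'))
      then PS_mult q (coef_history j') j' / (INR (j' + 1) * INR (j' + 2))
      else coef_history j' i
  end.

Definition coef (i : nat) : R := coef_history i i.

Lemma coef_history_stable (m j i : nat) :
  (i <= S j)%nat -> coef_history (m + j) i = coef_history j i.
Proof.
  intros H; induction m as [|m IH]; [reflexivity|].
  simpl; rewrite (proj2 (Nat.eqb_neq i (S (S (m + j))))) by lia; exact IH.
Qed.

Lemma coef_rec (j : nat) :
  coef (S (S j)) * (INR (j + 1) * INR (j + 2)) = PS_mult q coef j.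
Proof.
  unfold coef at 1.
  change (S (S j)) with (1 + S j)%nat at 1.
  rewrite (coef_history_stable 1 (S j)) by lia.
  simpl coef_history; rewrite Nat.eqb_refl.
  replace (PS_mult q (coef_history j) j) with (PS_mult q coef j).
  - field; split; apply not_0_INR; lia.
  - apply sum_eq; intros i Hi; f_equal; unfold coef.
    pose proof (coef_history_stable i (j - i) (j - i) ltac:(lia)) as E.
    replace (i + (j - i))%nat with j in E by lia; auto.
Qed.

Hypothesis q_entire : forall x, Rbar_lt (Rabs x) (CV_radius q).

(** With [Q] bounding the sums of [Rabs (q i * r ^ i)], the recursion bounds
    [Rabs (coef (j + 2) * r ^ (j + 2))] by [r ^ 2 * Q / ((j + 1) (j + 2))] times the maximum of the
    earlier terms. Once [j + 1] exceeds [r ^ 2 * Q] this maximum no longer grows, so the finitely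
    many first terms determine [M]. *)
Lemma coef_bounded (r : R) : 0 < r -> exists M, forall n, Rabs (coef n * r ^ n) <= M.
Proof.
  intros Hr.
  assert (HQ : exists Q, 0 <= Q /\ forall n, sum_f_R0 (fun i => Rabs (q i * r ^ i)) n <= Q).
  { pose proof (CV_disk_inside q r (q_entire r)) as Hs.
    exists (Series (fun n => Rabs (q n * r ^ n))).
    assert (HH : forall n, sum_f_R0 (fun i => Rabs (q i * r ^ i)) n
                 <= Series (fun n => Rabs (q n * r ^ n))).
    { intros n; rewrite <- sum_n_Reals.
      apply (is_lim_seq_incr_compare (sum_n (fun n => Rabs (q n * r ^ n)))).
      - apply Series_correct, Hs.
      - intros m; rewrite sum_Sn; unfold plus; simpl.
        pose proof (Rabs_pos (q (S m) * r ^ S m)); simpl in *; lra. }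
    split; [|exact HH].
    specialize (HH O); simpl in HH; pose proof (Rabs_pos (q O * 1)); lra. }
  destruct HQ as [Q [HQ0 HQ]].
  destruct (INR_unbounded (r ^ 2 * Q)) as [N HN].
  assert (Hmax : forall n, exists M, forall m, (m <= n)%nat -> Rabs (coef m * r ^ m) <= M).
  { induction n as [|n [M IH]].
    - exists (Rabs (coef 0 * r ^ 0)); intros m Hm; replace m with O by lia; lra.
    - exists (Rmax M (Rabs (coef (S n) * r ^ S n))); intros m Hm.
      destruct (Nat.eq_dec m (S n)) as [->|Hne]; [apply Rmax_r|].
      eapply Rle_trans; [apply IH; lia | apply Rmax_l]. }
  destruct (Hmax (S (S N))) as [M HM].
  exists M.
  intros n; induction n as [n IH] using (well_founded_induction Wf_nat.lt_wf).
  destruct (Nat.le_gt_cases n (S (S N))) as [Hle|Hgt]; [apply HM, Hle|].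
  destruct n as [|[|j]]; [lia|lia|].
  assert (HM0 : 0 <= M) by (eapply Rle_trans; [apply Rabs_pos | apply (HM O); lia]).
  assert (Hb : Rabs (PS_mult q coef j * r ^ j) <= Q * M).
  { unfold PS_mult; rewrite Rmult_comm, scal_sum.
    eapply Rle_trans; [apply Rsum_abs|].
    apply Rle_trans with (sum_f_R0 (fun i => Rabs (q i * r ^ i) * M) j).
    - apply sum_Rle; intros i Hi.
      replace (q i * coef (j - i) * r ^ j) with ((q i * r ^ i) * (coef (j - i) * r ^ (j - i))).
      + rewrite Rabs_mult; apply Rmult_le_compat_l; [apply Rabs_pos | apply IH; lia].
      + replace (r ^ j) with (r ^ i * r ^ (j - i)); [ring|].
        rewrite <- pow_add; f_equal; lia.
    - rewrite <- scal_sum, Rmult_comm; apply Rmult_le_compat_r; auto. }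
  rewrite <- coef_rec in Hb.
  set (c := coef (S (S j))) in *.
  assert (HjN : INR N <= INR (j + 1)) by (apply le_INR; lia).
  assert (Hj2 : 1 <= INR (j + 2)) by (rewrite <- INR_1; apply le_INR; lia).
  assert (HN0 : 0 <= INR N) by apply pos_INR.
  set (J1 := INR (j + 1)) in *; set (J2 := INR (j + 2)) in *.
  replace (c * r ^ S (S j)) with (r ^ 2 * (c * r ^ j)) by (simpl; ring).
  replace (c * (J1 * J2) * r ^ j) with ((J1 * J2) * (c * r ^ j)) in Hb by ring.
  rewrite Rabs_mult in Hb |- *.
  assert (Hr2 : 0 < r ^ 2) by (apply pow_lt; lra).
  rewrite (Rabs_pos_eq (r ^ 2)) by lra.
  rewrite (Rabs_pos_eq (J1 * J2)) in Hb by nra.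
  set (X := Rabs (c * r ^ j)) in *.
  assert (HX : 0 <= X) by apply Rabs_pos.
  assert (HJ1 : r ^ 2 * Q < J1) by lra.
  assert (H0 : 0 <= r ^ 2 * Q) by nra.
  assert (HJX : J1 * X <= Q * M).
  { eapply Rle_trans; [|exact Hb]. rewrite (Rmult_comm J1 J2), Rmult_assoc.
    assert (0 <= J1 * X) by (apply Rmult_le_pos; lra). nra. }
  apply Rmult_le_reg_l with J1; [lra|].
  apply Rle_trans with (r ^ 2 * (Q * M)).
  - replace (J1 * (r ^ 2 * X)) with (r ^ 2 * (J1 * X)) by ring.
    apply Rmult_le_compat_l; lra.
  - rewrite <- Rmult_assoc; apply Rmult_le_compat_r; lra.
Qed.

End SeriesSolution.

(** The equation [u'' = q u] as a first-order system; carrying [u1] along keeps both initial data at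
    hand. *)
Definition Sol (q u u1 : R -> R) : Prop :=
  forall t, is_derive u t (u1 t) /\ is_derive u1 t (q t * u t).

Lemma ivp_exists (q : R -> R) (y0 y1 : R) :
  entire q -> exists u u1, Sol q u u1 /\ u 0 = y0 /\ u1 0 = y1.
Proof.
  intros [c [Hr Hc]].
  set (a := coef c y0 y1).
  assert (Ha : forall x, Rbar_lt (Rabs x) (CV_radius a)).
  { apply CV_radius_infinite, coef_bounded, Hr. }
  assert (Ha1 : forall x, Rbar_lt (Rabs x) (CV_radius (PS_derive a))).
  { intros x; rewrite CV_radius_derive; auto. }
  exists (PSeries a), (PSeries (PS_derive a)); split; [intros t; split | split].
  - apply is_derive_PSeries; auto.
  - replace (q t * PSeries a t) with (PSeries (PS_derive (PS_derive a)) t).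
    + apply is_derive_PSeries; auto.
    + rewrite <- Hc, <- PSeries_mult by auto.
      apply PSeries_ext; intros n; unfold PS_derive.
      pose proof (coef_rec c y0 y1 n) as E; fold a in E; rewrite <- E.
      replace (n + 1)%nat with (S n) by lia; replace (n + 2)%nat with (S (S n)) by lia; ring.
  - rewrite PSeries_0; reflexivity.
  - rewrite PSeries_0; unfold PS_derive, a; simpl; unfold coef; simpl; ring.
Qed.

Lemma Sol_ext (q q' u u1 : R -> R) : (forall t, q t = q' t) -> Sol q u u1 -> Sol q' u u1.
Proof. intros E H t; rewrite <- E; apply H. Qed.

Lemma Sol_reflect (q u u1 : R -> R) :
  Sol q u u1 -> Sol (fun t => q (- t)) (fun t => u (- t)) (fun t => - u1 (- t)).
Proof.
  intros H t; destruct (H (- t)) as [H1 H2]; split.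
  - replace (- u1 (- t)) with (scal (-1) (u1 (- t))) by (unfold scal; simpl; unfold mult; simpl; ring).
    apply (is_derive_comp u (fun t => - t)); [exact H1|].
    auto_derive; auto; ring.
  - replace (q (- t) * u (- t)) with (opp (scal (-1) (q (- t) * u (- t))))
      by (unfold opp, scal; simpl; unfold mult; simpl; ring).
    apply (is_derive_opp (fun t => u1 (- t))).
    apply (is_derive_comp u1 (fun t => - t)); [exact H2|].
    auto_derive; auto; ring.
Qed.

Lemma Sol_translate (q u u1 : R -> R) (s : R) :
  Sol q u u1 -> Sol (fun t => q (t + s)) (fun t => u (t + s)) (fun t => u1 (t + s)).
Proof.
  intros H t; destruct (H (t + s)) as [H1 H2]; split.
  - rewrite <- (scal_one (u1 (t + s))); apply (is_derive_comp u (fun t => t + s)); [exact H1|].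
    auto_derive; auto.
  - rewrite <- (scal_one (q (t + s) * u (t + s))).
    apply (is_derive_comp u1 (fun t => t + s)); [exact H2|]. auto_derive; auto.
Qed.

Lemma Sol_lincomb (q u u1 v v1 : R -> R) (a b : R) :
  Sol q u u1 -> Sol q v v1 -> Sol q (fun t => a * u t + b * v t) (fun t => a * u1 t + b * v1 t).
Proof.
  intros H K t; destruct (H t) as [H1 H2], (K t) as [K1 K2]; split.
  - apply (is_derive_plus (fun t => a * u t) (fun t => b * v t));
      apply is_derive_scal; assumption.
  - replace (q t * (a * u t + b * v t)) with (a * (q t * u t) + b * (q t * v t)) by ring.
    apply (is_derive_plus (fun t => a * u1 t) (fun t => b * v1 t));
      apply is_derive_scal; assumption.
Qed.

(** * Stability of solutions *)

Lemma is_derive_eq (f : R -> R) (t l l' : R) : is_derive f t l -> l = l' -> is_derive f t l'.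
Proof. intros H <-; exact H. Qed.

Lemma is_derive_Rplus (f g : R -> R) (t a b : R) :
  is_derive f t a -> is_derive g t b -> is_derive (fun s => f s + g s) t (a + b).
Proof. apply (is_derive_plus f g). Qed.

Lemma is_derive_Rminus (f g : R -> R) (t a b : R) :
  is_derive f t a -> is_derive g t b -> is_derive (fun s => f s - g s) t (a - b).
Proof. apply (is_derive_minus f g). Qed.

Lemma is_derive_Rmult (f g : R -> R) (t a b : R) :
  is_derive f t a -> is_derive g t b -> is_derive (fun s => f s * g s) t (a * g t + f t * b).
Proof.
  intros H K; apply is_derive_eq with (plus (mult a (g t)) (mult (f t) b)); [|reflexivity].
  apply (is_derive_mult f g); auto; intros; apply Rmult_comm.
Qed.

Lemma is_derive_Ropp (f : R -> R) (t a : R) :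
  is_derive f t a -> is_derive (fun s => - f s) t (- a).
Proof. apply (is_derive_opp f). Qed.

Lemma is_derive_Rpow (f : R -> R) (n : nat) (t a : R) :
  is_derive f t a -> is_derive (fun s => f s ^ n) t (INR n * a * f t ^ pred n).
Proof. apply (is_derive_pow f). Qed.

Lemma is_derive_Rexp (f : R -> R) (t a : R) :
  is_derive f t a -> is_derive (fun s => exp (f s)) t (a * exp (f t)).
Proof.
  intros H; apply (is_derive_comp exp f t (exp (f t)) a); [apply is_derive_exp | exact H].
Qed.

Lemma is_derive_Rdiv (f g : R -> R) (t a b : R) : g t <> 0 ->
  is_derive f t a -> is_derive g t b ->
  is_derive (fun s => f s / g s) t ((a * g t - f t * b) / g t ^ 2).
Proof. intros H; intros; apply (is_derive_div f g); auto. Qed.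

Lemma is_derive_reflect (f : R -> R) (t a : R) :
  is_derive f (- t) a -> is_derive (fun s => f (- s)) t (- a).
Proof.
  intros H; apply is_derive_eq with (scal (-1) a);
    [|unfold scal; simpl; unfold mult; simpl; ring].
  apply (is_derive_comp f (fun t => - t)); [exact H|]. auto_derive; auto; ring.
Qed.

(** Differentiates along the syntax, taking the derivatives of abstract functions from the
    hypotheses. [der] then leaves the equality between the computed and the stated derivative, and
    nonvanishing denominators. *)
Ltac der_step :=
  first [ eassumption
        | match goal with
          | H : forall t, is_derive ?f t _ |- is_derive ?f _ _ => apply H
          end
        | lazymatch goal with
          | |- is_derive (fun _ => ?c) _ _ => apply (is_derive_const c)
          | |- is_derive (fun x => x) _ _ => apply (is_derive_id (K := R_AbsRing))
          | |- is_derive (fun x => _ + _) _ _ => apply is_derive_Rplus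
          | |- is_derive (fun x => _ - _) _ _ => apply is_derive_Rminus
          | |- is_derive (fun x => _ * _) _ _ => apply is_derive_Rmult
          | |- is_derive (fun x => _ / _) _ _ => apply is_derive_Rdiv
          | |- is_derive (fun x => - _) _ _ => apply is_derive_Ropp
          | |- is_derive (fun x => _ ^ _) _ _ => apply is_derive_Rpow
          | |- is_derive (fun x => exp _) _ _ => apply is_derive_Rexp
          | |- is_derive Ropp _ _ => apply (is_derive_Ropp (fun x => x))
          | |- is_derive exp _ _ => apply is_derive_exp
          | |- is_derive (Rmult ?c) _ _ => apply (is_derive_Rmult (fun _ => c) (fun x => x))
          | |- is_derive (Rplus ?c) _ _ => apply (is_derive_Rplus (fun _ => c) (fun x => x))
          | |- is_derive (Rminus ?c) _ _ => apply (is_derive_Rminus (fun _ => c) (fun x => x))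
          end ].

Ltac der := eapply is_derive_eq; [repeat der_step | unfold zero, one; simpl; try match goal with |- ?a = ?b => change (@eq R a b) end].

Lemma Sol_wronskian (q r u u1 v v1 : R -> R) :
  Sol q u u1 -> Sol r v v1 -> forall t,
  is_derive (fun t => u t * v1 t - u1 t * v t) t ((r t - q t) * (u t * v t)).
Proof.
  intros H K t; destruct (H t), (K t); der; ring.
Qed.

Lemma exp_mono (x y : R) : x <= y -> exp x <= exp y.
Proof. intros [H| ->]; [left; apply exp_increasing, H | right; reflexivity]. Qed.

(** As [1 <= K], the additive term is absorbed: [E' <= K * (E + b)], so [(E + b) * exp (- K * t)]
    does not increase. *)
Lemma gronwall (E E' : R -> R) (K b L : R) :
  1 <= K -> 0 <= b ->
  (forall t, 0 <= t <= L -> is_derive E t (E' t)) ->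
  (forall t, 0 <= t <= L -> E' t <= K * E t + b) ->
  forall t, 0 <= t <= L -> E t + b <= (E 0 + b) * exp (K * t).
Proof.
  intros HK Hb HE HE' t Ht.
  pose proof (le_of_derive_nonneg (fun s => - ((E s + b) * exp (- K * s)))
     (fun s => (K * (E s + b) - E' s) * exp (- K * s)) 0 t) as H.
  assert (Hd : forall s, 0 <= s <= t -> is_derive (fun s => - ((E s + b) * exp (- K * s))) s
     ((K * (E s + b) - E' s) * exp (- K * s))).
  { intros s Hs; assert (Hs' : 0 <= s <= L) by lra; specialize (HE s Hs'); der; ring. }
  specialize (H (proj1 Ht) Hd); cbv beta in H.
  assert (H0 : (E t + b) * exp (- K * t) <= E 0 + b).
  { rewrite Rmult_0_r, exp_0 in H. enough (- ((E 0 + b) * 1) <= - ((E t + b) * exp (- K * t))) by lra.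
    apply H; intros s Hs; apply Rmult_le_pos; [|left; apply exp_pos].
    assert (Hs' : 0 <= s <= L) by lra; specialize (HE' s Hs'); nra. }
  replace (E t + b) with (((E t + b) * exp (- K * t)) * exp (K * t)).
  - apply Rmult_le_compat_r; [left; apply exp_pos | exact H0].
  - rewrite Rmult_assoc, <- exp_plus; replace (- K * t + K * t) with 0 by ring.
    rewrite exp_0; ring.
Qed.

Lemma Rabs_le_of_sq (x y : R) : 0 <= y -> x ^ 2 <= y ^ 2 -> Rabs x <= y.
Proof. intros; apply Rabs_le; split; nra. Qed.

Lemma continuous_bounded (f : R -> R) (a b : R) :
  (forall t, continuous f t) -> exists K, 0 <= K /\ forall t, a <= t <= b -> Rabs (f t) <= K.
Proof.
  intros Hf.
  destruct (Rle_lt_dec a b) as [Hab|Hab].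
  - destruct (continuity_ab_maj (fun t => Rabs (f t)) a b Hab) as [x [Hx _]].
    + intros c _; apply continuity_pt_filterlim.
      apply (continuous_comp f Rabs); [apply Hf | apply continuous_Rabs].
    + exists (Rabs (f x)); split; [apply Rabs_pos | exact Hx].
  - exists 0; split; [lra | intros; lra].
Qed.

Lemma Sol_continuous (q u u1 : R -> R) : Sol q u u1 ->
  (forall t, continuous u t) /\ (forall t, continuous u1 t).
Proof.
  intros H; split; intros t; destruct (H t) as [H1 H2].
  - apply (ex_derive_continuous u); eexists; exact H1.
  - apply (ex_derive_continuous u1); eexists; exact H2.
Qed.

(** Gronwall for the squared distance [(u - v)^2 + (u1 - v1)^2]. Since [delta] is fixed before [q]
    and [u], the estimate is uniform over all nearby equations and solutions. *)
Lemma Sol_stability_half (r v v1 : R -> R) (L eta : R) :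
  (forall t, continuous r t) -> Sol r v v1 -> 0 < eta ->
  exists delta, 0 < delta /\ forall q u u1, Sol q u u1 ->
    (forall t, 0 <= t <= L -> Rabs (q t - r t) <= delta) ->
    Rabs (u 0 - v 0) <= delta -> Rabs (u1 0 - v1 0) <= delta ->
    forall t, 0 <= t <= L -> Rabs (u t - v t) <= eta /\ Rabs (u1 t - v1 t) <= eta.
Proof.
  intros Hr Hv Heta.
  destruct (continuous_bounded r 0 L Hr) as [K [HK0 HK]].
  destruct (continuous_bounded v 0 L (proj1 (Sol_continuous _ _ _ Hv))) as [B [HB0 HB]].
  (* [Z] is the factor by which Gronwall multiplies [delta ^ 2]: 2 comes from the two initial
     errors, [B ^ 2] from the error in the coefficient. In [K + 3], [K + 1] bounds the perturbed
     coefficient and the remaining 2 comes from splitting the mixed products. *)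
  set (Z := (2 + B ^ 2) * exp ((K + 3) * Rmax 0 L)).
  assert (He : 1 <= exp ((K + 3) * Rmax 0 L)).
  { rewrite <- exp_0 at 1; apply exp_mono; apply Rmult_le_pos; [lra | apply Rmax_l]. }
  assert (HZ : 1 <= Z) by (unfold Z; nra).
  exists (Rmin 1 (eta / Z)).
  assert (Hd : 0 < Rmin 1 (eta / Z)).
  { apply Rmin_pos; [lra | apply Rdiv_lt_0_compat; lra]. }
  split; [exact Hd|].
  pose proof (Rmin_l 1 (eta / Z)) as Hd1.
  pose proof (Rmin_r 1 (eta / Z)) as Hd2.
  set (dl := Rmin 1 (eta / Z)) in *.
  assert (HdZ : dl ^ 2 * Z <= eta ^ 2).
  { assert (dl * Z <= eta).
    { apply Rmult_le_compat_r with (r := Z) in Hd2; [|lra].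
      unfold Rdiv in Hd2; rewrite Rmult_assoc, Rinv_l in Hd2 by lra; lra. }
    assert (0 <= dl * Z) by nra. assert (dl <= eta) by nra. nra. }
  intros q u u1 Hu Hq H0 H1.
  set (E := fun t => (u t - v t) ^ 2 + (u1 t - v1 t) ^ 2).
  set (E' := fun t => 2 * (u t - v t) * (u1 t - v1 t)
              + 2 * (u1 t - v1 t) * (q t * u t - r t * v t)).
  assert (HG : forall t, 0 <= t <= L -> E t + dl ^ 2 * B ^ 2 <=
     (E 0 + dl ^ 2 * B ^ 2) * exp ((K + 3) * t)).
  { apply (gronwall E E' (K + 3) (dl ^ 2 * B ^ 2) L).
    - lra.
    - nra.
    - intros t _; destruct (Hu t), (Hv t); unfold E, E'; der; ring.
    - intros t Ht; unfold E, E'.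
      specialize (HK t Ht); specialize (HB t Ht); specialize (Hq t Ht).
      set (d := u t - v t); set (d1 := u1 t - v1 t).
      replace (q t * u t - r t * v t) with (q t * d + (q t - r t) * v t) by (unfold d; ring).
      assert (HqK : Rabs (q t) <= K + 1).
      { replace (q t) with (r t + (q t - r t)) by ring.
        eapply Rle_trans; [apply Rabs_triang | lra]. }
      assert (Hx : Rabs ((q t - r t) * v t) <= dl * B).
      { rewrite Rabs_mult; apply Rmult_le_compat; auto using Rabs_pos. }
      set (x := (q t - r t) * v t) in *.
      assert (Hx2 : x ^ 2 <= dl ^ 2 * B ^ 2).
      { rewrite <- Rpow_mult_distr, <- (pow2_abs x); apply pow_incr; split; auto using Rabs_pos. }
      assert (Hq2 : 2 * d1 * (q t * d) <= (K + 1) * (d ^ 2 + d1 ^ 2)).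
      { apply Rabs_le_between in HqK.
        assert (0 <= (K + 1 - q t) * (d + d1) ^ 2) by (apply Rmult_le_pos; [lra | apply pow2_ge_0]).
        assert (0 <= (K + 1 + q t) * (d - d1) ^ 2) by (apply Rmult_le_pos; [lra | apply pow2_ge_0]).
        nra. }
      pose proof (pow2_ge_0 (d1 - x)); pose proof (pow2_ge_0 (d1 - d)); nra. }
  intros t Ht; specialize (HG t Ht).
  assert (HE0 : E 0 <= 2 * dl ^ 2).
  { unfold E; rewrite <- (pow2_abs (u 0 - v 0)), <- (pow2_abs (u1 0 - v1 0)).
    assert (Rabs (u 0 - v 0) ^ 2 <= dl ^ 2) by (apply pow_incr; split; auto using Rabs_pos).
    assert (Rabs (u1 0 - v1 0) ^ 2 <= dl ^ 2) by (apply pow_incr; split; auto using Rabs_pos).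
    lra. }
  assert (Hexp : exp ((K + 3) * t) <= exp ((K + 3) * Rmax 0 L)).
  { apply exp_mono; apply Rmult_le_compat_l; [lra|]; pose proof (Rmax_r 0 L); lra. }
  assert (HEt : E t <= eta ^ 2).
  { eapply Rle_trans; [|exact HdZ].
    assert (0 <= dl ^ 2 * B ^ 2) by nra.
    apply Rle_trans with ((E 0 + dl ^ 2 * B ^ 2) * exp ((K + 3) * t)); [lra|].
    unfold Z; rewrite <- Rmult_assoc; apply Rmult_le_compat.
    - assert (0 <= E 0) by (unfold E; apply Rplus_le_le_0_compat; apply pow2_ge_0); lra.
    - left; apply exp_pos.
    - nra.
    - exact Hexp. }
  unfold E in HEt.
  pose proof (pow2_ge_0 (u t - v t)); pose proof (pow2_ge_0 (u1 t - v1 t)).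
  split; apply Rabs_le_of_sq; lra.
Qed.

Lemma continuous_reflect (f : R -> R) :
  (forall t, continuous f t) -> forall t, continuous (fun s : R => f (- s)) t.
Proof.
  intros H t; apply (continuous_comp Ropp f); [|apply H].
  apply (continuous_opp (fun x : R => x)); apply continuous_id.
Qed.

Lemma Sol_stability (r v v1 : R -> R) (L eta : R) :
  (forall t, continuous r t) -> Sol r v v1 -> 0 < eta ->
  exists delta, 0 < delta /\ forall q u u1, Sol q u u1 ->
    (forall t, - L <= t <= L -> Rabs (q t - r t) <= delta) ->
    Rabs (u 0 - v 0) <= delta -> Rabs (u1 0 - v1 0) <= delta ->
    forall t, - L <= t <= L -> Rabs (u t - v t) <= eta /\ Rabs (u1 t - v1 t) <= eta.
Proof.
  intros Hr Hv Heta.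
  destruct (Sol_stability_half r v v1 L eta Hr Hv Heta) as [d1 [Hd1 H1]].
  destruct (Sol_stability_half _ _ _ L eta (continuous_reflect r Hr) (Sol_reflect _ _ _ Hv) Heta)
    as [d2 [Hd2 H2]].
  exists (Rmin d1 d2); split; [apply Rmin_pos; auto|].
  pose proof (Rmin_l d1 d2); pose proof (Rmin_r d1 d2).
  intros q u u1 Hu Hq Hu0 Hu10 t Ht.
  destruct (Rle_lt_dec 0 t).
  - apply (H1 q u u1 Hu); try lra; intros s Hs.
    specialize (Hq s ltac:(lra)); lra.
  - specialize (H2 _ _ _ (Sol_reflect _ _ _ Hu)).
    cbv beta in H2; rewrite Ropp_0 in H2.
    assert (E : forall a b, Rabs (- a - - b) = Rabs (a - b)).
    { intros a b; rewrite <- Rabs_Ropp; f_equal; ring. }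
    rewrite E in H2.
    destruct (fun h1 => H2 h1 ltac:(lra) ltac:(lra) (- t) ltac:(lra)) as [Ha Hb].
    + intros s Hs; specialize (Hq (- s) ltac:(lra)); lra.
    + rewrite E in Hb. rewrite Ropp_involutive in Ha, Hb; auto.
Qed.

(** Uniqueness is stability around the zero solution under a perturbation of size 0, after moving
    [t0] to the origin. *)
Lemma Sol_unique_zero (q u u1 : R -> R) (t0 : R) :
  (forall t, continuous q t) -> Sol q u u1 -> u t0 = 0 -> u1 t0 = 0 -> forall t, u t = 0.
Proof.
  intros Hq Hu H0 H1 t.
  set (L := Rabs (t - t0)).
  assert (Hz : Sol (fun t => q (t + t0)) (fun _ => 0) (fun _ => 0)).
  { intros s; split; der; ring. }
  assert (Hqc : forall s, continuous (fun s => q (s + t0)) s).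
  { intros s; apply (continuous_comp (fun s => s + t0) q); [|apply Hq].
    apply (continuous_plus (fun s : R => s) (fun _ => t0)); [apply continuous_id|apply continuous_const]. }
  assert (Hall : forall eta, 0 < eta -> Rabs (u t) <= eta).
  { intros eta He.
    destruct (Sol_stability _ _ _ L eta Hqc Hz He) as [d [Hd H]].
    specialize (H _ _ _ (Sol_translate q u u1 t0 Hu)).
    cbv beta in H; rewrite !Rplus_0_l, H0, H1, Rminus_0_r, Rabs_R0 in H.
    assert (Ht : - L <= t - t0 <= L) by (apply (proj1 (Rabs_le_between _ _)), Rle_refl).
    destruct (fun h => H h ltac:(lra) ltac:(lra) (t - t0) Ht) as [Ha _].
    - intros s _; rewrite Rminus_eq_0, Rabs_R0; lra.
    - rewrite Rminus_0_r in Ha; replace (t - t0 + t0) with t in Ha by ring; exact Ha. }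
  destruct (Req_dec (u t) 0) as [|Hne]; [assumption|].
  specialize (Hall (Rabs (u t) / 2)). pose proof (Rabs_pos_lt _ Hne). lra.
Qed.

(** * Behaviour on a half-line *)

Lemma pos_of_no_zero (f : R -> R) (a b : R) :
  a <= b -> (forall t, continuous f t) -> (forall t, a <= t <= b -> f t <> 0) ->
  0 < f a -> 0 < f b.
Proof.
  intros Hab Hf Hn Ha.
  destruct (Rlt_le_dec 0 (f b)) as [|Hb]; [assumption|].
  destruct (IVT_gen f a b 0) as [x [Hx Hfx]].
  - intros x; apply continuity_pt_filterlim, Hf.
  - rewrite Rmin_right, Rmax_left; lra.
  - rewrite Rmin_left, Rmax_right in Hx by lra.
    destruct (Hn x Hx Hfx).
Qed.

Section HalfLine.
Variables (q u u1 : R -> R) (a : R).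
Hypothesis Hu : Sol q u u1.

Lemma Sol_mul_derive (t : R) :
  is_derive (fun t => u t * u1 t) t (u1 t ^ 2 + q t * u t ^ 2).
Proof. destruct (Hu t); der; ring. Qed.

Lemma Sol_mul_nondecr (b c : R) : (forall t, a <= t -> 0 <= q t) -> a <= b <= c ->
  u b * u1 b <= u c * u1 c.
Proof.
  intros Hq Hbc.
  apply (le_of_derive_nonneg (fun t => u t * u1 t) (fun t => u1 t ^ 2 + q t * u t ^ 2));
    [lra | intros; apply Sol_mul_derive|].
  intros t Ht; specialize (Hq t ltac:(lra)).
  pose proof (pow2_ge_0 (u1 t)); pose proof (pow2_ge_0 (u t)); nra.
Qed.

(** [u * u1] does not decrease and starts nonnegative, so [u ^ 2] does not decrease and cannot reach
    0. *)
Lemma Sol_pos_right : (forall t, a <= t -> 0 <= q t) -> 0 < u a -> 0 <= u1 a ->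
  forall t, a <= t -> 0 < u t.
Proof.
  intros Hq Ha Ha1 t Ht.
  apply (pos_of_no_zero u a t Ht); [apply (Sol_continuous q u u1 Hu)| |exact Ha].
  intros s Hs Hz.
  assert (H : (u a) ^ 2 <= (u s) ^ 2).
  { apply (le_of_derive_nonneg (fun t => u t ^ 2) (fun t => 2 * (u t * u1 t))); [lra| |].
    - intros r _; destruct (Hu r); der; ring.
    - intros r Hr; pose proof (Sol_mul_nondecr a r Hq ltac:(lra)); nra. }
  rewrite Hz in H; nra.
Qed.

Hypothesis Hq : forall t, a <= t -> 1 <= q t.
Hypothesis Hpos : forall t, a <= t -> 0 < u t.
Hypothesis Hneg : forall t, a <= t -> u1 t <= 0.

(** As [(u + u1)' - (u + u1) = (q - 1) u >= 0], a positive value of [u + u1] would grow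
    exponentially, whereas [u + u1 <= u] stays bounded because [u] does not increase. *)
Lemma tail_derive_le (t : R) : a <= t -> u1 t <= - u t.
Proof.
  intros Ht.
  destruct (Rle_lt_dec (u1 t) (- u t)) as [|Hc]; [assumption|exfalso].
  set (w := u t + u1 t).
  assert (Hw : 0 < w) by (unfold w; lra).
  pose proof (Hpos t Ht) as Hut.
  (* At this [s] the growth already gives [w * exp (s - t) >= w * (1 + (s - t)) = w + u t], which
     exceeds [u t], an upper bound for [u s + u1 s]. *)
  set (s := t + u t / w).
  assert (Hs : t < s) by (unfold s; pose proof (Rdiv_lt_0_compat _ _ Hut Hw); lra).
  assert (H1 : (u t + u1 t) * exp (- t) <= (u s + u1 s) * exp (- s)).
  { apply (le_of_derive_nonneg (fun t => (u t + u1 t) * exp (- t))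
             (fun t => (q t - 1) * u t * exp (- t))); [lra| |].
    - intros r _; destruct (Hu r); der; ring.
    - intros r Hr; specialize (Hq r ltac:(lra)); specialize (Hpos r ltac:(lra)).
      repeat apply Rmult_le_pos; try lra; left; apply exp_pos. }
  assert (H2 : u s <= u t).
  { apply Ropp_le_cancel.
    apply (le_of_derive_nonneg (fun t => - u t) (fun t => - u1 t)); [lra| |].
    - intros r _; destruct (Hu r); der; ring.
    - intros r Hr; specialize (Hneg r ltac:(lra)); lra. }
  specialize (Hneg s ltac:(lra)).
  assert (H3 : w * exp (s - t) <= u s + u1 s).
  { apply Rmult_le_reg_r with (exp (- s)); [apply exp_pos|].
    eapply Rle_trans; [|exact H1]; rewrite Rmult_assoc, <- exp_plus.
    replace (s - t + - s) with (- t) by ring; unfold w; lra. }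
  assert (H4 : 1 + (s - t) <= exp (s - t)) by (apply exp_ineq1_le).
  assert (H5 : w * (s - t) = u t) by (unfold s; field; lra).
  nra.
Qed.

Lemma tail_exp_decay (t : R) : a <= t -> u t <= u a * exp (a - t).
Proof.
  intros Ht.
  assert (H : - (u a * exp a) <= - (u t * exp t)).
  { apply (le_of_derive_nonneg (fun t => - (u t * exp t)) (fun t => (- u t - u1 t) * exp t)); [lra| |].
    - intros r _; destruct (Hu r); pose proof (is_derive_exp r); der; ring.
    - intros r Hr; pose proof (tail_derive_le r ltac:(lra)).
      apply Rmult_le_pos; [lra | left; apply exp_pos]. }
  apply Rmult_le_reg_r with (exp t); [apply exp_pos|].
  rewrite Rmult_assoc, <- exp_plus; replace (a - t + t) with a by ring; lra.
Qed.

Lemma tail_derive_nondecr (t : R) : a <= t -> u1 a <= u1 t.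
Proof.
  intros Ht; apply (le_of_derive_nonneg u1 (fun t => q t * u t)); [lra| |].
  - intros r _; apply Hu.
  - intros r Hr; specialize (Hq r ltac:(lra)); specialize (Hpos r ltac:(lra)); nra.
Qed.

Lemma tail_bounds : exists C, 0 < C /\
  forall t, a <= t -> Rabs (u t) <= C * exp (- t) /\ Rabs (u1 t) <= C.
Proof.
  exists (u a * exp a + Rabs (u1 a)); split.
  { pose proof (exp_pos a); pose proof (Hpos a (Rle_refl a)); pose proof (Rabs_pos (u1 a)); nra. }
  intros t Ht; pose proof (exp_pos a); pose proof (exp_pos (- t)).
  pose proof (Hpos a (Rle_refl a)); pose proof (Rabs_pos (u1 a)); split.
  - rewrite Rabs_pos_eq by (left; apply Hpos, Ht).
    pose proof (tail_exp_decay t Ht) as Hd.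
    unfold Rminus in Hd; rewrite exp_plus in Hd; nra.
  - pose proof (tail_derive_nondecr t Ht); pose proof (Hneg t Ht).
    rewrite (Rabs_left1 (u1 t)), (Rabs_left1 (u1 a)); [nra| apply Hneg; lra | assumption].
Qed.

End HalfLine.

(** Only the end +oo is covered; the other end is reached by composing with the reflection. *)
Definition vanishing (f : R -> R) : Prop :=
  forall eps, 0 < eps -> exists N, forall t, N <= t -> Rabs (f t) <= eps.

Lemma exp_small (C eps : R) : 0 <= C -> 0 < eps ->
  exists N, 0 <= N /\ forall t, N <= t -> C * exp (- t) <= eps.
Proof.
  intros HC He; exists (C / eps).
  assert (H0 : 0 <= C / eps) by (apply Rmult_le_pos; [lra | left; apply Rinv_0_lt_compat; lra]).
  split; [exact H0|]; intros t Ht.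
  assert (Hx : C / eps <= exp t) by (pose proof (exp_ineq1_le t); lra).
  rewrite exp_Ropp.
  apply Rmult_le_reg_r with (exp t); [apply exp_pos|].
  rewrite Rmult_assoc, Rinv_l, Rmult_1_r by (apply Rgt_not_eq, exp_pos).
  apply Rmult_le_compat_l with (r := eps) in Hx; [|lra].
  replace (eps * (C / eps)) with C in Hx by (field; lra); lra.
Qed.

Lemma vanishing_of_exp (f : R -> R) (C a : R) : 0 <= C ->
  (forall t, a <= t -> Rabs (f t) <= C * exp (- t)) -> vanishing f.
Proof.
  intros HC H eps He; destruct (exp_small C eps HC He) as [N [_ HN]].
  exists (Rmax a N); intros t Ht.
  pose proof (Rmax_l a N); pose proof (Rmax_r a N).
  eapply Rle_trans; [apply H; lra | apply HN; lra].
Qed.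

Lemma vanishing_opp (f : R -> R) : vanishing f -> vanishing (fun t => - f t).
Proof.
  intros H eps He; destruct (H eps He) as [N HN]; exists N; intros t Ht.
  rewrite Rabs_Ropp; auto.
Qed.

Lemma vanishing_ext (f g : R -> R) : (forall t, f t = g t) -> vanishing f -> vanishing g.
Proof.
  intros E H eps He; destruct (H eps He) as [N HN]; exists N; intros t Ht; rewrite <- E; auto.
Qed.

Lemma vanishing_plus (f g : R -> R) :
  vanishing f -> vanishing g -> vanishing (fun t => f t + g t).
Proof.
  intros Hf Hg eps He.
  destruct (Hf (eps / 2) ltac:(lra)) as [N HN], (Hg (eps / 2) ltac:(lra)) as [M HM].
  exists (Rmax N M); intros t Ht; pose proof (Rmax_l N M); pose proof (Rmax_r N M).
  specialize (HN t ltac:(lra)); specialize (HM t ltac:(lra)).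
  eapply Rle_trans; [apply Rabs_triang | lra].
Qed.

Lemma vanishing_nondecr_nonpos (f : R -> R) (a : R) :
  (forall s t, a <= s <= t -> f s <= f t) -> vanishing f -> forall t, a <= t -> f t <= 0.
Proof.
  intros Hm Hv t Ht.
  destruct (Rle_lt_dec (f t) 0) as [|Hc]; [assumption|exfalso].
  destruct (Hv (f t / 2) ltac:(lra)) as [N HN].
  set (s := Rmax N t); specialize (HN s (Rmax_l N t)).
  specialize (Hm t s ltac:(split; [lra | apply Rmax_r])).
  apply Rabs_le_between in HN; lra.
Qed.

(** In each product the function decays exponentially, and the slope is bounded because it is
    nonpositive and nondecreasing on the tail. *)
Lemma wronskian_tail_bound (q r u u1 v v1 : R -> R) (a b : R) :
  Sol q u u1 -> Sol r v v1 ->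
  (forall t, a <= t -> 1 <= q t) -> (forall t, b <= t -> 1 <= r t) ->
  (forall t, a <= t -> 0 < u t) -> (forall t, b <= t -> 0 < v t) ->
  (forall t, a <= t -> u1 t <= 0) -> (forall t, b <= t -> v1 t <= 0) ->
  vanishing (fun t => u t * v1 t - u1 t * v t).
Proof.
  intros Hu Hv Hq Hr Hpu Hpv Hnu Hnv.
  destruct (tail_bounds q u u1 a Hu Hq Hpu Hnu) as [C [HC0 HC]].
  destruct (tail_bounds r v v1 b Hv Hr Hpv Hnv) as [D [HD0 HD]].
  apply vanishing_of_exp with (2 * C * D) (Rmax a b); [nra|].
  intros t Ht; pose proof (Rmax_l a b); pose proof (Rmax_r a b).
  destruct (HC t ltac:(lra)) as [HC1 HC2], (HD t ltac:(lra)) as [HD1 HD2].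
  pose proof (exp_pos (- t)).
  unfold Rminus; eapply Rle_trans; [apply Rabs_triang|].
  rewrite Rabs_Ropp, !Rabs_mult.
  apply Rle_trans with (C * exp (- t) * D + C * (D * exp (- t))); [|right; ring].
  apply Rplus_le_compat; apply Rmult_le_compat; auto using Rabs_pos.
Qed.

(* Compare with [y x = x e^(M x)], which vanishes at [t - 1] and satisfies [y'' >= M y]. *)
Lemma harnack (q u u1 : R -> R) (t M : R) :
  Sol q u u1 -> 0 <= M -> (forall s, t - 1 <= s <= t -> q s <= M) ->
  (forall s, t - 1 <= s <= t -> 0 < u s) -> u1 t <= (1 + M) * u t.
Proof.
  intros Hu HM Hq Hp.
  set (W := fun s => u s * ((1 + M * (s - t + 1)) * exp (M * (s - t + 1)))
                   - u1 s * ((s - t + 1) * exp (M * (s - t + 1)))).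
  assert (H : W (t - 1) <= W t).
  { apply (le_of_derive_nonneg W (fun s => u s * exp (M * (s - t + 1)) *
      (2 * M + (M * M - q s) * (s - t + 1)))); [lra| |].
    - intros s _; destruct (Hu s); unfold W; der; ring.
    - intros s Hs; specialize (Hq s Hs); specialize (Hp s Hs).
      apply Rmult_le_pos; [apply Rmult_le_pos; [lra | left; apply exp_pos]|].
      set (x := s - t + 1); assert (Hx : 0 <= x <= 1) by (unfold x; lra).
      assert (0 <= M * M * x) by (apply Rmult_le_pos; nra).
      assert (q s * x <= M * x) by (apply Rmult_le_compat_r; lra).
      assert (M * x <= M * 1) by (apply Rmult_le_compat_l; lra).
      lra. }
  unfold W in H.
  replace (t - 1 - t + 1) with 0 in H by ring.
  replace (t - t + 1) with 1 in H by ring.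
  rewrite Rmult_0_r, exp_0, !Rmult_1_r in H.
  specialize (Hp (t - 1) ltac:(lra)).
  pose proof (exp_pos M).
  assert (0 <= exp M * ((1 + M) * u t - u1 t)) by nra.
  nra.
Qed.

(* Compare with [(1 - s^2)^2], whose second derivative is at least [-5] times itself. *)
Lemma no_positive_Sol (q u u1 : R -> R) :
  Sol q u u1 -> (forall s, -1 <= s <= 1 -> q s < -5) -> ~ (forall s, -1 <= s <= 1 -> 0 < u s).
Proof.
  intros Hu Hq Hp.
  set (W := fun s => u s * (-4 * s * (1 - s ^ 2)) - u1 s * (1 - s ^ 2) ^ 2).
  assert (H : W (-1) < W 1).
  { apply (lt_of_derive_pos W (fun s => u s * (-4 + 12 * s ^ 2 - q s * (1 - s ^ 2) ^ 2))); [lra| |].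
    - intros s _; destruct (Hu s); unfold W; der; ring.
    - intros s Hs; specialize (Hq s ltac:(lra)); specialize (Hp s ltac:(lra)).
      apply Rmult_lt_0_compat; [exact Hp|].
      pose proof (pow2_ge_0 (1 - s ^ 2)).
      pose proof (pow2_ge_0 (5 * (1 - s ^ 2) - 6)).
      assert (5 * (1 - s ^ 2) ^ 2 <= - q s * (1 - s ^ 2) ^ 2) by (apply Rmult_le_compat_r; lra).
      nra. }
  unfold W in H; lra.
Qed.

(** * Ground states *)

(* Energies of positive solutions are at most [M + 5]; the constant 7 keeps [V - lam >= 1] far out
   even when such an energy is raised by 1. *)
Record well (V : R -> R) (M T : R) : Prop := {
  well_cont : forall t, continuous V t;
  well_ivp : forall lam y0 y1,
    exists u u1, Sol (fun t => V t - lam) u u1 /\ u 0 = y0 /\ u1 0 = y1;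
  well_ge0 : forall t, 0 <= V t;
  well_le : forall t, -1 <= t <= 1 -> V t <= M;
  well_T : 0 < T;
  well_large : forall t, T <= Rabs t -> M + 7 <= V t }.

(** The value at 0 is normalised so that, for a given energy, only the slope at 0 varies; that slope
    is the parameter in the compactness argument. *)
Definition positive_energy (V : R -> R) (lam : R) : Prop :=
  exists u u1, Sol (fun t => V t - lam) u u1 /\ u 0 = 1 /\ forall t, 0 < u t.

Lemma well_reflect (V : R -> R) (M T : R) : well V M T -> well (fun t => V (- t)) M T.
Proof.
  intros [H1 H2 H3 H4 H5 H6]; split; auto.
  - apply continuous_reflect, H1.
  - intros lam y0 y1; destruct (H2 lam y0 (- y1)) as [u [u1 [Hu [H0 H01]]]].
    exists (fun t => u (- t)), (fun t => - u1 (- t)); split; [|split].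
    + apply (Sol_reflect _ _ _ Hu).
    + rewrite Ropp_0; exact H0.
    + rewrite Ropp_0, H01; ring.
  - intros t Ht; apply H4; lra.
  - intros t Ht; apply H6; rewrite Rabs_Ropp; exact Ht.
Qed.

Lemma positive_energy_reflect (V : R -> R) (lam : R) :
  positive_energy V lam -> positive_energy (fun t => V (- t)) lam.
Proof.
  intros [u [u1 [Hu [H0 Hp]]]]; exists (fun t => u (- t)), (fun t => - u1 (- t)).
  split; [apply (Sol_reflect _ _ _ Hu)|]; split; [rewrite Ropp_0; exact H0 | intros t; apply Hp].
Qed.

Lemma Sol_pos_left (q u u1 : R -> R) (a : R) : Sol q u u1 ->
  (forall t, t <= a -> 0 <= q t) -> 0 < u a -> u1 a <= 0 -> forall t, t <= a -> 0 < u t.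
Proof.
  intros Hu Hq Ha Ha1 t Ht.
  pose proof (Sol_pos_right _ _ _ (- a) (Sol_reflect _ _ _ Hu)) as H; cbv beta in H.
  rewrite Ropp_involutive in H.
  specialize (H ltac:(intros s Hs; apply Hq; lra) Ha ltac:(lra) (- t) ltac:(lra)).
  rewrite Ropp_involutive in H; exact H.
Qed.

Lemma derive_at_zero_min (f : R -> R) (t l : R) :
  (forall s, 0 <= f s) -> f t = 0 -> is_derive f t l -> l = 0.
Proof.
  intros Hp H0 Hd; apply is_derive_Reals in Hd.
  set (pr := exist _ l Hd : derivable_pt f t).
  change l with (derive_pt f t pr).
  apply (deriv_minimum f (t - 1) (t + 1)); try lra.
  intros x _ _; rewrite H0; apply Hp.
Qed.

Lemma continuous_pos_lower_bound (f : R -> R) (a b : R) :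
  (forall t, continuous f t) -> (forall t, a <= t <= b -> 0 < f t) ->
  exists m, 0 < m /\ forall t, a <= t <= b -> m <= f t.
Proof.
  intros Hf Hp; destruct (Rle_lt_dec a b) as [Hab|Hab].
  - destruct (continuity_ab_min f a b Hab) as [x [Hx Hxab]].
    + intros c _; apply continuity_pt_filterlim, Hf.
    + exists (f x); split; [apply Hp, Hxab | exact Hx].
  - exists 1; split; [lra | intros; lra].
Qed.

Lemma lipschitz_of_derive (f f' : R -> R) (a b M : R) : a <= b ->
  (forall t, a <= t <= b -> is_derive f t (f' t)) ->
  (forall t, a <= t <= b -> Rabs (f' t) <= M) -> Rabs (f b - f a) <= M * (b - a).
Proof.
  intros Hab Hd HM.
  assert (H1 : M * a - f a <= M * b - f b).
  { apply (le_of_derive_nonneg (fun t => M * t - f t) (fun t => M - f' t)); auto.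
    - intros t Ht; specialize (Hd t Ht); der; ring.
    - intros t Ht; specialize (HM t Ht); apply Rabs_le_between in HM; lra. }
  assert (H2 : M * a + f a <= M * b + f b).
  { apply (le_of_derive_nonneg (fun t => M * t + f t) (fun t => M + f' t)); auto.
    - intros t Ht; specialize (Hd t Ht); der; ring.
    - intros t Ht; specialize (HM t Ht); apply Rabs_le_between in HM; lra. }
  apply Rabs_le; lra.
Qed.

Lemma const_of_derive_0 (f : R -> R) : (forall t, is_derive f t 0) -> forall s t, f s = f t.
Proof.
  intros Hd.
  assert (H : forall s t, s <= t -> f s = f t).
  { intros s t Hst; pose proof (lipschitz_of_derive f (fun _ => 0) s t 0 Hst (fun x _ => Hd x)
      (fun _ _ => Req_le _ _ Rabs_R0)) as H.
    rewrite Rmult_0_l in H.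
    apply Rabs_le_between in H; lra. }
  intros s t; destruct (Rle_lt_dec s t); [apply H; lra | symmetry; apply H; lra].
Qed.

Lemma wronskian_const (q u u1 v v1 : R -> R) : Sol q u u1 -> Sol q v v1 ->
  forall t, u t * v1 t - u1 t * v t = u 0 * v1 0 - u1 0 * v 0.
Proof.
  intros Hu Hv t; apply (const_of_derive_0 (fun t => u t * v1 t - u1 t * v t)).
  intros r; eapply is_derive_eq; [apply (Sol_wronskian q q u u1 v v1 Hu Hv)|ring].
Qed.

Section GroundState.
Variables (V : R -> R) (M T : R).
Hypothesis HV : well V M T.

Lemma well_M_nonneg : 0 <= M.
Proof. pose proof (well_ge0 _ _ _ HV 0); pose proof (well_le _ _ _ HV 0 ltac:(lra)); lra. Qed.

Lemma continuous_minus_const (lam t : R) : continuous (fun t : R => V t - lam) t.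
Proof.
  apply (continuous_minus V (fun _ => lam)); [apply (well_cont _ _ _ HV) | apply continuous_const].
Qed.

Lemma positive_energy_0 : positive_energy V 0.
Proof.
  destruct (well_ivp _ _ _ HV 0 1 0) as [u [u1 [Hu [H0 H01]]]].
  exists u, u1; split; [exact Hu|]; split; [exact H0|].
  assert (Hq : forall t, 0 <= V t - 0) by (intros t; pose proof (well_ge0 _ _ _ HV t); lra).
  intros t; destruct (Rle_lt_dec 0 t).
  - apply (Sol_pos_right _ u u1 0 Hu); auto; lra.
  - apply (Sol_pos_left _ u u1 0 Hu); auto; lra.
Qed.

Lemma positive_energy_le (lam : R) : positive_energy V lam -> lam <= M + 5.
Proof.
  intros [u [u1 [Hu [_ Hp]]]].
  destruct (Rle_lt_dec lam (M + 5)) as [|Hc]; [assumption|exfalso].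
  apply (no_positive_Sol _ _ _ Hu); [|auto].
  intros s Hs; pose proof (well_le _ _ _ HV s Hs); lra.
Qed.

(** Harnack at 0, for [u] and for its reflection, confines the slopes of positive solutions to a
    compact interval. The lower bound -1 leaves room for energies slightly below the nonnegative
    supremum. *)
Lemma positive_slope_bound (lam : R) (u u1 : R -> R) :
  -1 <= lam -> Sol (fun t => V t - lam) u u1 -> u 0 = 1 -> (forall t, 0 < u t) ->
  - (M + 2) <= u1 0 <= M + 2.
Proof.
  intros Hl Hu H0 Hp; pose proof well_M_nonneg; split.
  - pose proof (harnack _ _ _ 0 (M + 1) (Sol_reflect _ _ _ Hu)) as H1; cbv beta in H1.
    rewrite Ropp_0, H0 in H1.
    enough (- u1 0 <= (1 + (M + 1)) * 1) by lra; apply H1; [lra| |auto].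
    intros s Hs; pose proof (well_le _ _ _ HV (- s) ltac:(lra)); lra.
  - pose proof (harnack _ _ _ 0 (M + 1) Hu) as H1; rewrite H0 in H1.
    enough (u1 0 <= (1 + (M + 1)) * 1) by lra; apply H1; [lra| |auto].
    intros s Hs; pose proof (well_le _ _ _ HV s ltac:(lra)); lra.
Qed.

(** The slopes at 0 of positive solutions with energies tending to the supremum accumulate at some
    [c]. The solution with data [(1, c)] is a limit of positive ones, hence nonnegative; a zero
    would be a minimum, thus a double zero, and the solution would vanish identically. *)
Lemma positive_energy_lub (lam : R) : is_lub (positive_energy V) lam -> positive_energy V lam.
Proof.
  intros [Hub Hl].
  assert (Hl0 : 0 <= lam) by apply Hub, positive_energy_0.
  set (P := fun (n : nat) (p : R * R) => lam - / (INR n + 1) < fst p <= lam /\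
    exists u u1, Sol (fun t => V t - fst p) u u1 /\ u 0 = 1 /\ u1 0 = snd p /\ forall t, 0 < u t).
  assert (HP : forall n, exists p, P n p).
  { intros n.
    assert (Hn : 0 < / (INR n + 1)) by (apply Rinv_0_lt_compat; pose proof (pos_INR n); lra).
    destruct (classic (exists l, positive_energy V l /\ lam - / (INR n + 1) < l)) as [[l [Hpl Hll]]|Hne].
    - pose proof (Hub l Hpl) as Hle; destruct Hpl as [u [u1 [Hu [H0 Hp]]]].
      exists (l, u1 0); split; [simpl; lra|]; exists u, u1; simpl; auto.
    - exfalso; enough (lam <= lam - / (INR n + 1)) by lra.
      apply Hl; intros l Hpl; destruct (Rle_lt_dec l (lam - / (INR n + 1))); auto.
      exfalso; apply Hne; exists l; auto. }
  destruct (functional_choice P HP) as [f Hf].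
  destruct (Bolzano_Weierstrass (fun n => snd (f n)) (fun c => - (M + 2) <= c <= M + 2)) as [c Hc].
  { apply compact_P3. }
  { intros n; destruct (Hf n) as [Hn [u [u1 [Hu [H0 [H1 Hp]]]]]]; rewrite <- H1.
    apply (positive_slope_bound (fst (f n)) u u1); auto.
    enough (/ (INR n + 1) <= 1) by lra.
    rewrite <- Rinv_1; apply Rinv_le_contravar; [lra|]; pose proof (pos_INR n); lra. }
  destruct (well_ivp _ _ _ HV lam 1 c) as [u [u1 [Hu [H0 H1]]]].
  exists u, u1; split; [exact Hu|]; split; [exact H0|].
  assert (Hnn : forall t, 0 <= u t).
  { intros t; destruct (Rle_lt_dec 0 (u t)) as [|Hneg]; [assumption|exfalso].
    destruct (Sol_stability _ u u1 (Rabs t) (- u t / 2) (continuous_minus_const lam) Hu ltac:(lra))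
      as [d [Hd HS]].
    destruct (INR_unbounded (/ d)) as [N HN].
    destruct (Hc (disc c (mkposreal d Hd)) N) as [n [Hn Hnc]].
    { exists (mkposreal d Hd); intros x Hx; exact Hx. }
    destruct (Hf n) as [Hn1 [v [v1 [Hv [Hv0 [Hv1 Hvp]]]]]].
    unfold disc in Hnc; simpl in Hnc.
    assert (Hdn : / (INR n + 1) <= d).
    { rewrite <- (Rinv_inv d); apply Rinv_le_contravar; [apply Rinv_0_lt_compat, Hd|].
      apply le_INR in Hn; lra. }
    destruct (HS _ _ _ Hv) with (t := t) as [Ha _].
    - intros s _; replace (V s - fst (f n) - (V s - lam)) with (lam - fst (f n)) by ring.
      rewrite Rabs_pos_eq; lra.
    - rewrite Hv0, H0, Rminus_eq_0, Rabs_R0; lra.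
    - rewrite Hv1, H1; lra.
    - apply (proj1 (Rabs_le_between _ _)), Rle_refl.
    - apply Rabs_le_between in Ha; specialize (Hvp t); lra. }
  intros t; destruct (Hnn t) as [|Hz]; [assumption|exfalso].
  assert (H1z : u1 t = 0) by (apply (derive_at_zero_min u t); auto; apply Hu).
  pose proof (Sol_unique_zero _ u u1 t (continuous_minus_const lam) Hu (eq_sym Hz) H1z 0); lra.
Qed.

Lemma lub_exists : exists lam, is_lub (positive_energy V) lam /\ 0 <= lam <= M + 5.
Proof.
  destruct (completeness (positive_energy V)) as [lam Hlam].
  - exists (M + 5); intros l; apply positive_energy_le.
  - exists 0; apply positive_energy_0.
  - exists lam; split; [exact Hlam|]; destruct Hlam as [Hub Hl]; split.
    + apply Hub, positive_energy_0.
    + apply Hl; intros l; apply positive_energy_le.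
Qed.

Variable lam : R.
Hypothesis Hlub : is_lub (positive_energy V) lam.

Lemma lub_le : lam <= M + 5.
Proof. apply Hlub; intros l; apply positive_energy_le. Qed.

Lemma potential_ge (l t : R) : l <= M + 6 -> T <= Rabs t -> 1 <= V t - l.
Proof. intros Hl Ht; pose proof (well_large _ _ _ HV t Ht); lra. Qed.

(* Growth at both ends is stable, hence would allow a slightly larger energy. *)
Lemma not_growing_both (u u1 : R -> R) (t1 t2 : R) :
  Sol (fun t => V t - lam) u u1 -> u 0 = 1 -> (forall t, 0 < u t) ->
  T <= t1 -> t2 <= - T -> 0 < u1 t1 -> 0 <= u1 t2.
Proof.
  intros Hu H0 Hp Ht1 Ht2 Hg1.
  destruct (Rle_lt_dec 0 (u1 t2)) as [|Hg2]; [assumption|exfalso].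
  pose proof lub_le as Hle; pose proof (well_T _ _ _ HV) as HT.
  set (L := Rmax t1 (- t2)).
  pose proof (Rmax_l t1 (- t2)) as HL1; pose proof (Rmax_r t1 (- t2)) as HL2; fold L in HL1, HL2.
  destruct (continuous_pos_lower_bound u (- L) L) as [m [Hm0 Hm]];
    [apply (Sol_continuous _ _ _ Hu) | auto |].
  set (eta := Rmin (m / 2) (Rmin (u1 t1) (- u1 t2) / 2)).
  assert (Heta : 0 < eta).
  { apply Rmin_pos; [lra|]; enough (0 < Rmin (u1 t1) (- u1 t2)) by lra; apply Rmin_pos; lra. }
  assert (Heta1 : eta <= m / 2) by apply Rmin_l.
  assert (Heta2 : eta <= Rmin (u1 t1) (- u1 t2) / 2) by apply Rmin_r.
  pose proof (Rmin_l (u1 t1) (- u1 t2)); pose proof (Rmin_r (u1 t1) (- u1 t2)).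
  destruct (Sol_stability _ u u1 L eta (continuous_minus_const lam) Hu Heta) as [d [Hd HS]].
  set (e := Rmin d 1).
  assert (He : 0 < e) by (apply Rmin_pos; lra).
  assert (Hed : e <= d) by apply Rmin_l. assert (He1 : e <= 1) by apply Rmin_r.
  destruct (well_ivp _ _ _ HV (lam + e) 1 (u1 0)) as [w [w1 [Hw [Hw0 Hw1]]]].
  assert (HSw : forall t, - L <= t <= L -> Rabs (w t - u t) <= eta /\ Rabs (w1 t - u1 t) <= eta).
  { apply (HS _ w w1 Hw).
    - intros t _; replace (V t - (lam + e) - (V t - lam)) with (- e) by ring.
      rewrite Rabs_Ropp, Rabs_pos_eq; lra.
    - rewrite Hw0, H0, Rminus_eq_0, Rabs_R0; lra.
    - rewrite Hw1, Rminus_eq_0, Rabs_R0; lra. }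
  assert (Hmid : forall t, - L <= t <= L -> 0 < w t).
  { intros t Ht; destruct (HSw t Ht) as [Ha _]; specialize (Hm t Ht).
    apply Rabs_le_between in Ha; lra. }
  assert (Hpe : positive_energy V (lam + e)).
  { exists w, w1; split; [exact Hw|]; split; [exact Hw0|].
    intros t; destruct (Rle_lt_dec t1 t) as [Hr|Hr]; [|destruct (Rle_lt_dec t t2) as [Hs|Hs]].
    - apply (Sol_pos_right _ w w1 t1 Hw); auto.
      + intros s Hs; pose proof (potential_ge (lam + e) s ltac:(lra)) as Hq.
        rewrite Rabs_pos_eq in Hq by lra; specialize (Hq ltac:(lra)); lra.
      + apply Hmid; lra.
      + destruct (HSw t1 ltac:(lra)) as [_ Ha]; apply Rabs_le_between in Ha; lra.
    - apply (Sol_pos_left _ w w1 t2 Hw); auto.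
      + intros r Hr2; pose proof (potential_ge (lam + e) r ltac:(lra)) as Hq.
        rewrite Rabs_left1 in Hq by lra; specialize (Hq ltac:(lra)); lra.
      + apply Hmid; lra.
      + destruct (HSw t2 ltac:(lra)) as [_ Ha]; apply Rabs_le_between in Ha; lra.
    - apply Hmid; lra. }
  pose proof (proj1 Hlub _ Hpe); lra.
Qed.

(* If [u] grew at [+oo], it would decay at [-oo], and so would every small perturbation of it
   by another solution; but two solutions decaying at the same end are proportional. *)
Lemma decays_right (u u1 : R -> R) :
  Sol (fun t => V t - lam) u u1 -> u 0 = 1 -> (forall t, 0 < u t) ->
  forall t, T <= t -> u1 t <= 0.
Proof.
  intros Hu H0 Hp t1 Ht1.
  destruct (Rle_lt_dec (u1 t1) 0) as [|Hg]; [assumption|exfalso].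
  pose proof lub_le as Hle; pose proof (well_T _ _ _ HV) as HT.
  destruct (well_ivp _ _ _ HV lam 0 1) as [psi [psi1 [Hpsi [Hpsi0 Hpsi1]]]].
  destruct (Sol_continuous _ _ _ Hpsi) as [Hc Hc1].
  destruct (continuous_bounded psi 0 t1 Hc) as [K [HK0 HK]].
  destruct (continuous_bounded psi1 0 t1 Hc1) as [K1 [HK10 HK1]].
  destruct (continuous_pos_lower_bound u 0 t1) as [m [Hm0 Hm]];
    [apply (Sol_continuous _ _ _ Hu) | auto |].
  assert (Hw : forall t, u t * psi1 t - u1 t * psi t = 1).
  { intros t; rewrite (wronskian_const _ _ _ _ _ Hu Hpsi), H0, Hpsi0, Hpsi1; ring. }
  (* [psi / u] has derivative [/ u ^ 2] because the Wronskian is 1, so it increases through 0.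
     Subtracting [e * psi] from [u] therefore keeps it positive on the left. *)
  assert (Hneg : forall t, t <= 0 -> psi t <= 0).
  { intros t Ht.
    assert (Hr : psi t / u t <= psi 0 / u 0).
    { apply (le_of_derive_nonneg (fun t => psi t / u t) (fun t => / (u t) ^ 2)); [lra| |].
      - intros s _; destruct (Hu s), (Hpsi s); pose proof (Hp s); der; [lra|].
        specialize (Hw s); replace (psi1 s * u s - psi s * u1 s) with 1 by lra; field; lra.
      - intros s _; left; apply Rinv_0_lt_compat, pow_lt, Hp. }
    rewrite Hpsi0 in Hr; unfold Rdiv in Hr; rewrite Rmult_0_l in Hr.
    pose proof (Rinv_0_lt_compat _ (Hp t)); nra. }
  set (e := Rmin m (u1 t1) / (2 * (K + K1 + 1))).
  assert (Hmin : 0 < Rmin m (u1 t1)) by (apply Rmin_pos; lra).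
  assert (He : 0 < e) by (apply Rdiv_lt_0_compat; lra).
  assert (HeK : e * (K + K1 + 1) = Rmin m (u1 t1) / 2) by (unfold e; field; lra).
  pose proof (Rmin_l m (u1 t1)); pose proof (Rmin_r m (u1 t1)).
  set (w := fun t => 1 * u t + (- e) * psi t); set (w1 := fun t => 1 * u1 t + (- e) * psi1 t).
  assert (Hws : Sol (fun t => V t - lam) w w1) by (apply Sol_lincomb; assumption).
  assert (Hw0 : w 0 = 1) by (unfold w; rewrite H0, Hpsi0; ring).
  assert (Hmid : forall t, 0 <= t <= t1 -> 0 < w t).
  { intros t Ht; specialize (HK t Ht); specialize (Hm t Ht); unfold w.
    apply Rabs_le_between in HK. nra. }
  assert (Hw1 : 0 < w1 t1).
  { specialize (HK1 t1 ltac:(lra)); unfold w1; apply Rabs_le_between in HK1; nra. }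
  assert (Hwp : forall t, 0 < w t).
  { intros t; destruct (Rle_lt_dec t 0) as [Hr|Hr]; [|destruct (Rle_lt_dec t t1) as [Hs|Hs]].
    - specialize (Hneg t Hr); specialize (Hp t); unfold w; nra.
    - apply Hmid; lra.
    - apply (Sol_pos_right _ w w1 t1 Hws); try lra; [|apply Hmid; lra].
      intros s Hs'; pose proof (potential_ge lam s ltac:(lra)) as Hq.
      rewrite Rabs_pos_eq in Hq by lra; specialize (Hq ltac:(lra)); lra. }
  pose proof (fun t Ht => not_growing_both u u1 t1 t Hu H0 Hp Ht1 Ht Hg) as Hl.
  pose proof (fun t Ht => not_growing_both w w1 t1 t Hws Hw0 Hwp Ht1 Ht Hw1) as Hlw.
  assert (Hq : forall t, T <= t -> 1 <= V (- t) - lam).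
  { intros t Ht; apply potential_ge; [lra|]; rewrite Rabs_Ropp, Rabs_pos_eq; lra. }
  destruct (wronskian_tail_bound _ _ _ _ _ _ T T (Sol_reflect _ _ _ Hu) (Sol_reflect _ _ _ Hws))
    with (eps := e / 2) as [N HN]; try lra; auto.
  - intros t Ht; specialize (Hl (- t)); lra.
  - intros t Ht; specialize (Hlw (- t)); lra.
  (* The Wronskian of the reflected pair is the constant [e], whereas decay of both functions would
     make it at most [e / 2]. *)
  - specialize (HN N (Rle_refl N)).
    replace (u (- N) * - w1 (- N) - - u1 (- N) * w (- N)) with
      (e * (u (- N) * psi1 (- N) - u1 (- N) * psi (- N))) in HN by (unfold w, w1; ring).
    rewrite Hw, Rabs_pos_eq in HN; lra.
Qed.

End GroundState.

(** Extremality of [lam] is not recorded: positivity and monotone tails determine [lam] as the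
    lowest eigenvalue, by Sturm comparison. *)
Record ground (V : R -> R) (T lam : R) (u u1 : R -> R) : Prop := {
  ground_sol : Sol (fun t => V t - lam) u u1;
  ground_0 : u 0 = 1;
  ground_pos : forall t, 0 < u t;
  ground_right : forall t, T <= t -> u1 t <= 0;
  ground_left : forall t, t <= - T -> 0 <= u1 t }.

Lemma ground_reflect (V : R -> R) (T lam : R) (u u1 : R -> R) : ground V T lam u u1 ->
  ground (fun t => V (- t)) T lam (fun t => u (- t)) (fun t => - u1 (- t)).
Proof.
  intros [H1 H2 H3 H4 H5]; split; auto.
  - apply (Sol_reflect _ _ _ H1).
  - rewrite Ropp_0; exact H2.
  - intros t Ht; specialize (H5 (- t) ltac:(lra)); lra.
  - intros t Ht; specialize (H4 (- t) ltac:(lra)); lra.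
Qed.

Lemma ground_exists (V : R -> R) (M T : R) : well V M T ->
  exists lam u u1, ground V T lam u u1 /\ 0 <= lam <= M + 5.
Proof.
  intros HV; destruct (lub_exists V M T HV) as [lam [Hlub Hl]].
  destruct (positive_energy_lub V M T HV lam Hlub) as [u [u1 [Hu [H0 Hp]]]].
  exists lam, u, u1; split; [|exact Hl]; split; auto.
  - apply (decays_right V M T HV lam Hlub u u1 Hu H0 Hp).
  - intros t Ht.
    assert (Hlub' : is_lub (positive_energy (fun t => V (- t))) lam).
    { assert (E : forall l, positive_energy (fun t => V (- t)) l -> positive_energy V l).
      { intros l Hl'; apply positive_energy_reflect in Hl'.
        destruct Hl' as [v [v1 [Hv Hv']]]; exists v, v1; split; [|exact Hv'].
        apply (Sol_ext (fun t => V (- - t) - l)); [intros s; rewrite Ropp_involutive; reflexivity|].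
        exact Hv. }
      split.
      - intros l Hpl; apply (proj1 Hlub), E, Hpl.
      - intros b Hb; apply (proj2 Hlub); intros l Hpl; apply Hb, positive_energy_reflect, Hpl. }
    pose proof (decays_right _ M T (well_reflect _ _ _ HV) lam Hlub' _ _ (Sol_reflect _ _ _ Hu)) as H.
    cbv beta in H; rewrite Ropp_0 in H.
    specialize (H H0 ltac:(auto) (- t) ltac:(lra)); rewrite Ropp_involutive in H; lra.
Qed.

(** * Improper integrals of exponentially dominated functions *)

Lemma ex_RInt_cont (f : R -> R) (a b : R) : (forall t, continuous f t) -> ex_RInt f a b.
Proof. intros H; apply (ex_RInt_continuous (V := R_CompleteNormedModule)); intros; apply H. Qed.

Lemma eq_of_exp_close (x y K : R) : (forall N, 0 <= N -> Rabs (x - y) <= K * exp (- N)) -> x = y.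
Proof.
  intros H.
  destruct (Req_dec x y) as [|Hne]; [assumption|exfalso].
  assert (Hp : 0 < Rabs (x - y)) by (apply Rabs_pos_lt; lra).
  assert (HK : 0 <= K).
  { specialize (H 0 (Rle_refl 0)); rewrite Ropp_0, exp_0 in H; lra. }
  destruct (exp_small K (Rabs (x - y) / 2) HK ltac:(lra)) as [N [HN0 HN]].
  specialize (H N HN0); specialize (HN N (Rle_refl N)); lra.
Qed.

Lemma RInt_split (f : R -> R) (a b c : R) :
  (forall t, continuous f t) -> RInt f a c = RInt f a b + RInt f b c.
Proof. intros H; symmetry; apply (RInt_Chasles f a b c); apply ex_RInt_cont, H. Qed.

Lemma RInt_Rconst (c a b : R) : RInt (fun _ => c) a b = (b - a) * c.
Proof. apply (RInt_const (V := R_CompleteNormedModule)). Qed.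

Lemma RInt_minus_cont (f g : R -> R) (a b : R) :
  (forall t, continuous f t) -> (forall t, continuous g t) ->
  RInt (fun t => f t - g t) a b = RInt f a b - RInt g a b.
Proof. intros Hf Hg; apply (RInt_minus f g); apply ex_RInt_cont; auto. Qed.

Lemma RInt_tail_bound (f : R -> R) (C a b : R) : (forall t, continuous f t) ->
  0 <= a <= b -> (forall t, 0 <= t -> Rabs (f t) <= C * exp (- t)) ->
  Rabs (RInt f a b) <= C * exp (- a).
Proof.
  intros Hf Hab Hd.
  assert (HC : 0 <= C).
  { specialize (Hd 0 (Rle_refl 0)); rewrite Ropp_0, exp_0 in Hd.
    pose proof (Rabs_pos (f 0)); lra. }
  apply Rle_trans with (- C * exp (- b) - - C * exp (- a)).
  - apply (norm_RInt_le f (fun t => C * exp (- t)) a b); [lra| | |].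
    + intros t Ht; apply Hd; lra.
    + apply (RInt_correct (V := R_CompleteNormedModule)), ex_RInt_cont, Hf.
    + apply (is_RInt_derive (V := R_CompleteNormedModule) (fun t => - C * exp (- t)) (fun t => C * exp (- t))).
      * intros t _; der; ring.
      * intros t _; apply (ex_derive_continuous (fun t => C * exp (- t))); auto_derive; auto.
  - pose proof (exp_pos (- b)); nra.
Qed.

(** The limit runs along the integers; for continuous exponentially dominated [f] the explicit error
    bound below holds at every real endpoint and justifies [real]. *)
Definition half_integral (f : R -> R) : R := real (Lim_seq (fun n => RInt f 0 (INR n))).

Lemma half_integral_spec (f : R -> R) (C : R) : (forall t, continuous f t) ->
  (forall t, 0 <= t -> Rabs (f t) <= C * exp (- t)) ->
  forall t, 0 <= t -> Rabs (RInt f 0 t - half_integral f) <= C * exp (- t).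
Proof.
  intros Hf Hd.
  assert (HC : 0 <= C).
  { specialize (Hd 0 (Rle_refl 0)); rewrite Ropp_0, exp_0 in Hd.
    pose proof (Rabs_pos (f 0)); lra. }
  assert (Hdiff : forall s t, 0 <= s <= t -> Rabs (RInt f 0 t - RInt f 0 s) <= C * exp (- s)).
  { intros s t Hst.
    rewrite (RInt_split f 0 s t Hf).
    assert (E : forall x y : R, x + y - x = y) by (intros; ring); rewrite E.
    apply RInt_tail_bound; auto. }
  assert (Hlim : is_lim_seq (fun n => RInt f 0 (INR n)) (half_integral f)).
  { apply Lim_seq_correct', ex_lim_seq_cauchy_corr.
    intros eps; destruct (exp_small C (eps / 2) HC) as [N [HN0 HN]].
    { destruct eps; simpl; lra. }
    destruct (INR_unbounded N) as [n0 Hn0]; exists n0; intros n m Hn Hm.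
    apply le_INR in Hn, Hm.
    pose proof (Hdiff (INR n0) (INR n) ltac:(lra)); pose proof (Hdiff (INR n0) (INR m) ltac:(lra)).
    specialize (HN (INR n0) ltac:(lra)).
    apply Rle_lt_trans with (eps / 2); [|destruct eps; simpl; lra].
    assert (Hc : Rabs (RInt f 0 (INR n) - RInt f 0 (INR m)) <= C * exp (- Rmin (INR n) (INR m))).
    { unfold Rmin; destruct (Rle_dec (INR n) (INR m)).
      - rewrite Rabs_minus_sym; apply Hdiff; lra.
      - apply Hdiff; lra. }
    eapply Rle_trans; [exact Hc|]; apply Rle_trans with (C * exp (- INR n0)); [|lra].
    apply Rmult_le_compat_l; [lra|]; apply exp_mono, Ropp_le_contravar, Rmin_glb; lra. }
  intros t Ht; destruct (INR_unbounded t) as [n0 Hn0].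
  apply Rabs_le_between.
  apply is_lim_seq_incr_n with (N := n0) in Hlim.
  assert (Hb : forall n, RInt f 0 t - C * exp (- t) <= RInt f 0 (INR (n + n0)) <= RInt f 0 t + C * exp (- t)).
  { intros n; rewrite plus_INR; pose proof (pos_INR n).
    specialize (Hdiff t (INR n + INR n0) ltac:(lra)); apply Rabs_le_between in Hdiff; lra. }
  assert (H1 : RInt f 0 t - C * exp (- t) <= half_integral f).
  { apply (is_lim_seq_le (fun _ => RInt f 0 t - C * exp (- t)) _ (Finite _) (Finite _)
      (fun n => proj1 (Hb n)) (is_lim_seq_const _) Hlim). }
  assert (H2 : half_integral f <= RInt f 0 t + C * exp (- t)).
  { apply (is_lim_seq_le _ (fun _ => RInt f 0 t + C * exp (- t)) (Finite _) (Finite _)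
      (fun n => proj2 (Hb n)) Hlim (is_lim_seq_const _)). }
  lra.
Qed.

Definition integral (f : R -> R) : R := half_integral f + half_integral (fun t => f (- t)).

(** A single decay rate with an explicit constant: a family sharing [C] has uniformly small
    tails. *)
Definition dominated (f : R -> R) (C : R) : Prop :=
  (forall t, continuous f t) /\ forall t, Rabs (f t) <= C * exp (- Rabs t).

Lemma dominated_nonneg (f : R -> R) (C : R) : dominated f C -> 0 <= C.
Proof.
  intros [_ Hd]; specialize (Hd 0); rewrite Rabs_R0, Ropp_0, exp_0 in Hd.
  pose proof (Rabs_pos (f 0)); lra.
Qed.

Lemma dominated_reflect (f : R -> R) (C : R) : dominated f C -> dominated (fun t => f (- t)) C.
Proof.
  intros [Hc Hd]; split; [apply continuous_reflect, Hc|].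
  intros t; rewrite <- (Rabs_Ropp t); apply Hd.
Qed.

Lemma dominated_half (f : R -> R) (C t : R) : dominated f C -> 0 <= t ->
  Rabs (RInt f 0 t - half_integral f) <= C * exp (- t).
Proof.
  intros [Hc Hd]; apply half_integral_spec; auto.
  intros s Hs; rewrite <- (Rabs_pos_eq s) at 2 by exact Hs; apply Hd.
Qed.

Lemma RInt_reflect (f : R -> R) (a b : R) : (forall t, continuous f t) ->
  RInt (fun t => f (- t)) a b = RInt f (- b) (- a).
Proof.
  intros Hc; apply is_RInt_unique.
  assert (H : is_RInt f (- a) (- b) (- RInt f (- b) (- a))).
  { apply (is_RInt_swap f (- a) (- b)), (RInt_correct (V := R_CompleteNormedModule)), ex_RInt_cont, Hc. }
  apply (is_RInt_comp_opp f) in H.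
  apply (is_RInt_opp (fun y => opp (f (- y)))) in H.
  rewrite <- (Ropp_involutive (RInt f (- b) (- a))).
  eapply is_RInt_ext; [|exact H]; intros x _; unfold opp; simpl; ring.
Qed.

Lemma integral_spec (f : R -> R) (C N : R) : dominated f C -> 0 <= N ->
  Rabs (RInt f (- N) N - integral f) <= 2 * C * exp (- N).
Proof.
  intros Hd HN.
  pose proof (dominated_half f C N Hd HN) as H1.
  pose proof (dominated_half _ C N (dominated_reflect f C Hd) HN) as H2.
  rewrite RInt_reflect, Ropp_0 in H2 by apply Hd.
  rewrite (RInt_split f (- N) 0 N (proj1 Hd)); unfold integral.
  apply Rabs_le_between in H1, H2; apply Rabs_le_between; lra.
Qed.

Lemma integral_unique (f : R -> R) (C K l : R) : dominated f C ->
  (forall N, 0 <= N -> Rabs (RInt f (- N) N - l) <= K * exp (- N)) -> integral f = l.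
Proof.
  intros Hd Hl; apply eq_of_exp_close with (2 * C + K); intros N HN.
  pose proof (integral_spec f C N Hd HN) as H1; specialize (Hl N HN).
  apply Rabs_le_between in H1, Hl; apply Rabs_le_between; lra.
Qed.

Lemma dominated_scal (f : R -> R) (C a : R) :
  dominated f C -> dominated (fun t => a * f t) (Rabs a * C).
Proof.
  intros [Hc Hd]; split; [intros t; apply (continuous_scal_r a f); apply Hc|].
  intros t; rewrite Rabs_mult, Rmult_assoc; apply Rmult_le_compat_l; [apply Rabs_pos | apply Hd].
Qed.

Lemma dominated_minus (f g : R -> R) (C D : R) :
  dominated f C -> dominated g D -> dominated (fun t => f t - g t) (C + D).
Proof.
  intros [Hc Hd] [Kc Kd]; split; [intros t; apply (continuous_minus f g); auto|].
  intros t; unfold Rminus; eapply Rle_trans; [apply Rabs_triang|].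
  rewrite Rabs_Ropp, Rmult_plus_distr_r; apply Rplus_le_compat; auto.
Qed.

Lemma integral_scal (f : R -> R) (C a : R) :
  dominated f C -> integral (fun t => a * f t) = a * integral f.
Proof.
  intros Hd; apply (integral_unique _ _ (Rabs a * (2 * C)) _ (dominated_scal f C a Hd)).
  intros N HN.
  replace (RInt (fun t => a * f t) (- N) N) with (a * RInt f (- N) N).
  - rewrite <- Rmult_minus_distr_l, Rabs_mult, Rmult_assoc.
    apply Rmult_le_compat_l; [apply Rabs_pos | apply integral_spec; auto].
  - symmetry; apply (RInt_scal f), ex_RInt_cont, Hd.
Qed.

Lemma integral_minus (f g : R -> R) (C D : R) : dominated f C -> dominated g D ->
  integral (fun t => f t - g t) = integral f - integral g.
Proof.
  intros Hf Hg; apply (integral_unique _ _ (2 * C + 2 * D) _ (dominated_minus f g C D Hf Hg)).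
  intros N HN; rewrite RInt_minus_cont by (apply Hf || apply Hg).
  pose proof (integral_spec f C N Hf HN) as H1; pose proof (integral_spec g D N Hg HN) as H2.
  apply Rabs_le_between in H1, H2; apply Rabs_le_between; lra.
Qed.

Lemma integral_abs (f : R -> R) (C : R) : dominated f C -> Rabs (integral f) <= 2 * C.
Proof.
  intros Hd; pose proof (integral_spec f C 0 Hd (Rle_refl 0)) as H.
  rewrite Ropp_0, RInt_point, exp_0 in H; unfold zero in H; simpl in H.
  apply Rabs_le_between in H; apply Rabs_le_between; lra.
Qed.

Lemma integral_lower (f : R -> R) (C c : R) : dominated f C -> (forall t, 0 <= f t) ->
  (forall t, -1 <= t <= 1 -> c <= f t) -> 2 * c <= integral f.
Proof.
  intros Hd Hp Hc.
  apply Rnot_lt_le; intros Hlt.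
  pose proof (dominated_nonneg f C Hd) as HC.
  destruct (exp_small (2 * C) ((2 * c - integral f) / 2) ltac:(lra) ltac:(lra)) as [N0 [HN0 HN]].
  set (N := Rmax N0 1).
  pose proof (Rmax_l N0 1) as HNl; pose proof (Rmax_r N0 1) as HNr; fold N in HNl, HNr.
  specialize (HN N HNl).
  pose proof (integral_spec f C N Hd ltac:(lra)) as H.
  assert (Hcont : forall a b, ex_RInt f a b) by (intros; apply ex_RInt_cont, Hd).
  rewrite (RInt_split f (- N) (-1) N (proj1 Hd)), (RInt_split f (-1) 1 N (proj1 Hd)) in H.
  assert (H1 : 0 <= RInt f (- N) (-1)) by (apply RInt_ge_0; [lra | auto | auto]).
  assert (H2 : 0 <= RInt f 1 N) by (apply RInt_ge_0; [lra | auto | auto]).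
  assert (H3 : RInt (fun _ => c) (-1) 1 <= RInt f (-1) 1).
  { apply RInt_le; auto; [lra | apply ex_RInt_const |]. intros x Hx; apply Hc; lra. }
  rewrite RInt_Rconst in H3.
  apply Rabs_le_between in H; lra.
Qed.

Lemma integral_derive_0 (F f : R -> R) (C : R) : dominated f C ->
  (forall t, is_derive F t (f t)) -> vanishing F -> vanishing (fun t => F (- t)) ->
  integral f = 0.
Proof.
  intros Hd HF Hv1 Hv2.
  assert (HR : forall N, RInt f (- N) N = F N - F (- N)).
  { intros N; apply is_RInt_unique.
    apply (is_RInt_derive (V := R_CompleteNormedModule) F f); intros; [apply HF | apply Hd]. }
  destruct (Req_dec (integral f) 0) as [|Hne]; [assumption|exfalso].
  pose proof (Rabs_pos_lt _ Hne) as Hp.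
  (* Three errors of size [e], one from truncation and two from the boundary values, add up to half
     of [Rabs (integral f)]. *)
  set (e := Rabs (integral f) / 6) in *.
  assert (He : 0 < e) by (unfold e; lra).
  pose proof (dominated_nonneg f C Hd) as HC.
  destruct (exp_small (2 * C) e ltac:(lra) He) as [N0 [HN0 HN]].
  destruct (Hv1 e He) as [N1 H1], (Hv2 e He) as [N2 H2].
  set (N := Rmax N0 (Rmax N1 N2)).
  pose proof (Rmax_l N0 (Rmax N1 N2)) as K0; pose proof (Rmax_r N0 (Rmax N1 N2)) as K1.
  pose proof (Rmax_l N1 N2); pose proof (Rmax_r N1 N2); fold N in K0, K1.
  specialize (HN N ltac:(lra)); specialize (H1 N ltac:(lra)); specialize (H2 N ltac:(lra)).
  pose proof (integral_spec f C N Hd ltac:(lra)) as K2; rewrite HR in K2.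
  assert (Hl : Rabs (integral f) <= 3 * e).
  { apply Rabs_le_between in H1, H2, K2; apply Rabs_le_between; lra. }
  unfold e in Hl; lra.
Qed.

(** The filter is a parameter so that punctured neighbourhoods are allowed, as difference quotients
    in [b] require. *)
Definition locally_uniform (G : (R -> Prop) -> Prop) (F : R -> R -> R) (f : R -> R) : Prop :=
  forall N eps, 0 < eps -> G (fun b => forall t, - N <= t <= N -> Rabs (F b t - f t) <= eps).

(** Dominated convergence: the common constant [C] makes the integrals outside [[-N, N]] small for
    all [b] at once, and convergence is uniform inside. *)
Lemma integral_limit (G : (R -> Prop) -> Prop) {FG : Filter G} (F : R -> R -> R) (f : R -> R) (C : R) :
  G (fun b => dominated (F b) C) -> dominated f C -> locally_uniform G F f ->
  filterlim (fun b => integral (F b)) G (locally (integral f)).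
Proof.
  intros HF Hf Hu; apply filterlim_locally; intros eps.
  pose proof (dominated_nonneg f C Hf) as HC.
  assert (He : 0 < eps / 4) by (destruct eps; simpl; lra).
  destruct (exp_small (2 * C) (eps / 4) ltac:(lra) He) as [N [HN0 HN]].
  specialize (HN N (Rle_refl N)).
  (* The length of the interval is [2 * N]; the summand 1 keeps the divisor positive when
     [N = 0]. *)
  assert (Hd : 0 < eps / 4 / (2 * N + 1)) by (apply Rdiv_lt_0_compat; lra).
  generalize (filter_and _ _ HF (Hu N _ Hd)); apply filter_imp; intros b [Hb1 Hb2].
  unfold ball; simpl; unfold AbsRing_ball, abs, minus, plus, opp; simpl.
  pose proof (integral_spec f C N Hf HN0) as H1.
  pose proof (integral_spec _ C N Hb1 HN0) as H2.
  assert (H3 : Rabs (RInt (F b) (- N) N - RInt f (- N) N) <= eps / 4).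
  { rewrite <- RInt_minus_cont by (apply Hf || apply Hb1).
    eapply Rle_trans; [apply abs_RInt_le_const with (M := eps / 4 / (2 * N + 1)); [lra| |]|].
    - apply ex_RInt_cont; intros t; apply (continuous_minus (F b) f); [apply Hb1 | apply Hf].
    - exact Hb2.
    - apply Rle_trans with ((2 * N + 1) * (eps / 4 / (2 * N + 1))).
      + apply Rmult_le_compat_r; lra.
      + right; field; lra. }
  apply Rabs_le_between in H1, H2, H3.
  apply Rabs_lt_between; lra.
Qed.

(** * Eigenvalues lie above the ground state *)

(** Square integrability at +oo expressed through proper integrals, as the growth argument below
    uses it. *)
Definition tail_square_bounded (v : R -> R) : Prop :=
  exists N B, forall b, N <= b -> RInt (fun t => v t ^ 2) N b <= B.

Lemma continuous_sq (v : R -> R) : (forall t, continuous v t) ->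
  forall t, continuous (fun t : R => v t ^ 2) t.
Proof.
  intros H t; apply (continuous_ext (fun t => v t * v t)); [intros; simpl; ring|].
  apply (continuous_mult v v); apply H.
Qed.

Lemma square_integrable_tails (v : R -> R) : (forall t, continuous v t) ->
  square_integrable v -> tail_square_bounded v /\ tail_square_bounded (fun t => v (- t)).
Proof.
  intros Hc [l Hl].
  pose proof (continuous_sq v Hc) as Hc2.
  specialize (Hl (ball l 1) (locally_ball l (mkposreal 1 Rlt_0_1))).
  destruct Hl as [Q S [m HQ] [p HS] H].
  assert (Hb : forall a b, a < m -> p < b -> Rabs (RInt (fun t => v t ^ 2) a b - l) < 1).
  { intros a b Ha Hb; destruct (H a b (HQ a Ha) (HS b Hb)) as [y [Hy Hy']].
    rewrite (is_RInt_unique (V := R_CompleteNormedModule) _ _ _ _ Hy : RInt _ a b = y); exact Hy'. }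
  set (N := Rmax (Rabs m) (Rabs p) + 1).
  assert (HN : Rabs m < N /\ Rabs p < N).
  { unfold N; pose proof (Rmax_l (Rabs m) (Rabs p)); pose proof (Rmax_r (Rabs m) (Rabs p)); lra. }
  destruct HN as [HN1 HN2].
  apply Rabs_lt_between in HN1, HN2.
  pose proof (Hb (- N) N ltac:(lra) ltac:(lra)) as H0; apply Rabs_lt_between in H0.
  (* The integral over [[-N, N]] and the one over the interval extended to [b] or [- b] both lie
     within 1 of [l], so they differ by less than 2. *)
  split; exists N, 2; intros b HNb.
  - pose proof (Hb (- N) b ltac:(lra) ltac:(lra)) as H1; apply Rabs_lt_between in H1.
    rewrite (RInt_split _ (- N) N b Hc2) in H1; lra.
  - rewrite (RInt_reflect (fun t => v t ^ 2)) by exact Hc2.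
    pose proof (Hb (- b) N ltac:(lra) ltac:(lra)) as H1; apply Rabs_lt_between in H1.
    rewrite (RInt_split _ (- b) (- N) N Hc2) in H1; lra.
Qed.

Lemma RInt_sq_nonneg (v : R -> R) (a b : R) : (forall t, continuous v t) -> a <= b ->
  0 <= RInt (fun t => v t ^ 2) a b.
Proof.
  intros Hc Hab; apply RInt_ge_0; [exact Hab | apply ex_RInt_cont, continuous_sq, Hc|].
  intros; apply pow2_ge_0.
Qed.

Section Eigen.
Variables (q v v1 : R -> R) (a : R).
Hypothesis Hv : Sol q v v1.
Hypothesis Hq : forall t, a <= t -> 1 <= q t.
Hypothesis Hl2 : tail_square_bounded v.

(** [v * v1] is half the derivative of [v ^ 2] and does not decrease beyond [a]. A positive value
    would force [v ^ 2] to grow at least linearly, against the bound on its integrals. *)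
Lemma l2_mul_nonpos (t : R) : a <= t -> v t * v1 t <= 0.
Proof.
  intros Ht; apply Rnot_lt_le; intros Hs.
  set (s := v t * v1 t) in *.
  destruct Hl2 as [N [B HB]].
  pose proof (proj1 (Sol_continuous _ _ _ Hv)) as Hc.
  assert (Hg : forall r, t <= r -> s <= v r * v1 r).
  { intros r Hr; apply (Sol_mul_nondecr q v v1 a Hv); [|lra].
    intros x Hx; specialize (Hq x Hx); lra. }
  assert (Hlow : forall r, t + 1 <= r -> 2 * s <= v r ^ 2).
  { intros r Hr.
    assert (H : v t ^ 2 - 2 * s * t <= v r ^ 2 - 2 * s * r).
    { apply (le_of_derive_nonneg (fun r => v r ^ 2 - 2 * s * r) (fun r => 2 * (v r * v1 r - s))); [lra| |].
      - intros x _; destruct (Hv x); der; ring.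
      - intros x Hx; specialize (Hg x ltac:(lra)); lra. }
    pose proof (pow2_ge_0 (v t)); nra. }
  set (c := Rmax N (t + 1)).
  assert (HcN : N <= c) by apply Rmax_l.
  assert (Hct : t + 1 <= c) by apply Rmax_r.
  (* On [[c, b]] the lower bound [2 * s] alone integrates to [Rabs B + 1], more than the whole tail
     may have. *)
  set (b := c + (Rabs B + 1) / (2 * s)).
  assert (Hcb : c < b).
  { unfold b; pose proof (Rabs_pos B).
    assert (0 < (Rabs B + 1) / (2 * s)) by (apply Rdiv_lt_0_compat; lra); lra. }
  specialize (HB b ltac:(lra)).
  rewrite (RInt_split _ N c b (continuous_sq v Hc)) in HB.
  pose proof (RInt_sq_nonneg v N c Hc HcN).
  assert (H1 : RInt (fun _ => 2 * s) c b <= RInt (fun t => v t ^ 2) c b).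
  { apply RInt_le; [lra | apply ex_RInt_const | apply ex_RInt_cont, continuous_sq, Hc |].
    intros x Hx; apply Hlow; lra. }
  rewrite RInt_Rconst in H1.
  replace ((b - c) * (2 * s)) with (Rabs B + 1) in H1 by (unfold b; field; lra).
  pose proof (Rle_abs B); lra.
Qed.

Hypothesis Hqc : forall t, continuous q t.
Hypothesis Hnz : exists t, v t <> 0.

(** [v ^ 2] does not increase on the tail, so a zero would persist; then [v] and [v1] vanish at a
    common point and [v] is identically 0. *)
Lemma tail_no_zero (t : R) : a <= t -> v t <> 0.
Proof.
  intros Ht Hz.
  assert (H0 : forall s, t <= s -> v s = 0).
  { intros s Hs.
    assert (H : - v t ^ 2 <= - v s ^ 2).
    { apply (le_of_derive_nonneg (fun s => - v s ^ 2) (fun s => - 2 * (v s * v1 s))); [lra| |].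
      - intros x _; destruct (Hv x); der; ring.
      - intros x Hx; pose proof (l2_mul_nonpos x ltac:(lra)); lra. }
    rewrite Hz in H; pose proof (pow2_ge_0 (v s)); nra. }
  destruct (MVT_cor2 v v1 t (t + 1)) as [c [Hc Hct]]; [lra| |].
  { intros c _; apply is_derive_Reals, Hv. }
  rewrite (H0 t), (H0 (t + 1)) in Hc by lra.
  destruct Hnz as [s Hs]; apply Hs.
  apply (Sol_unique_zero q v v1 c); auto; [apply H0; lra | lra].
Qed.

End Eigen.

Section Compare.
Variables (V : R -> R) (M T lam mu : R) (u u1 v v1 : R -> R).
Hypothesis HV : well V M T.
Hypothesis Hu : ground V T lam u u1.
Hypothesis Hlam : lam <= M + 6.
Hypothesis Hv : Sol (fun t => V t - mu) v v1.
Hypothesis Hl2 : tail_square_bounded v.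
Hypothesis Hmu : mu < lam.

Let W t := u t * v1 t - u1 t * v t.

Lemma compare_wronskian_derive (t : R) : is_derive W t ((lam - mu) * (u t * v t)).
Proof.
  eapply is_derive_eq; [apply (Sol_wronskian _ _ _ _ _ _ (ground_sol _ _ _ _ _ Hu) Hv)|].
  ring.
Qed.

Lemma well_tail (l : R) : l <= M + 6 -> forall t, T <= t -> 1 <= V t - l.
Proof.
  intros Hl t Ht; apply (potential_ge V M T HV); auto.
  pose proof (well_T _ _ _ HV); rewrite Rabs_pos_eq; lra.
Qed.

(** To the right of [z] the Wronskian strictly increases, because [mu < lam], and it tends to 0 at
    +oo, where square integrability forces [v] to decay. *)
Lemma compare_wronskian_negative (z : R) : (forall t, z < t -> 0 < v t) -> forall t, z < t -> W t < 0.
Proof.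
  intros Hp t Hzt.
  assert (Hinc : forall r s, z < r < s -> W r < W s).
  { intros r s Hrs; apply (lt_of_derive_pos W (fun t => (lam - mu) * (u t * v t))); [lra| |].
    - intros; apply compare_wronskian_derive.
    - intros x Hx; apply Rmult_lt_0_compat; [lra|]; apply Rmult_lt_0_compat;
        [apply (ground_pos _ _ _ _ _ Hu) | apply Hp; lra]. }
  assert (Hvan : vanishing W).
  { pose proof (well_T _ _ _ HV).
    set (b := Rmax T (z + 1)).
    assert (HbT : T <= b) by apply Rmax_l. assert (Hbz : z + 1 <= b) by apply Rmax_r.
    apply (wronskian_tail_bound (fun t => V t - lam) (fun t => V t - mu) u u1 v v1 T b).
    - apply Hu.
    - exact Hv.
    - apply well_tail; lra.
    - intros s Hs; apply well_tail; lra.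
    - intros; apply Hu.
    - intros s Hs; apply Hp; lra.
    - apply Hu.
    - intros s Hs.
      pose proof (l2_mul_nonpos _ v v1 T Hv (well_tail mu ltac:(lra)) Hl2 s ltac:(lra)).
      specialize (Hp s ltac:(lra)); nra. }
  apply Rlt_le_trans with (W (t + 1)); [apply Hinc; lra|].
  apply (vanishing_nondecr_nonpos W (t + 1)); [|exact Hvan|lra].
  intros r s Hrs; destruct (Req_dec r s) as [->|Hne]; [lra | left; apply Hinc; lra].
Qed.

(** At such a zero [v1 z >= 0], so [W z = u z * v1 z >= 0]; but [W] increases from there and is
    negative to the right. *)
Lemma no_last_zero (z : R) : v z = 0 -> ~ (forall t, z < t -> 0 < v t).
Proof.
  intros Hz Hp.
  assert (H1 : 0 <= v1 z).
  { apply Rnot_lt_le; intros H1.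
    destruct (proj2 (Sol_continuous _ _ _ Hv) z (ball (v1 z) (- v1 z))) as [d Hd].
    { exists (mkposreal (- v1 z) ltac:(lra)); intros y Hy; exact Hy. }
    assert (Hlt : - v z < - v (z + d / 2)).
    { apply (lt_of_derive_pos (fun t => - v t) (fun t => - v1 t)).
      - destruct d; simpl; lra.
      - intros t _; destruct (Hv t); der; ring.
      - intros t Ht; enough (v1 t < 0) by lra.
        specialize (Hd t); unfold ball in Hd; simpl in Hd; unfold AbsRing_ball, abs, minus, plus, opp in Hd;
          simpl in Hd.
        assert (Hb : Rabs (v1 t + - v1 z) < - v1 z).
        { apply Hd; rewrite Rabs_pos_eq; destruct d; simpl in *; lra. }
        apply Rabs_lt_between in Hb; lra. }
    specialize (Hp (z + d / 2)); destruct d; simpl in *; lra. }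
  pose proof (compare_wronskian_negative z Hp) as Hneg.
  assert (Hlt : W z < W (z + 1)).
  { apply (lt_of_derive_pos W (fun t => (lam - mu) * (u t * v t))); [lra| |].
    - intros; apply compare_wronskian_derive.
    - intros x Hx; apply Rmult_lt_0_compat; [lra|]; apply Rmult_lt_0_compat;
        [apply (ground_pos _ _ _ _ _ Hu) | apply Hp; lra]. }
  specialize (Hneg (z + 1) ltac:(lra)).
  assert (0 <= W z).
  { unfold W; rewrite Hz; pose proof (ground_pos _ _ _ _ _ Hu z); nra. }
  lra.
Qed.

End Compare.

Lemma Sol_opp (q v v1 : R -> R) : Sol q v v1 -> Sol q (fun t => - v t) (fun t => - v1 t).
Proof. intros H t; destruct (H t); split; der; ring. Qed.

Lemma tail_square_bounded_opp (v : R -> R) :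
  tail_square_bounded v -> tail_square_bounded (fun t => - v t).
Proof.
  intros [N [B H]]; exists N, B; intros b Hb.
  rewrite (RInt_ext _ (fun t => v t ^ 2)); [apply H, Hb | intros; simpl; ring].
Qed.

Lemma sign_const (f : R -> R) : (forall t, continuous f t) -> forall (P : R -> Prop),
  (forall s t r, P s -> P t -> s <= r <= t -> P r) -> (forall t, P t -> f t <> 0) ->
  (forall t, P t -> 0 < f t) \/ (forall t, P t -> 0 < - f t).
Proof.
  intros Hf P Hconv Hnz.
  destruct (classic (exists s, P s /\ 0 < f s)) as [[s [Hs Hfs]]|Hno].
  - left; intros t Ht; destruct (Rle_lt_dec s t) as [Hst|Hst].
    + apply (pos_of_no_zero f s t); auto; intros r Hr; apply Hnz, (Hconv s t); auto.
    + pose proof (pos_of_no_zero (fun x => f (- x)) (- s) (- t)) as H; cbv beta in H.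
      rewrite !Ropp_involutive in H; apply H; try lra.
      * apply continuous_reflect, Hf.
      * intros r Hr; apply Hnz, (Hconv t s); auto; lra.
  - right; intros t Ht; specialize (Hnz t Ht).
    destruct (Rtotal_order (f t) 0) as [H|[H|H]]; [lra|contradiction|].
    exfalso; apply Hno; exists t; auto.
Qed.

(* Sturm comparison to the right of the last zero of [v], or on the whole line if there is none. *)
Lemma ground_le_eigenvalue (V : R -> R) (M T lam mu : R) (u u1 v v1 : R -> R) :
  well V M T -> ground V T lam u u1 -> lam <= M + 6 ->
  Sol (fun t => V t - mu) v v1 -> tail_square_bounded v ->
  tail_square_bounded (fun t => v (- t)) -> (exists t, v t <> 0) -> lam <= mu.
Proof.
  intros HV Hu Hlam Hv Hl Hr Hnz; apply Rnot_lt_le; intros Hmu.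
  pose proof (proj1 (Sol_continuous _ _ _ Hv)) as Hc.
  assert (Hqc : forall t, continuous (fun t => V t - mu) t).
  { intros t; apply (continuous_minus V (fun _ => mu)); [apply HV | apply continuous_const]. }
  assert (Htail : forall t, T <= t -> v t <> 0).
  { intros t Ht; apply (tail_no_zero (fun t => V t - mu) v v1 T); auto.
    intros s Hs; apply (well_tail V M T HV); lra. }
  destruct (classic (exists t, v t = 0)) as [[t0 Ht0]|Hno].
  - destruct (completeness (fun t => v t = 0)) as [z [Hub Hlub]].
    + exists T; intros t Ht; destruct (Rle_lt_dec t T); auto; exfalso; apply (Htail t); auto; lra.
    + exists t0; exact Ht0.
    + assert (Hz : v z = 0).
      { destruct (Req_dec (v z) 0) as [|Hne]; [assumption|exfalso].
        pose proof (Rabs_pos_lt _ Hne) as Hp.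
        destruct (Hc z (ball (v z) (Rabs (v z)))) as [d Hd].
        { exists (mkposreal _ Hp); intros y Hy; exact Hy. }
        enough (z <= z - d) by (destruct d; simpl in *; lra).
        apply Hlub; intros t Ht; destruct (Rle_lt_dec t (z - d)) as [|Hgt]; [assumption|exfalso].
        pose proof (Hub t Ht).
        specialize (Hd t); unfold ball in Hd; simpl in Hd; unfold AbsRing_ball, abs, minus, plus, opp in Hd;
          simpl in Hd.
        rewrite Ht, Rplus_0_l, Rabs_Ropp in Hd.
        enough (Rabs (v z) < Rabs (v z)) by lra; apply Hd.
        rewrite Rabs_left1; lra. }
      destruct (sign_const v Hc (fun t => z < t)) as [Hs|Hs].
      * intros; lra.
      * intros t Ht Hvt; pose proof (Hub t Hvt); lra.
      * exact (no_last_zero V M T lam mu u u1 v v1 HV Hu Hlam Hv Hl Hmu z Hz Hs).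
      * refine (no_last_zero V M T lam mu u u1 _ _ HV Hu Hlam (Sol_opp _ _ _ Hv)
          (tail_square_bounded_opp _ Hl) Hmu z _ Hs).
        rewrite Hz; ring.
  (* For a positive [w] the Wronskian with [u] is negative at 0. Reflection changes its sign there,
     while the reflected pair satisfies the same hypotheses, a contradiction. *)
  - assert (Hnever : forall w w1, Sol (fun t => V t - mu) w w1 -> tail_square_bounded w ->
      tail_square_bounded (fun t => w (- t)) -> ~ (forall t, 0 < w t)).
    { intros w w1 Hw Hwl Hwr Hwp.
      pose proof (compare_wronskian_negative V M T lam mu u u1 w w1 HV Hu Hlam Hw Hwl Hmu (-1)
        (fun t _ => Hwp t) 0 ltac:(lra)) as H1.
      pose proof (compare_wronskian_negative _ M T lam mu _ _ _ _ (well_reflect _ _ _ HV) (ground_reflect _ _ _ _ _ Hu)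
        Hlam (Sol_reflect _ _ _ Hw) Hwr Hmu (-1) (fun t _ => Hwp (- t)) 0 ltac:(lra)) as H2.
      cbv beta in H1, H2; rewrite Ropp_0 in H2; lra. }
    destruct (sign_const v Hc (fun _ => True)) as [Hs|Hs].
    + auto.
    + intros t _ Hvt; apply Hno; exists t; exact Hvt.
    + apply (Hnever v v1); auto.
    + apply (Hnever _ _ (Sol_opp _ _ _ Hv)); auto using tail_square_bounded_opp.
Qed.

Lemma square_integrable_of_dominated (u : R -> R) (C : R) :
  dominated (fun t => u t ^ 2) C -> square_integrable u.
Proof.
  intros Hd; exists (integral (fun t => u t ^ 2)).
  intros P [eps HP].
  pose proof (dominated_nonneg _ C Hd) as HC.
  destruct (exp_small C (eps / 4) HC) as [N [HN0 HN]]; [destruct eps; simpl; lra|].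
  apply Filter_prod with (Q := fun a => a < - N) (R := fun b => N < b).
  - exists (- N); auto.
  - exists N; auto.
  - intros a b Ha Hb; exists (RInt (fun t => u t ^ 2) a b); split.
    + apply (RInt_correct (V := R_CompleteNormedModule)), ex_RInt_cont, Hd.
    + apply HP.
      change (Rabs (RInt (fun t => u t ^ 2) a b - integral (fun t => u t ^ 2)) < eps).
      rewrite (RInt_split _ a 0 b (proj1 Hd)).
      pose proof (dominated_half _ C b Hd ltac:(lra)) as H1.
      pose proof (dominated_half _ C (- a) (dominated_reflect _ C Hd) ltac:(lra)) as H2.
      rewrite (RInt_reflect (fun t => u t ^ 2)), Ropp_0, Ropp_involutive in H2 by apply Hd.
      unfold integral.
      pose proof (HN b ltac:(lra)); pose proof (HN (- a) ltac:(lra)).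
      rewrite Ropp_involutive in *.
      apply Rabs_le_between in H1, H2.
      apply Rabs_lt_between; destruct eps; simpl in *; lra.
Qed.

(** * The anharmonic potential *)

Lemma potential_bound_nonneg (V : R -> R) (M T K : R) : well V M T ->
  (forall t, - (T + 1) <= t <= T + 1 -> V t <= K) -> 0 <= K.
Proof.
  intros HV HK; pose proof (well_T _ _ _ HV); pose proof (well_ge0 _ _ _ HV 0).
  specialize (HK 0); lra.
Qed.

(** Harnack looks back by one unit, which is why the bound on [V] is required up to [T + 1]. *)
Lemma slope_upper (V : R -> R) (M T K lam : R) (u u1 : R -> R) : well V M T ->
  (forall t, - (T + 1) <= t <= T + 1 -> V t <= K) -> 0 <= lam -> ground V T lam u u1 ->
  forall t, - T <= t <= T -> u1 t <= (1 + K) * u t.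
Proof.
  intros HV HK Hlam Hu t Ht; apply (harnack _ _ _ t K (ground_sol _ _ _ _ _ Hu)).
  - apply (potential_bound_nonneg V M T K HV HK).
  - intros s Hs; specialize (HK s ltac:(lra)); lra.
  - intros s _; apply Hu.
Qed.

Section GroundBounds.
Variables (V : R -> R) (M T K lam : R) (u u1 : R -> R).
Hypothesis HV : well V M T.
Hypothesis HK : forall t, - (T + 1) <= t <= T + 1 -> V t <= K.
Hypothesis Hlam : 0 <= lam <= M + 6.
Hypothesis Hu : ground V T lam u u1.

Lemma slope_bound (t : R) : - T <= t <= T -> Rabs (u1 t) <= (1 + K) * u t.
Proof.
  intros Ht; apply Rabs_le; split.
  - assert (HK' : forall t, - (T + 1) <= t <= T + 1 -> V (- t) <= K) by (intros; apply HK; lra).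
    pose proof (slope_upper _ M T K lam _ _ (well_reflect _ _ _ HV) HK' (proj1 Hlam)
      (ground_reflect _ _ _ _ _ Hu) (- t) ltac:(lra)) as H.
    cbv beta in H; rewrite Ropp_involutive in H; lra.
  - apply (slope_upper V M T K lam); auto; apply Hlam.
Qed.

(** On [[0, T]] the logarithmic slope is at most [1 + K] in absolute value and [u 0 = 1], which
    bounds [u] from both sides. Beyond [T] it decays like [exp (T - t)]; the extra factor [exp T]
    turns this into [exp (- t)] and raises the exponent to [(2 + K) * T]. *)
Lemma ground_bounds_half :
  (forall t, 0 <= t -> u t <= exp ((2 + K) * T) * exp (- t)) /\
  (forall t, 0 <= t -> Rabs (u1 t) <= (1 + K) * exp ((2 + K) * T)) /\
  (forall t, 0 <= t <= T -> exp (- ((1 + K) * T)) <= u t).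
Proof.
  pose proof (potential_bound_nonneg V M T K HV HK) as HK0.
  pose proof (well_T _ _ _ HV) as HT.
  destruct Hu as [Hsol H0 Hpos Hr _].
  assert (Hup : forall t, 0 <= t <= T -> u t <= exp ((1 + K) * T)).
  { intros t Ht.
    assert (H : - (u 0 * exp (- (1 + K) * 0)) <= - (u t * exp (- (1 + K) * t))).
    { apply (le_of_derive_nonneg (fun t => - (u t * exp (- (1 + K) * t)))
        (fun t => ((1 + K) * u t - u1 t) * exp (- (1 + K) * t))); [lra| |].
      - intros s _; destruct (Hsol s); der; ring.
      - intros s Hs; pose proof (slope_bound s ltac:(lra)) as Hb; apply Rabs_le_between in Hb.
        apply Rmult_le_pos; [lra | left; apply exp_pos]. }
    rewrite H0, Rmult_0_r, exp_0 in H.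
    assert (He : exp (- (1 + K) * t) * exp ((1 + K) * t) = 1).
    { rewrite <- exp_plus, <- exp_0; f_equal; ring. }
    assert (Ht' : exp ((1 + K) * t) <= exp ((1 + K) * T)) by (apply exp_mono; nra).
    pose proof (exp_pos ((1 + K) * t)); nra. }
  assert (Hdec : forall t, T <= t -> u t <= u T * exp (T - t)).
  { apply (tail_exp_decay (fun t => V t - lam) u u1 T Hsol); auto.
    intros t Ht; apply (potential_ge V M T HV); [lra|]; rewrite Rabs_pos_eq; lra. }
  assert (HTT : u T <= exp ((1 + K) * T)) by (apply Hup; lra).
  assert (Hexp : exp ((2 + K) * T) = exp ((1 + K) * T) * exp T).
  { rewrite <- exp_plus; f_equal; ring. }
  pose proof (exp_pos ((1 + K) * T)) as He1.
  assert (HeT : 1 <= exp T) by (rewrite <- exp_0 at 1; apply exp_mono; lra).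
  split; [|split].
  - intros t Ht; destruct (Rle_lt_dec t T).
    + apply Rle_trans with (exp ((1 + K) * T)); [apply Hup; lra|].
      rewrite <- exp_plus; apply exp_mono; lra.
    + eapply Rle_trans; [apply Hdec; lra|].
      unfold Rminus; rewrite exp_plus, Hexp, Rmult_assoc.
      apply Rmult_le_compat_r; [|exact HTT].
      apply Rmult_le_pos; left; apply exp_pos.
  - assert (H1 : forall t, 0 <= t <= T -> Rabs (u1 t) <= (1 + K) * exp ((2 + K) * T)).
    { intros t Ht; eapply Rle_trans; [apply slope_bound; lra|].
      apply Rmult_le_compat_l; [lra|]; rewrite Hexp.
      specialize (Hup t Ht); nra. }
    intros t Ht; destruct (Rle_lt_dec t T); [apply H1; lra|].
    apply Rle_trans with (Rabs (u1 T)); [|apply H1; lra].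
    rewrite !Rabs_left1 by (apply Hr; lra); apply Ropp_le_contravar.
    apply (tail_derive_nondecr (fun t => V t - lam) u u1 T Hsol); auto; [|lra].
    intros s Hs; apply (potential_ge V M T HV); [lra|]; rewrite Rabs_pos_eq; lra.
  - intros t Ht.
    assert (H : u 0 * exp ((1 + K) * 0) <= u t * exp ((1 + K) * t)).
    { apply (le_of_derive_nonneg (fun t => u t * exp ((1 + K) * t))
        (fun t => ((1 + K) * u t + u1 t) * exp ((1 + K) * t))); [lra| |].
      - intros s _; destruct (Hsol s); der; ring.
      - intros s Hs; pose proof (slope_bound s ltac:(lra)) as Hb; apply Rabs_le_between in Hb.
        apply Rmult_le_pos; [lra | left; apply exp_pos]. }
    rewrite H0, Rmult_0_r, exp_0 in H.
    assert (Ht' : exp ((1 + K) * t) <= exp ((1 + K) * T)) by (apply exp_mono; nra).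
    assert (He : exp (- ((1 + K) * T)) * exp ((1 + K) * T) = 1).
    { rewrite <- exp_plus, <- exp_0; f_equal; ring. }
    specialize (Hpos t); apply Rmult_le_reg_r with (exp ((1 + K) * T)); [exact He1|].
    rewrite He; nra.
Qed.

End GroundBounds.

(** [C] depends on [K] and [T] only, so a family of wells with common bounds shares it. *)
Lemma ground_bounds (V : R -> R) (M T K lam : R) (u u1 : R -> R) : well V M T ->
  (forall t, - (T + 1) <= t <= T + 1 -> V t <= K) -> 0 <= lam <= M + 6 ->
  ground V T lam u u1 ->
  let C := (1 + K) * exp ((2 + K) * T) in
  (forall t, u t <= C * exp (- Rabs t)) /\ (forall t, Rabs (u1 t) <= C) /\
  (forall t, - T <= t <= T -> / C <= u t).
Proof.
  intros HV HK Hlam Hu C.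
  pose proof (potential_bound_nonneg V M T K HV HK) as HK0; pose proof (well_T _ _ _ HV) as HT.
  assert (HK' : forall t, - (T + 1) <= t <= T + 1 -> V (- t) <= K) by (intros; apply HK; lra).
  destruct (ground_bounds_half V M T K lam u u1 HV HK Hlam Hu) as [H1 [H2 H3]].
  destruct (ground_bounds_half _ M T K lam _ _ (well_reflect _ _ _ HV) HK' Hlam
    (ground_reflect _ _ _ _ _ Hu)) as [K1 [K2 K3]].
  pose proof (exp_pos ((2 + K) * T)) as He.
  assert (HeC : exp ((2 + K) * T) <= C) by (unfold C; nra).
  split; [|split].
  - intros t; pose proof (exp_pos (- Rabs t)).
    apply Rle_trans with (exp ((2 + K) * T) * exp (- Rabs t)); [|nra].
    destruct (Rle_lt_dec 0 t).
    + rewrite Rabs_pos_eq by lra; apply H1; lra.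
    + rewrite Rabs_left by lra; specialize (K1 (- t) ltac:(lra)).
      rewrite Ropp_involutive in K1 |- *; exact K1.
  - intros t; destruct (Rle_lt_dec 0 t); [apply H2; lra|].
    specialize (K2 (- t) ltac:(lra)); rewrite Ropp_involutive, Rabs_Ropp in K2; exact K2.
  - assert (HC : / C <= exp (- ((1 + K) * T))).
    { rewrite exp_Ropp; apply Rinv_le_contravar; [apply exp_pos|].
      eapply Rle_trans; [|exact HeC]; apply exp_mono; nra. }
    intros t Ht; eapply Rle_trans; [exact HC|].
    destruct (Rle_lt_dec 0 t); [apply H3; lra|].
    specialize (K3 (- t) ltac:(lra)); rewrite Ropp_involutive in K3; exact K3.
Qed.

(** * The monomial [t^(k+1)/(k+1)] and the well it defines *)

Definition pmon (k : nat) (t : R) : R := t ^ (k + 1) / INR (k + 1).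

Lemma potentialE (k : nat) (alpha t : R) : potential k alpha t = (pmon k t - alpha) ^ 2.
Proof. reflexivity. Qed.

Lemma INR_k1_pos (k : nat) : 0 < INR (k + 1).
Proof. apply lt_0_INR; lia. Qed.

Lemma pmon_derive (k : nat) (t : R) : is_derive (pmon k) t (t ^ k).
Proof.
  unfold pmon; pose proof (INR_k1_pos k).
  der; [lra|]; replace (Nat.pred (k + 1)) with k by lia; field; lra.
Qed.

Lemma pmon_continuous (k : nat) (t : R) : continuous (pmon k) t.
Proof. apply (ex_derive_continuous (pmon k)); eexists; apply pmon_derive. Qed.

Lemma pmon_abs (k : nat) (t : R) : Rabs (pmon k t) = Rabs t ^ (k + 1) / INR (k + 1).
Proof.
  pose proof (INR_k1_pos k); unfold pmon, Rdiv; rewrite Rabs_mult, RPow_abs; f_equal.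
  apply Rabs_pos_eq; left; apply Rinv_0_lt_compat; lra.
Qed.

Lemma pmon_opp (k : nat) (t : R) : Nat.Even k -> pmon k (- t) = - pmon k t.
Proof.
  intros [m ->]; unfold pmon.
  replace ((- t) ^ (2 * m + 1)) with (- t ^ (2 * m + 1)); [unfold Rdiv; ring|].
  rewrite !pow_add, !pow_mult; replace ((- t) ^ 2) with (t ^ 2) by ring; ring.
Qed.

Lemma potential_reflect (k : nat) (alpha t : R) : Nat.Even k ->
  potential k alpha (- t) = potential k (- alpha) t.
Proof. intros Hk; rewrite !potentialE, pmon_opp by exact Hk; ring. Qed.

Lemma pmon_large (k : nat) (t : R) : 1 <= Rabs t -> Rabs t / INR (k + 1) <= Rabs (pmon k t).
Proof.
  intros Ht; pose proof (INR_k1_pos k); rewrite pmon_abs.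
  apply Rmult_le_compat_r; [left; apply Rinv_0_lt_compat; lra|].
  rewrite <- (pow_1 (Rabs t)) at 1; apply Rle_pow; [exact Ht | lia].
Qed.

Lemma pmon_small (k : nat) (t : R) : -1 <= t <= 1 -> Rabs (pmon k t) <= 1.
Proof.
  intros Ht; pose proof (INR_k1_pos k); rewrite pmon_abs.
  assert (Ha : 0 <= Rabs t <= 1) by (split; [apply Rabs_pos | apply Rabs_le; lra]).
  assert (Hp : Rabs t ^ (k + 1) <= 1).
  { rewrite <- (pow1 (k + 1)); apply pow_incr; exact Ha. }
  assert (Hk : 1 <= INR (k + 1)) by (rewrite <- INR_1; apply le_INR; lia).
  apply Rmult_le_reg_r with (INR (k + 1)); [lra|].
  unfold Rdiv; rewrite Rmult_assoc, Rinv_l by lra; lra.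
Qed.

(** One term of the exponential series. A product of two ground states decays like [exp (- 2 |t|)],
    so a factor [pmon] costs only one of the two exponentials. *)
Lemma pmon_exp (k : nat) (t : R) : Rabs (pmon k t) <= INR (fact (k + 1)) * exp (Rabs t).
Proof.
  rewrite pmon_abs.
  pose proof (exp_ge_taylor (Rabs t) (k + 1) (Rabs_pos t)) as H.
  assert (Hf : 0 < INR (fact (k + 1))) by apply INR_fact_lt_0.
  assert (Hpow : 0 <= Rabs t ^ (k + 1)) by (apply pow_le, Rabs_pos).
  assert (H1 : Rabs t ^ (k + 1) / INR (fact (k + 1)) <= exp (Rabs t)).
  { eapply Rle_trans; [|exact H].
    rewrite Nat.add_1_r, tech5.
    enough (0 <= sum_f_R0 (fun n => Rabs t ^ n / INR (fact n)) k) by lra.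
    apply cond_pos_sum; intros n; apply Rmult_le_pos; [apply pow_le, Rabs_pos|].
    left; apply Rinv_0_lt_compat, INR_fact_lt_0. }
  assert (Hk : 1 <= INR (k + 1)) by (rewrite <- INR_1; apply le_INR; lia).
  apply Rle_trans with (Rabs t ^ (k + 1)).
  - unfold Rdiv; rewrite <- (Rmult_1_r (Rabs t ^ (k + 1))) at 2.
    apply Rmult_le_compat_l; [exact Hpow|]; rewrite <- Rinv_1; apply Rinv_le_contravar; lra.
  - apply Rmult_le_compat_l with (r := INR (fact (k + 1))) in H1; [|lra].
    replace (INR (fact (k + 1)) * (Rabs t ^ (k + 1) / INR (fact (k + 1))))
      with (Rabs t ^ (k + 1)) in H1 by (field; lra).
    exact H1.
Qed.

Lemma potential_entire (k : nat) (alpha lam : R) : entire (fun t => potential k alpha t - lam).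
Proof.
  pose proof (INR_k1_pos k).
  apply entire_ext with (fun t => / INR (k + 1) ^ 2 * t ^ (2 * (k + 1)) +
    (- 2 * alpha / INR (k + 1) * t ^ (k + 1) + (alpha ^ 2 - lam))).
  - intros t; unfold potential; replace (2 * (k + 1))%nat with ((k + 1) * 2)%nat by lia.
    rewrite pow_mult; field; lra.
  - apply entire_plus; [apply entire_monomial|].
    apply entire_plus; [apply entire_monomial | apply entire_const].
Qed.

Lemma potential_continuous (k : nat) (alpha t : R) : continuous (potential k alpha) t.
Proof.
  apply (ex_derive_continuous (potential k alpha)); eexists.
  apply is_derive_Rpow, is_derive_Rminus; [apply pmon_derive | apply is_derive_const].
Qed.

(** Both constants serve every alpha with [Rabs alpha <= A]. On [[-1, 1]] the monomial is at most 1
    in absolute value, whence the bound. Beyond the radius [|pmon|] is at least [|t| / (k + 1)], so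
    [|pmon - alpha|] is at least [well_bound A + 7], and so is its square. *)
Definition well_bound (A : R) : R := (1 + A) ^ 2.
Definition well_radius (k : nat) (A : R) : R := INR (k + 1) * (A + well_bound A + 7).

Lemma well_radius_ge1 (k : nat) (A : R) : 0 <= A -> 1 <= well_radius k A.
Proof.
  intros HA; unfold well_radius, well_bound; pose proof (pow2_ge_0 (1 + A)).
  assert (Hk : 1 <= INR (k + 1)) by (rewrite <- INR_1; apply le_INR; lia); nra.
Qed.

Lemma pmon_beyond (k : nat) (A t : R) : 0 <= A -> well_radius k A <= Rabs t ->
  A + well_bound A + 7 <= Rabs (pmon k t).
Proof.
  intros HA Ht; pose proof (well_radius_ge1 k A HA); pose proof (INR_k1_pos k).
  eapply Rle_trans; [|apply pmon_large; lra].
  apply Rmult_le_reg_r with (INR (k + 1)); [lra|].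
  unfold Rdiv; rewrite Rmult_assoc, Rinv_l by lra; unfold well_radius in Ht; lra.
Qed.

Lemma potential_well (k : nat) (A alpha : R) : Rabs alpha <= A ->
  well (potential k alpha) (well_bound A) (well_radius k A).
Proof.
  intros Ha.
  assert (HA : 0 <= A) by (pose proof (Rabs_pos alpha); lra).
  apply Rabs_le_between in Ha; split.
  - apply potential_continuous.
  - intros lam y0 y1; apply ivp_exists, potential_entire.
  - intros t; apply pow2_ge_0.
  - intros t Ht; rewrite potentialE; pose proof (pmon_small k t Ht) as Hp.
    apply Rabs_le_between in Hp; unfold well_bound; nra.
  - pose proof (well_radius_ge1 k A HA); lra.
  - intros t Ht; rewrite potentialE; pose proof (pmon_beyond k A t HA Ht) as Hp.
    assert (Hw : 0 <= well_bound A) by apply pow2_ge_0.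
    assert (Hs : well_bound A + 7 <= Rabs (pmon k t - alpha)).
    { unfold Rabs in Hp |- *; destruct (Rcase_abs (pmon k t)), (Rcase_abs (pmon k t - alpha)); lra. }
    rewrite <- pow2_abs; nra.
Qed.

Lemma Sol_of_eigen (k : nat) (alpha mu : R) (v : R -> R) :
  (forall t, ex_derive v t) -> (forall t, ex_derive (Derive v) t) ->
  (forall t, - Derive (Derive v) t + potential k alpha t * v t = mu * v t) ->
  Sol (fun t => potential k alpha t - mu) v (Derive v).
Proof.
  intros H1 H2 H3 t; split; [apply Derive_correct, H1|].
  apply is_derive_eq with (Derive (Derive v) t); [apply Derive_correct, H2|].
  specialize (H3 t); lra.
Qed.

(** Sturm comparison makes [lam] a lower bound of the eigenvalues, and the decaying [u] is itself an
    eigenfunction. The infimum is thus attained and finite, so [real] returns it unchanged. *)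
Lemma lambda1_ground (k : nat) (A alpha lam C : R) (u u1 : R -> R) : Rabs alpha <= A ->
  ground (potential k alpha) (well_radius k A) lam u u1 -> lam <= well_bound A + 6 ->
  (forall t, u t <= C * exp (- Rabs t)) -> lambda1 k alpha = lam.
Proof.
  intros Ha Hu Hlam HC.
  pose proof (potential_well k A alpha Ha) as HV.
  destruct (Sol_continuous _ _ _ (ground_sol _ _ _ _ _ Hu)) as [Huc _].
  assert (Hglb : is_glb_Rbar (fun l => is_eigenvalue k alpha l) (Finite lam)).
  { split.
    - intros mu [v [H1 [H2 [H3 [H4 H5]]]]]; simpl.
      pose proof (Sol_of_eigen k alpha mu v H1 H2 H5) as Hv.
      destruct (square_integrable_tails v (proj1 (Sol_continuous _ _ _ Hv)) H3) as [Hr Hl].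
      apply (ground_le_eigenvalue _ _ _ lam mu u u1 v (Derive v) HV Hu); auto.
    - intros b Hb; apply Hb; exists u.
      assert (HD : forall t, Derive u t = u1 t) by (intros t; apply is_derive_unique, Hu).
      repeat split.
      + intros t; eexists; apply Hu.
      + intros t; apply (ex_derive_ext u1); [intros; symmetry; apply HD|].
        eexists; apply (ground_sol _ _ _ _ _ Hu).
      + apply (square_integrable_of_dominated u (C ^ 2)); split; [apply continuous_sq, Huc|].
        intros t; pose proof (ground_pos _ _ _ _ _ Hu t); specialize (HC t).
        rewrite Rabs_pos_eq by apply pow2_ge_0.
        assert (He : 0 < exp (- Rabs t) <= 1).
        { split; [apply exp_pos|]; rewrite <- exp_0; apply exp_mono; pose proof (Rabs_pos t); lra. }
        apply Rle_trans with ((C * exp (- Rabs t)) ^ 2); [apply pow_incr; lra|].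
        rewrite Rpow_mult_distr; apply Rmult_le_compat_l; [apply pow2_ge_0 | nra].
      + exists 0; rewrite (ground_0 _ _ _ _ _ Hu); lra.
      + intros t; rewrite (Derive_ext _ u1) by apply HD.
        rewrite (is_derive_unique u1 t _ (proj2 (ground_sol _ _ _ _ _ Hu t))); ring. }
  unfold lambda1; rewrite (is_glb_Rbar_unique _ _ Hglb); reflexivity.
Qed.

(** A ground state with bounds whose constants [T] and [C] are shared by all alpha in an interval;
    every passage to the limit in alpha rests on this. *)
Record state (k : nat) (T C alpha : R) (u u1 : R -> R) : Prop := {
  state_ground : ground (potential k alpha) T (lambda1 k alpha) u u1;
  state_tail : forall t, T <= Rabs t -> 1 <= potential k alpha t - lambda1 k alpha;
  state_le : forall t, u t <= C * exp (- Rabs t);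
  state_slope : forall t, Rabs (u1 t) <= C;
  state_ge : forall t, - T <= t <= T -> / C <= u t }.

Lemma states_exist (k : nat) (A : R) : 0 <= A -> exists C, 1 <= C /\
  forall alpha, Rabs alpha <= A -> exists u u1, state k (well_radius k A) C alpha u u1.
Proof.
  intros HA; set (T := well_radius k A).
  assert (HT : 1 <= T) by apply well_radius_ge1, HA.
  destruct (continuous_bounded (pmon k) (- (T + 1)) (T + 1) (pmon_continuous k)) as [P [HP0 HP]].
  set (K := (P + A) ^ 2); assert (HK : 0 <= K) by apply pow2_ge_0.
  exists ((1 + K) * exp ((2 + K) * T)); split.
  { assert (1 <= exp ((2 + K) * T)) by (rewrite <- exp_0 at 1; apply exp_mono; nra); nra. }
  intros alpha Ha; pose proof (potential_well k A alpha Ha) as HV; fold T in HV.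
  destruct (ground_exists _ _ _ HV) as [lam [u [u1 [Hu Hlam]]]].
  destruct (ground_bounds _ _ _ K lam u u1 HV) as [H1 [H2 H3]]; auto; [|lra|].
  { intros t Ht; rewrite potentialE; specialize (HP t Ht).
    apply Rabs_le_between in HP, Ha; unfold K; nra. }
  assert (El : lambda1 k alpha = lam) by (eapply lambda1_ground; eauto; lra).
  exists u, u1; split; auto.
  - rewrite El; exact Hu.
  - intros t Ht; rewrite El; apply (potential_ge _ _ _ HV); [lra | exact Ht].
Qed.

(** * The derivative of the lowest eigenvalue *)

(** Integration from +oo without an improper integral: [F - c * exp (- t)] does not decrease and
    vanishes at +oo, hence is nonpositive; the same holds for [- F]. *)
Lemma vanishing_exp_bound (F f : R -> R) (c : R) : (forall t, is_derive F t (f t)) ->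
  (forall t, 0 <= t -> Rabs (f t) <= c * exp (- t)) -> vanishing F ->
  forall t, 0 <= t -> Rabs (F t) <= c * exp (- t).
Proof.
  intros HF Hf Hv.
  assert (Hc : 0 <= c).
  { specialize (Hf 0 (Rle_refl 0)); rewrite Ropp_0, exp_0 in Hf; pose proof (Rabs_pos (f 0)); lra. }
  assert (Hgen : forall G g, (forall t, is_derive G t (g t)) ->
    (forall t, 0 <= t -> Rabs (g t) <= c * exp (- t)) -> vanishing G ->
    forall t, 0 <= t -> G t <= c * exp (- t)).
  { intros G g HG Hg Hvg t Ht.
    enough (G t + - (c * exp (- t)) <= 0) by lra.
    apply (vanishing_nondecr_nonpos (fun t => G t + - (c * exp (- t))) 0); [| |exact Ht].
    - intros r s Hrs.
      apply (le_of_derive_nonneg (fun t => G t + - (c * exp (- t))) (fun t => g t + c * exp (- t))); [lra| |].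
      + intros x _; der; ring.
      + intros x Hx; specialize (Hg x ltac:(lra)); apply Rabs_le_between in Hg; lra.
    - apply vanishing_plus; [exact Hvg|].
      apply vanishing_of_exp with c 0; [exact Hc|]; intros s _.
      rewrite Rabs_Ropp, Rabs_pos_eq; [lra|].
      apply Rmult_le_pos; [exact Hc | left; apply exp_pos]. }
  intros t Ht; apply Rabs_le; split.
  - enough (- F t <= c * exp (- t)) by lra.
    apply (Hgen (fun t => - F t) (fun t => - f t)); auto.
    + intros s; apply is_derive_Ropp, HF.
    + intros s Hs; rewrite Rabs_Ropp; auto.
    + apply vanishing_opp, Hv.
  - apply (Hgen F f); auto.
Qed.

(** * Two ground states compared through their Wronskian *)

Section Pair.
Variables (k : nat) (T C a b : R) (u u1 v v1 : R -> R).
Hypothesis HT : 1 <= T.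
Hypothesis HC : 1 <= C.
Hypothesis Hu : state k T C a u u1.
Hypothesis Hv : state k T C b v v1.

(** One constant for two products: the summand 1 serves [u v], the factorial serves [pmon u v]. *)
Definition pair_bound : R := (1 + INR (fact (k + 1))) * C ^ 2.

Lemma state_continuous (c : R) (w w1 : R -> R) : state k T C c w w1 -> forall t, continuous w t.
Proof.
  intros Hw; apply (Sol_continuous _ _ _ (ground_sol _ _ _ _ _ (state_ground _ _ _ _ _ _ Hw))).
Qed.

Lemma state_abs_le (c : R) (w w1 : R -> R) : state k T C c w w1 ->
  forall t, Rabs (w t) <= C * exp (- Rabs t).
Proof.
  intros Hw t; rewrite Rabs_pos_eq; [apply (state_le _ _ _ _ _ _ Hw)|].
  left; apply (ground_pos _ _ _ _ _ (state_ground _ _ _ _ _ _ Hw)).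
Qed.

Lemma pair_abs_le (t : R) : Rabs (u t * v t) <= C ^ 2 * (exp (- Rabs t) * exp (- Rabs t)).
Proof.
  rewrite Rabs_mult; replace (C ^ 2 * (exp (- Rabs t) * exp (- Rabs t)))
    with ((C * exp (- Rabs t)) * (C * exp (- Rabs t))) by ring.
  apply Rmult_le_compat; auto using Rabs_pos; eapply state_abs_le; eassumption.
Qed.

Lemma pair_dominated : dominated (fun t => u t * v t) pair_bound.
Proof.
  split.
  - intros t; apply (continuous_mult u v); eapply state_continuous; eassumption.
  - intros t; eapply Rle_trans; [apply pair_abs_le|].
    assert (He : 0 < exp (- Rabs t) <= 1).
    { split; [apply exp_pos|]; rewrite <- exp_0; apply exp_mono; pose proof (Rabs_pos t); lra. }
    pose proof (INR_fact_lt_0 (k + 1)) as Hf; unfold pair_bound.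
    rewrite <- Rmult_assoc; apply Rmult_le_compat_r; [lra|].
    assert (0 < C ^ 2) by (apply pow_lt; lra); nra.
Qed.

Lemma pair_pmon_dominated : dominated (fun t => pmon k t * (u t * v t)) pair_bound.
Proof.
  split.
  - intros t; apply (continuous_mult (pmon k) (fun t => u t * v t)); [apply pmon_continuous|].
    apply pair_dominated.
  - intros t; rewrite Rabs_mult.
    pose proof (pmon_exp k t) as Hp; pose proof (pair_abs_le t) as Huv.
    pose proof (INR_fact_lt_0 (k + 1)) as Hf; unfold pair_bound.
    apply Rle_trans with (INR (fact (k + 1)) * exp (Rabs t) * (C ^ 2 * (exp (- Rabs t) * exp (- Rabs t)))).
    + apply Rmult_le_compat; auto using Rabs_pos.
    + assert (He : exp (Rabs t) * exp (- Rabs t) = 1) by (rewrite <- exp_plus, <- exp_0; f_equal; ring).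
      replace (INR (fact (k + 1)) * exp (Rabs t) * (C ^ 2 * (exp (- Rabs t) * exp (- Rabs t))))
        with (INR (fact (k + 1)) * C ^ 2 * (exp (Rabs t) * exp (- Rabs t)) * exp (- Rabs t)) by ring.
      rewrite He; apply Rmult_le_compat_r; [left; apply exp_pos|].
      assert (0 < C ^ 2) by (apply pow_lt; lra); nra.
Qed.

(** Already the part over [[-1, 1]], contained in [[-T, T]], gives this. Since it depends on [C]
    only, division by the integral keeps the Lipschitz constants uniform. *)
Lemma pair_integral_ge : 2 * / C ^ 2 <= integral (fun t => u t * v t).
Proof.
  apply (integral_lower _ pair_bound); [apply pair_dominated| |].
  - intros t; left; apply Rmult_lt_0_compat; eapply ground_pos, state_ground; eassumption.
  - intros t Ht; replace (/ C ^ 2) with (/ C * / C) by (field; lra).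
    assert (0 <= / C) by (left; apply Rinv_0_lt_compat; lra).
    apply Rmult_le_compat; auto; eapply state_ge; eauto; lra.
Qed.

Lemma pair_integral_pos : 0 < integral (fun t => u t * v t).
Proof.
  pose proof pair_integral_ge as H.
  assert (0 < / C ^ 2) by (apply Rinv_0_lt_compat, pow_lt; lra); lra.
Qed.

Lemma pair_wronskian_derive (t : R) : is_derive (fun t => u t * v1 t - u1 t * v t) t
  ((lambda1 k a - lambda1 k b + (b - a) * (a + b)) * (u t * v t)
   - 2 * (b - a) * (pmon k t * (u t * v t))).
Proof.
  eapply is_derive_eq.
  - apply (Sol_wronskian _ _ _ _ _ _ (ground_sol _ _ _ _ _ (state_ground _ _ _ _ _ _ Hu))
      (ground_sol _ _ _ _ _ (state_ground _ _ _ _ _ _ Hv))).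
  - rewrite !potentialE; ring.
Qed.

Lemma pair_wronskian_vanishing : vanishing (fun t => u t * v1 t - u1 t * v t).
Proof.
  destruct Hu as [Hgu Htu _ _ _], Hv as [Hgv Htv _ _ _].
  apply (wronskian_tail_bound _ _ _ _ _ _ T T (ground_sol _ _ _ _ _ Hgu) (ground_sol _ _ _ _ _ Hgv)).
  - intros t Ht; apply Htu; rewrite Rabs_pos_eq; lra.
  - intros t Ht; apply Htv; rewrite Rabs_pos_eq; lra.
  - intros; apply Hgu.
  - intros; apply Hgv.
  - apply Hgu.
  - apply Hgv.
Qed.

Lemma pair_wronskian_vanishing_left : vanishing (fun t => u (- t) * v1 (- t) - u1 (- t) * v (- t)).
Proof.
  destruct Hu as [Hgu Htu _ _ _], Hv as [Hgv Htv _ _ _].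
  apply vanishing_ext with (fun t => - (u (- t) * - v1 (- t) - - u1 (- t) * v (- t))); [intros; ring|].
  apply vanishing_opp.
  pose proof (ground_reflect _ _ _ _ _ Hgu) as Hgu'; pose proof (ground_reflect _ _ _ _ _ Hgv) as Hgv'.
  apply (wronskian_tail_bound _ _ _ _ _ _ T T (ground_sol _ _ _ _ _ Hgu') (ground_sol _ _ _ _ _ Hgv')).
  - intros t Ht; apply Htu; rewrite Rabs_Ropp, Rabs_pos_eq; lra.
  - intros t Ht; apply Htv; rewrite Rabs_Ropp, Rabs_pos_eq; lra.
  - intros; apply Hgu.
  - intros; apply Hgv.
  - apply Hgu'.
  - apply Hgv'.
Qed.

Lemma pair_integral_identity :
  (lambda1 k b - lambda1 k a) * integral (fun t => u t * v t) =
  (b - a) * ((a + b) * integral (fun t => u t * v t) - 2 * integral (fun t => pmon k t * (u t * v t))).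
Proof.
  set (c := lambda1 k a - lambda1 k b + (b - a) * (a + b)).
  pose proof (dominated_scal _ _ c pair_dominated) as D1.
  pose proof (dominated_scal _ _ (2 * (b - a)) pair_pmon_dominated) as D2.
  assert (H : integral (fun t => c * (u t * v t) - 2 * (b - a) * (pmon k t * (u t * v t))) = 0)
    by exact (integral_derive_0 _ _ _ (dominated_minus _ _ _ _ D1 D2) pair_wronskian_derive
    pair_wronskian_vanishing pair_wronskian_vanishing_left).
  rewrite (integral_minus _ _ _ _ D1 D2) in H.
  rewrite (integral_scal _ _ _ pair_dominated), (integral_scal _ _ _ pair_pmon_dominated) in H.
  unfold c in H; lra.
Qed.

Lemma lambda1_lipschitz (A : R) : Rabs a <= A -> Rabs b <= A ->
  Rabs (lambda1 k b - lambda1 k a) <= (2 * A + 2 * pair_bound * C ^ 2) * Rabs (b - a).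
Proof.
  intros Ha Hb.
  pose proof pair_integral_identity as H; pose proof pair_integral_ge as Hge.
  pose proof (integral_abs _ _ pair_pmon_dominated) as Hp.
  set (I := integral (fun t => u t * v t)) in *; set (J := integral (fun t => pmon k t * (u t * v t))) in *.
  assert (HC2 : 0 < C ^ 2) by (apply pow_lt; lra).
  assert (HI : 0 < / C ^ 2) by (apply Rinv_0_lt_compat; lra).
  assert (E : lambda1 k b - lambda1 k a = (a + b - 2 * J / I) * (b - a)).
  { apply Rmult_eq_reg_r with I; [|lra]; rewrite H; field; lra. }
  rewrite E, Rabs_mult; apply Rmult_le_compat_r; [apply Rabs_pos|].
  assert (HJ : Rabs (2 * J / I) <= 2 * pair_bound * C ^ 2).
  { unfold Rdiv; rewrite Rabs_mult, (Rabs_mult 2), (Rabs_pos_eq 2), (Rabs_pos_eq (/ I)) by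
      (try lra; left; apply Rinv_0_lt_compat; lra).
    assert (HI2 : / I <= C ^ 2 / 2).
    { replace (C ^ 2 / 2) with (/ (2 * / C ^ 2)) by (field; lra).
      apply Rinv_le_contravar; lra. }
    apply Rle_trans with (2 * (2 * pair_bound) * (C ^ 2 / 2)); [|right; field].
    apply Rmult_le_compat; try lra.
    - pose proof (Rabs_pos J); lra.
    - left; apply Rinv_0_lt_compat; lra. }
  apply Rabs_le_between in HJ, Ha, Hb; apply Rabs_le; lra.
Qed.

(** With both values at 0 equal to 1, the Wronskian at 0 is [v1 0 - u1 0]. It is estimated by
    integrating its derivative, which carries a factor [b - a], from +oo. *)
Lemma pair_slope_lipschitz (A : R) : Rabs a <= A -> Rabs b <= A ->
  Rabs (v1 0 - u1 0) <= (4 * A + 2 * pair_bound * C ^ 2 + 2) * pair_bound * Rabs (b - a).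
Proof.
  intros Ha Hb.
  pose proof (lambda1_lipschitz A Ha Hb) as HL.
  set (c := (4 * A + 2 * pair_bound * C ^ 2 + 2) * pair_bound * Rabs (b - a)).
  pose proof (vanishing_exp_bound _ _ c pair_wronskian_derive) as H.
  assert (Hg : forall t, 0 <= t -> Rabs
    ((lambda1 k a - lambda1 k b + (b - a) * (a + b)) * (u t * v t)
     - 2 * (b - a) * (pmon k t * (u t * v t))) <= c * exp (- t)).
  { intros t Ht.
    pose proof (proj2 pair_dominated t) as D1; pose proof (proj2 pair_pmon_dominated t) as D2.
    rewrite (Rabs_pos_eq t Ht) in D1, D2.
    unfold Rminus at 1; eapply Rle_trans; [apply Rabs_triang|].
    rewrite Rabs_Ropp, (Rabs_mult (lambda1 k a - lambda1 k b + (b - a) * (a + b))),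
      (Rabs_mult (2 * (b - a))).
    assert (H1 : Rabs (lambda1 k a - lambda1 k b + (b - a) * (a + b)) <=
      (4 * A + 2 * pair_bound * C ^ 2) * Rabs (b - a)).
    { eapply Rle_trans; [apply Rabs_triang|].
      rewrite (Rabs_minus_sym (lambda1 k a)), Rabs_mult.
      assert (Hab : Rabs (a + b) <= 2 * A) by (eapply Rle_trans; [apply Rabs_triang | lra]).
      pose proof (Rabs_pos (b - a)); nra. }
    assert (H2 : Rabs (2 * (b - a)) = 2 * Rabs (b - a)) by (rewrite Rabs_mult, Rabs_pos_eq; lra).
    rewrite H2.
    apply Rle_trans with ((4 * A + 2 * pair_bound * C ^ 2) * Rabs (b - a) * (pair_bound * exp (- t))
      + 2 * Rabs (b - a) * (pair_bound * exp (- t))); [|right; unfold c; ring].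
    apply Rplus_le_compat.
    - apply Rmult_le_compat; auto using Rabs_pos.
    - apply Rmult_le_compat_l; [pose proof (Rabs_pos (b - a)); lra | exact D2]. }
  specialize (H Hg pair_wronskian_vanishing 0 (Rle_refl 0)); cbv beta in H.
  rewrite (ground_0 _ _ _ _ _ (state_ground _ _ _ _ _ _ Hu)),
    (ground_0 _ _ _ _ _ (state_ground _ _ _ _ _ _ Hv)), Ropp_0, exp_0 in H.
  replace (v1 0 - u1 0) with (1 * v1 0 - u1 0 * 1) by ring; lra.
Qed.

End Pair.

Lemma locally'_near (x d : R) (P : R -> Prop) : 0 < d ->
  (forall y, Rabs (y - x) < d -> y <> x -> P y) -> locally' x P.
Proof. intros Hd H; exists (mkposreal d Hd); intros y Hy Hne; apply H; auto. Qed.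

Lemma is_derive_of_slope (f : R -> R) (x l : R) :
  is_lim (fun y => (f y - f x) / (y - x)) x l -> is_derive f x l.
Proof.
  intros H; apply is_derive_Reals; intros eps Heps.
  apply is_lim_spec in H; destruct (H (mkposreal eps Heps)) as [d Hd]; exists d; intros h Hh Hhd.
  specialize (Hd (x + h)).
  replace (x + h - x) with h in Hd by ring; apply Hd; [|lra].
  unfold ball; simpl; unfold AbsRing_ball, abs, minus, plus, opp; simpl.
  replace (x + h + - x) with h by ring; exact Hhd.
Qed.

Lemma is_lim_quotient (f g : R -> R) (x l m : R) : is_lim f x l -> is_lim g x m -> m <> 0 ->
  is_lim (fun y => f y / g y) x (l / m).
Proof.
  intros Hf Hg Hm; apply (is_lim_div f g x l m Hf Hg); [|simpl; auto].
  intros E; injection E; exact Hm.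
Qed.

Lemma locally_uniform_mult (G : (R -> Prop) -> Prop) {FG : Filter G}
  (F H : R -> R -> R) (f h : R -> R) :
  (forall t, continuous f t) -> (forall t, continuous h t) ->
  locally_uniform G F f -> locally_uniform G H h ->
  locally_uniform G (fun b t => F b t * H b t) (fun t => f t * h t).
Proof.
  intros Hf Hh HF HH N eps Heps.
  destruct (continuous_bounded f (- N) N Hf) as [K [HK0 HK]].
  destruct (continuous_bounded h (- N) N Hh) as [L [HL0 HL]].
  set (d := Rmin 1 (eps / (K + L + 1))).
  assert (Hd0 : 0 < d) by (apply Rmin_pos; [lra | apply Rdiv_lt_0_compat; lra]).
  assert (Hd1 : d <= 1) by apply Rmin_l.
  assert (Hd2 : d * (K + L + 1) <= eps).
  { apply Rle_trans with (eps / (K + L + 1) * (K + L + 1)); [|right; field; lra].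
    apply Rmult_le_compat_r; [lra | apply Rmin_r]. }
  generalize (filter_and _ _ (HF N d Hd0) (HH N d Hd0)); apply filter_imp; intros b [H1 H2] t Ht.
  specialize (H1 t Ht); specialize (H2 t Ht); specialize (HK t Ht); specialize (HL t Ht).
  replace (F b t * H b t - f t * h t) with
    (f t * (H b t - h t) + (F b t - f t) * h t + (F b t - f t) * (H b t - h t)) by ring.
  eapply Rle_trans; [apply Rabs_triang|].
  eapply Rle_trans; [apply Rplus_le_compat_r, Rabs_triang|].
  rewrite !Rabs_mult.
  pose proof (Rabs_pos (f t)); pose proof (Rabs_pos (h t)).
  pose proof (Rabs_pos (F b t - f t)); pose proof (Rabs_pos (H b t - h t)).
  assert (Rabs (f t) * Rabs (H b t - h t) <= K * d) by (apply Rmult_le_compat; lra).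
  assert (Rabs (F b t - f t) * Rabs (h t) <= d * L) by (apply Rmult_le_compat; lra).
  assert (Rabs (F b t - f t) * Rabs (H b t - h t) <= d * 1) by (apply Rmult_le_compat; lra).
  lra.
Qed.

Lemma locally_uniform_const (G : (R -> Prop) -> Prop) {FG : Filter G} (f : R -> R) :
  locally_uniform G (fun _ => f) f.
Proof.
  intros N eps Heps; apply filter_forall; intros b t _; rewrite Rminus_eq_0, Rabs_R0; lra.
Qed.

(** * Continuity of the ground state in alpha and the first derivative *)

Section Derivative.
Variables (k : nat) (A T C : R) (U U1 : R -> R -> R).
Hypothesis HT : 1 <= T.
Hypothesis HC : 1 <= C.
Hypothesis HU : forall a, Rabs a <= A -> state k T C a (U a) (U1 a).

Lemma near_bounded (a : R) : Rabs a < A -> locally' a (fun b => Rabs b <= A).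
Proof.
  intros Ha; apply (locally'_near a (A - Rabs a)); [lra|]; intros y Hy _.
  replace y with (a + (y - a)) by ring; eapply Rle_trans; [apply Rabs_triang | lra].
Qed.

(** The value at 0 is fixed, while the slope at 0, the energy and the potential on [[-N, N]] are
    Lipschitz in [b]; stability of the initial value problem does the rest. *)
Lemma states_converge (a : R) : Rabs a < A -> locally_uniform (locally' a) U (U a).
Proof.
  intros Ha N eps Heps.
  assert (Ha' : Rabs a <= A) by lra.
  pose proof (HU a Ha') as Hs; pose proof (state_ground _ _ _ _ _ _ Hs) as Hg.
  destruct (Sol_stability _ _ _ N eps
    (continuous_minus_const _ _ _ (potential_well k A a Ha') _) (ground_sol _ _ _ _ _ Hg) Heps)
    as [d [Hd HS]].
  destruct (continuous_bounded (pmon k) (- N) N (pmon_continuous k)) as [P [HP0 HP]].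
  set (D := pair_bound k C).
  assert (HD : 0 <= D) by (apply (dominated_nonneg _ _ (pair_dominated k T C a a _ _ _ _ HC Hs Hs))).
  assert (HA : 0 <= A) by (pose proof (Rabs_pos a); lra).
  set (L1 := 2 * A + 2 * D * C ^ 2); set (L2 := (4 * A + 2 * D * C ^ 2 + 2) * D).
  assert (HC2 : 0 < C ^ 2) by (apply pow_lt; lra).
  assert (HL1 : 0 <= L1) by (unfold L1; nra).
  assert (HL2 : 0 <= L2) by (unfold L2; apply Rmult_le_pos; [nra | lra]).
  (* Adds the Lipschitz constants of the energy ([L1]), the slope ([L2]) and the potential
     ([2 * A + 2 * P]). *)
  set (Z := L1 + L2 + 2 * A + 2 * P + 1).
  assert (HZ : 1 <= Z) by (unfold Z; lra).
  assert (Hnear : locally' a (fun b => Rabs (b - a) < d / Z)).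
  { apply (locally'_near a (d / Z)); [apply Rdiv_lt_0_compat; lra | auto]. }
  generalize (filter_and _ _ Hnear (near_bounded a Ha)); apply filter_imp; intros b [Hb HbA].
  pose proof (HU b HbA) as Hsb; pose proof (state_ground _ _ _ _ _ _ Hsb) as Hgb.
  assert (HbZ : Z * Rabs (b - a) <= d).
  { apply Rle_trans with (Z * (d / Z)); [apply Rmult_le_compat_l; lra | right; field; lra]. }
  pose proof (Rabs_pos (b - a)) as Hba.
  pose proof (lambda1_lipschitz _ _ _ _ _ _ _ _ _ HT HC Hs Hsb A Ha' HbA) as HLip; fold D in HLip; fold L1 in HLip.
  pose proof (pair_slope_lipschitz _ _ _ _ _ _ _ _ _ HT HC Hs Hsb A Ha' HbA) as HSl; fold D in HSl; fold L2 in HSl.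
  assert (H1 : forall t, - N <= t <= N ->
    Rabs (potential k b t - lambda1 k b - (potential k a t - lambda1 k a)) <= d).
  { intros t Ht; rewrite !potentialE.
    replace ((pmon k t - b) ^ 2 - lambda1 k b - ((pmon k t - a) ^ 2 - lambda1 k a))
      with (- (lambda1 k b - lambda1 k a) + (b - a) * (a + b + - (2 * pmon k t))) by ring.
    eapply Rle_trans; [apply Rabs_triang|]; rewrite Rabs_Ropp, Rabs_mult.
    assert (H2 : Rabs (a + b + - (2 * pmon k t)) <= 2 * A + 2 * P).
    { eapply Rle_trans; [apply Rabs_triang|]; rewrite Rabs_Ropp, Rabs_mult, (Rabs_pos_eq 2) by lra.
      pose proof (Rabs_triang a b); specialize (HP t Ht); lra. }
    assert (H3 : Rabs (b - a) * Rabs (a + b + - (2 * pmon k t)) <= Rabs (b - a) * (2 * A + 2 * P))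
      by (apply Rmult_le_compat_l; lra).
    unfold Z in HbZ; nra. }
  intros t Ht; apply (HS _ _ _ (ground_sol _ _ _ _ _ Hgb)); auto.
  - rewrite (ground_0 _ _ _ _ _ Hgb), (ground_0 _ _ _ _ _ Hg), Rminus_eq_0, Rabs_R0; lra.
  - unfold Z in HbZ; nra.
Qed.

Lemma integral_pair_lim (a : R) : Rabs a < A ->
  is_lim (fun b => integral (fun t => U a t * U b t)) a (integral (fun t => U a t * U a t)) /\
  is_lim (fun b => integral (fun t => pmon k t * (U a t * U b t))) a
    (integral (fun t => pmon k t * (U a t * U a t))).
Proof.
  intros Ha.
  assert (Ha' : Rabs a <= A) by lra.
  pose proof (HU a Ha') as Hs.
  pose proof (state_continuous _ _ _ _ _ _ Hs) as Hc.
  assert (Hlu : locally_uniform (locally' a) (fun b t => U a t * U b t) (fun t => U a t * U a t)).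
  { apply locally_uniform_mult with (F := fun _ => U a); auto.
    - apply locally'_filter.
    - apply locally_uniform_const, locally'_filter.
    - apply states_converge, Ha. }
  split.
  - apply (integral_limit (locally' a) (fun b t => U a t * U b t) _ (pair_bound k C)); [| |exact Hlu].
    + generalize (near_bounded a Ha); apply filter_imp; intros b Hb.
      exact (pair_dominated _ _ _ _ _ _ _ _ _ HC Hs (HU b Hb)).
    + exact (pair_dominated _ _ _ _ _ _ _ _ _ HC Hs Hs).
  - apply (integral_limit (locally' a) (fun b t => pmon k t * (U a t * U b t)) _ (pair_bound k C)).
    + generalize (near_bounded a Ha); apply filter_imp; intros b Hb.
      exact (pair_pmon_dominated _ _ _ _ _ _ _ _ _ HC Hs (HU b Hb)).
    + exact (pair_pmon_dominated _ _ _ _ _ _ _ _ _ HC Hs Hs).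
    + apply locally_uniform_mult with (F := fun _ => pmon k); auto.
      * apply locally'_filter.
      * apply pmon_continuous.
      * intros t; apply (continuous_mult (U a) (U a)); apply Hc.
      * apply locally_uniform_const, locally'_filter.
Qed.

Lemma lambda1_derive (a : R) : Rabs a < A ->
  is_derive (lambda1 k) a (2 * a - 2 * (integral (fun t => pmon k t * (U a t * U a t))
    / integral (fun t => U a t * U a t))).
Proof.
  intros Ha; apply is_derive_of_slope.
  assert (Ha' : Rabs a <= A) by lra.
  pose proof (HU a Ha') as Hs.
  destruct (integral_pair_lim a Ha) as [HI HJ].
  assert (HIpos : 0 < integral (fun t => U a t * U a t))
    by exact (pair_integral_pos _ _ _ _ _ _ _ _ _ HT HC Hs Hs).
  apply is_lim_ext_loc with (fun b => (a + b) - 2 *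
    (integral (fun t => pmon k t * (U a t * U b t)) / integral (fun t => U a t * U b t))).
  - generalize (filter_and _ _ (near_bounded a Ha)
      (locally'_near a 1 (fun b => b <> a) Rlt_0_1 (fun y _ h => h))).
    apply filter_imp; intros b [Hb Hne].
    pose proof (pair_integral_identity _ _ _ _ _ _ _ _ _ HT HC Hs (HU b Hb)) as Hid.
    pose proof (pair_integral_pos _ _ _ _ _ _ _ _ _ HT HC Hs (HU b Hb)) as Hp.
    set (I := integral (fun t => U a t * U b t)) in *.
    set (J := integral (fun t => pmon k t * (U a t * U b t))) in *.
    apply Rmult_eq_reg_r with ((b - a) * I); [|apply Rmult_integral_contrapositive_currified; lra].
    replace ((lambda1 k b - lambda1 k a) / (b - a) * ((b - a) * I))
      with ((lambda1 k b - lambda1 k a) * I) by (field; lra).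
    rewrite Hid; field; lra.
  - replace (2 * a) with (a + a) by ring.
    apply is_lim_minus'.
    + apply is_lim_plus'; [apply is_lim_const | apply is_lim_id].
    + apply (is_lim_scal_l _ 2 a (Finite _)), is_lim_quotient; auto; lra.
Qed.

End Derivative.

Lemma states_choice (k : nat) (A : R) : 0 <= A -> exists C U U1, 1 <= C /\
  forall a, Rabs a <= A -> state k (well_radius k A) C a (U a) (U1 a).
Proof.
  intros HA; destruct (states_exist k A HA) as [C [HC H]].
  destruct (functional_choice (fun a (w : (R -> R) * (R -> R)) =>
    Rabs a <= A -> state k (well_radius k A) C a (fst w) (snd w))) as [f Hf].
  - intros a; destruct (Rle_dec (Rabs a) A) as [Ha|Ha].
    + destruct (H a Ha) as [u [u1 Hu]]; exists (u, u1); auto.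
    + exists (fun _ => 0, fun _ => 0); intros; contradiction.
  - exists C, (fun a => fst (f a)), (fun a => snd (f a)); auto.
Qed.

Lemma lambda1_ex_derive (k : nat) (a : R) : ex_derive (lambda1 k) a.
Proof.
  set (A := Rabs a + 1).
  assert (HA : 0 <= A) by (unfold A; pose proof (Rabs_pos a); lra).
  destruct (states_choice k A HA) as [C [U [U1 [HC HU]]]].
  eexists; apply (lambda1_derive k A (well_radius k A) C U U1); auto.
  - apply well_radius_ge1, HA.
  - unfold A; lra.
Qed.

(** * Symmetry under alpha -> -alpha *)

Lemma ground_even (k : nat) (T a lam : R) (u u1 : R -> R) : Nat.Even k ->
  ground (potential k a) T lam u u1 ->
  ground (potential k (- a)) T lam (fun t => u (- t)) (fun t => - u1 (- t)).
Proof.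
  intros Hk Hu; destruct (ground_reflect _ _ _ _ _ Hu) as [H1 H2 H3 H4 H5]; split; auto.
  apply (Sol_ext (fun t => potential k a (- t) - lam)); [|exact H1].
  intros t; rewrite potential_reflect by exact Hk; reflexivity.
Qed.

Lemma lambda1_even (k : nat) (a : R) : Nat.Even k -> lambda1 k (- a) = lambda1 k a.
Proof.
  intros Hk.
  destruct (ground_exists _ _ _ (potential_well k (Rabs a) a (Rle_refl _))) as [lam [u [u1 [Hu Hlam]]]].
  destruct (continuous_bounded (potential k a) (- (well_radius k (Rabs a) + 1)) (well_radius k (Rabs a) + 1)
    (potential_continuous k a)) as [K [_ HK]].
  destruct (ground_bounds _ (well_bound (Rabs a)) _ K lam u u1 (potential_well k (Rabs a) a (Rle_refl _))
    (fun t Ht => Rle_trans _ _ _ (Rle_abs _) (HK t Ht)) ltac:(lra) Hu) as [HC _].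
  rewrite (lambda1_ground k (Rabs a) a lam _ u u1 (Rle_refl _) Hu ltac:(lra) HC).
  apply (lambda1_ground k (Rabs a) (- a) lam ((1 + K) * exp ((2 + K) * well_radius k (Rabs a)))
    (fun t => u (- t)) (fun t => - u1 (- t))).
  - rewrite Rabs_Ropp; apply Rle_refl.
  - apply ground_even; auto.
  - lra.
  - intros t; rewrite <- (Rabs_Ropp t); apply HC.
Qed.

Lemma lambda1_derive_0 (k : nat) : Nat.Even k -> is_derive (lambda1 k) 0 0.
Proof.
  intros Hk; destruct (lambda1_ex_derive k 0) as [l Hl].
  assert (H : is_derive (lambda1 k) 0 (- l)).
  { apply (is_derive_ext (fun a => lambda1 k (- a))); [intros; apply lambda1_even, Hk|].
    apply is_derive_reflect; rewrite Ropp_0; exact Hl. }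
  apply is_derive_unique in H; rewrite (is_derive_unique _ _ _ Hl) in H.
  replace 0 with l at 2 by lra; exact Hl.
Qed.

(** * The second derivative at the origin *)

Lemma state_even (k : nat) (T C b : R) (v v1 : R -> R) : Nat.Even k ->
  state k T C b v v1 -> state k T C (- b) (fun t => v (- t)) (fun t => - v1 (- t)).
Proof.
  intros Hk [H1 H2 H3 H4 H5]; split.
  - rewrite lambda1_even by exact Hk; apply ground_even; auto.
  - intros t Ht; rewrite lambda1_even, <- potential_reflect by exact Hk.
    apply H2; rewrite Rabs_Ropp; exact Ht.
  - intros t; rewrite <- (Rabs_Ropp t); apply H3.
  - intros t; rewrite Rabs_Ropp; apply H4.
  - intros t Ht; apply H5; lra.
Qed.

Lemma pow_strict_mono (s t : R) (k : nat) : (0 < k)%nat -> 0 <= s < t -> s ^ k < t ^ k.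
Proof.
  intros Hk Hst; induction k as [|[|k] IH]; [lia | simpl; lra |].
  specialize (IH ltac:(lia)); change (s * s ^ S k < t * t ^ S k).
  apply Rmult_le_0_lt_compat; try lra; apply pow_le; lra.
Qed.

Section SecondDerivative.
Variables (k : nat) (C : R) (U U1 : R -> R -> R).
Hypothesis Hk : Nat.Even k.
Hypothesis Hk0 : (0 < k)%nat.
Hypothesis HC : 1 <= C.
Let T := well_radius k 1.
Hypothesis HU : forall b, Rabs b <= 1 -> state k T C b (U b) (U1 b).

Let u := U 0.
Let u1 := U1 0.
Let lam := lambda1 k 0.

Lemma radius_ge1 : 1 <= T.
Proof. apply well_radius_ge1; lra. Qed.

Lemma ground0_state : state k T C 0 u u1.
Proof. apply HU; rewrite Rabs_R0; lra. Qed.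

Lemma ground0_ground : ground (potential k 0) T lam u u1.
Proof. apply ground0_state. Qed.

Lemma ground0_sol : Sol (fun t => potential k 0 t - lam) u u1.
Proof. apply ground0_ground. Qed.

Lemma ground0_pos (t : R) : 0 < u t.
Proof. apply ground0_ground. Qed.

Lemma ground0_continuous (t : R) : continuous u t.
Proof. apply (Sol_continuous _ _ _ ground0_sol). Qed.

(** At alpha = 0 the reflection of [u] solves the same equation. Their Wronskian is the constant
    [-2 * u1 0] and vanishes at infinity, so [u1 0 = 0]; the difference of the two solutions then
    has zero initial data. *)
Lemma ground0_even (t : R) : u (- t) = u t.
Proof.
  pose proof (state_even _ _ _ _ _ _ Hk ground0_state) as Hs; rewrite Ropp_0 in Hs.
  pose proof (ground_sol _ _ _ _ _ (state_ground _ _ _ _ _ _ Hs)) as Hr; cbv beta in Hr.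
  fold lam in Hr.
  assert (H0 : u1 0 = 0).
  { pose proof (wronskian_const _ _ _ _ _ ground0_sol Hr) as Hw; cbv beta in Hw.
    rewrite Ropp_0, (ground_0 _ _ _ _ _ ground0_ground) in Hw.
    destruct (Req_dec (u1 0) 0) as [|Hne]; [assumption|exfalso].
    destruct (pair_wronskian_vanishing _ _ _ _ _ _ _ _ _ radius_ge1 ground0_state Hs (Rabs (u1 0))) as [N HN].
    - apply Rabs_pos_lt, Hne.
    - specialize (HN N (Rle_refl N)); cbv beta in HN; rewrite Hw in HN.
      replace (1 * - u1 0 - u1 0 * 1) with (-2 * u1 0) in HN by ring.
      rewrite Rabs_mult, (Rabs_left (-2)) in HN by lra.
      pose proof (Rabs_pos_lt _ Hne); lra. }
  pose proof (Sol_lincomb _ _ _ _ _ 1 (-1) Hr ground0_sol) as Hd.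
  pose proof (Sol_unique_zero _ _ _ 0
    (continuous_minus_const _ _ _ (potential_well k 1 0 ltac:(rewrite Rabs_R0; lra)) _) Hd) as Hz.
  cbv beta in Hz; rewrite Ropp_0, H0 in Hz.
  specialize (Hz ltac:(ring) ltac:(ring) t); lra.
Qed.

Lemma ground0_slope_odd (t : R) : u1 (- t) = - u1 t.
Proof.
  pose proof (proj1 (Sol_reflect _ _ _ ground0_sol t)) as H.
  apply (is_derive_ext _ u) in H; [|intros; apply ground0_even].
  apply is_derive_unique in H; rewrite (is_derive_unique _ _ _ (proj1 (ground0_sol t))) in H; lra.
Qed.

Lemma ground0_slope_0 : u1 0 = 0.
Proof. pose proof (ground0_slope_odd 0) as H; rewrite Ropp_0 in H; lra. Qed.

Lemma pmon_0 : pmon k 0 = 0.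
Proof. unfold pmon; rewrite pow_i by lia; unfold Rdiv; ring. Qed.

Lemma pmon_pos (t : R) : 0 <= t -> 0 <= pmon k t.
Proof.
  intros Ht; apply Rmult_le_pos; [apply pow_le, Ht | left; apply Rinv_0_lt_compat, INR_k1_pos].
Qed.

Lemma pmon_ge1 (t : R) : T <= t -> 1 <= pmon k t.
Proof.
  intros Ht; pose proof radius_ge1.
  pose proof (pmon_beyond k 1 t ltac:(lra)) as H1.
  rewrite !Rabs_pos_eq in H1 by (try apply pmon_pos; lra).
  specialize (H1 Ht); assert (0 <= well_bound 1) by apply pow2_ge_0; lra.
Qed.

(** * The slope inequality on the right half-line *)

Let P (t : R) : R := t ^ (k + 2) / (INR (k + 1) * INR (k + 2)).

Lemma exponent_derive (t : R) : is_derive P t (pmon k t).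
Proof.
  assert (0 < INR (k + 2)) by (apply lt_0_INR; lia); pose proof (INR_k1_pos k).
  assert (INR (k + 1) * INR (k + 2) <> 0) by (apply Rmult_integral_contrapositive_currified; lra).
  unfold P, pmon; der.
  replace (Nat.pred (k + 2)) with (k + 1)%nat by lia; field; lra.
Qed.

Let D (t : R) : R := u1 t + pmon k t * u t.
Let y (t : R) : R := exp (- P t) * D t.

(** The potential at 0 is [p^2] with [p = pmon k], so [(u1 + p u)' = p (u1 + p u) + (t^k - lam) u];
    the integrating factor [exp (- P t)] removes the first term. *)
Lemma damped_derive (t : R) : is_derive y t (exp (- P t) * ((t ^ k - lam) * u t)).
Proof.
  destruct (ground0_sol t); pose proof (exponent_derive t); pose proof (pmon_derive k t).
  unfold y, D; der; rewrite potentialE; ring.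
Qed.

(** [D] is bounded, the decay of [u] absorbing [pmon]; and [P t - t] does not decrease beyond [T],
    where [pmon >= 1], so the weight decays at least like [exp (- t)]. *)
Lemma damped_vanishing : vanishing y.
Proof.
  set (B := C + INR (fact (k + 1)) * C).
  pose proof (INR_fact_lt_0 (k + 1)) as Hf.
  assert (HB : 0 <= B) by (unfold B; nra).
  apply vanishing_of_exp with (B * exp (T - P T)) T.
  { apply Rmult_le_pos; [exact HB | left; apply exp_pos]. }
  intros t Ht.
  assert (HP : P T - T <= P t - t).
  { apply (le_of_derive_nonneg (fun t => P t - t) (fun t => pmon k t - 1)); [exact Ht| |].
    - intros s _; pose proof (exponent_derive s); der; ring.
    - intros s Hs; pose proof (pmon_ge1 s ltac:(lra)); lra. }
  assert (HD : Rabs (D t) <= B).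
  { unfold D; eapply Rle_trans; [apply Rabs_triang|]; unfold B.
    apply Rplus_le_compat; [apply (state_slope _ _ _ _ _ _ ground0_state)|].
    rewrite Rabs_mult.
    apply Rle_trans with ((INR (fact (k + 1)) * exp (Rabs t)) * (C * exp (- Rabs t))).
    - apply Rmult_le_compat; auto using Rabs_pos; [apply pmon_exp|].
      apply (state_abs_le _ _ _ _ _ _ ground0_state).
    - right; replace (INR (fact (k + 1)) * C) with (INR (fact (k + 1)) * C * exp (Rabs t + - Rabs t)).
      + rewrite exp_plus; ring.
      + rewrite Rplus_opp_r, exp_0; ring. }
  unfold y; rewrite Rabs_mult, (Rabs_pos_eq (exp _)) by (left; apply exp_pos).
  rewrite Rmult_assoc, <- exp_plus, Rmult_comm.
  apply Rmult_le_compat; [apply Rabs_pos | left; apply exp_pos | exact HD | apply exp_mono; lra].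
Qed.

(* [y] first decreases, as long as [t^k < lam], then increases to its limit 0. *)
Lemma damped_negative (t : R) : 0 < t -> y t < 0.
Proof.
  intros Ht; destruct (Rle_lt_dec (t ^ k) lam) as [Hl|Hl].
  - assert (H0 : y 0 = 0) by (unfold y, D; rewrite ground0_slope_0, pmon_0; ring).
    enough (- y 0 < - y t) by lra.
    apply (lt_of_derive_pos (fun t => - y t) (fun t => - (exp (- P t) * ((t ^ k - lam) * u t)))); [lra| |].
    + intros s _; apply is_derive_Ropp, damped_derive.
    + intros s Hs; pose proof (pow_strict_mono s t k Hk0 ltac:(lra)).
      pose proof (exp_pos (- P s)); pose proof (ground0_pos s).
      replace (- (exp (- P s) * ((s ^ k - lam) * u s))) with (exp (- P s) * ((lam - s ^ k) * u s)) by ring.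
      apply Rmult_lt_0_compat; [lra|]; apply Rmult_lt_0_compat; lra.
  - assert (Hinc : forall r s, t <= r < s -> y r < y s).
    { intros r s Hrs.
      apply (lt_of_derive_pos y (fun t => exp (- P t) * ((t ^ k - lam) * u t))); [lra| |].
      - intros x _; apply damped_derive.
      - intros x Hx; pose proof (exp_pos (- P x)); pose proof (ground0_pos x).
        assert (t ^ k <= x ^ k) by (apply pow_incr; lra).
        apply Rmult_lt_0_compat; [lra|]; apply Rmult_lt_0_compat; lra. }
    apply Rlt_le_trans with (y (t + 1)); [apply Hinc; lra|].
    apply (vanishing_nondecr_nonpos y t); [|apply damped_vanishing|lra].
    intros r s Hrs; destruct (Req_dec r s) as [->|]; [lra | left; apply Hinc; lra].
Qed.

Lemma ground0_slope_lt (t : R) : 0 < t -> u1 t < - (pmon k t * u t).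
Proof.
  intros Ht; pose proof (damped_negative t Ht) as Hy; unfold y, D in Hy; pose proof (exp_pos (- P t)); nra.
Qed.

(** * The moment [G] and its comparison with [u^2] *)

Let f0 (t : R) : R := 2 * (pmon k t * (u t * u t)).
(** The integral of [f0] from [t] to +oo, written with a finite endpoint so that it can be
    differentiated. *)
Let G (t : R) : R := half_integral f0 - RInt f0 0 t.

Lemma moment_density_dominated : dominated f0 (Rabs 2 * pair_bound k C).
Proof. apply dominated_scal, (pair_pmon_dominated _ _ _ _ _ _ _ _ _ HC ground0_state ground0_state). Qed.

Lemma moment_derive (t : R) : is_derive G t (- f0 t).
Proof.
  assert (H : is_derive (RInt f0 0) t (f0 t)).
  { apply (is_derive_RInt (V := R_NormedModule) f0 (RInt f0 0) 0).
    - apply filter_forall; intros s.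
      apply (RInt_correct (V := R_CompleteNormedModule)), ex_RInt_cont, moment_density_dominated.
    - apply moment_density_dominated. }
  unfold G; der; ring.
Qed.

Lemma moment_vanishing : vanishing G.
Proof.
  apply vanishing_of_exp with (Rabs 2 * pair_bound k C) 0.
  - apply (dominated_nonneg _ _ moment_density_dominated).
  - intros t Ht; unfold G; rewrite Rabs_minus_sym.
    apply (dominated_half _ _ t moment_density_dominated Ht).
Qed.

(** [f0] is odd because [pmon k] is odd and [u] even. Hence [G], built to vanish at +oo, vanishes at
    -oo as well: this is the solvability condition of first-order perturbation theory. *)
Lemma moment_even (t : R) : G (- t) = G t.
Proof.
  assert (H : forall s, is_derive (fun s => G (- s) - G s) s 0).
  { intros s; pose proof (is_derive_reflect G s _ (moment_derive (- s))); pose proof (moment_derive s).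
    der; unfold f0; rewrite pmon_opp, ground0_even by exact Hk; ring. }
  pose proof (const_of_derive_0 _ H t 0) as E; cbv beta in E.
  rewrite Ropp_0 in E; lra.
Qed.

Lemma ground0_sq_vanishing : vanishing (fun t => u t ^ 2).
Proof.
  apply vanishing_of_exp with (pair_bound k C) 0.
  - apply (dominated_nonneg _ _ (pair_dominated _ _ _ _ _ _ _ _ _ HC ground0_state ground0_state)).
  - intros t Ht; replace (u t ^ 2) with (u t * u t) by ring.
    rewrite <- (Rabs_pos_eq t) at 3 by exact Ht.
    apply (pair_dominated _ _ _ _ _ _ _ _ _ HC ground0_state ground0_state).
Qed.

Lemma moment_bounds_half (t : R) : 0 <= t -> 0 <= G t < u t ^ 2.
Proof.
  intros Ht; split.
  - enough (- G t <= 0) by lra.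
    apply (vanishing_nondecr_nonpos (fun t => - G t) 0); [| |exact Ht].
    + intros r s Hrs; apply (le_of_derive_nonneg (fun t => - G t) (fun t => f0 t)); [lra| |].
      * intros x _; eapply is_derive_eq; [apply is_derive_Ropp, moment_derive | ring].
      * intros x Hx; unfold f0; pose proof (pmon_pos x ltac:(lra)); pose proof (ground0_pos x).
        apply Rmult_le_pos; [lra|]; apply Rmult_le_pos; nra.
    + apply vanishing_opp, moment_vanishing.
  - set (H := fun t => G t + - u t ^ 2).
    assert (Hinc : forall r s, 0 <= r < s -> H r < H s).
    { intros r s Hrs; apply (lt_of_derive_pos H (fun t => - 2 * u t * (u1 t + pmon k t * u t))); [lra| |].
      - intros x _; destruct (ground0_sol x); pose proof (moment_derive x); unfold H; der; unfold f0; ring.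
      - intros x Hx; pose proof (ground0_slope_lt x ltac:(lra)); pose proof (ground0_pos x); nra. }
    assert (Hv : vanishing H).
    { apply vanishing_plus; [apply moment_vanishing|].
      apply (vanishing_opp (fun t => u t ^ 2)), ground0_sq_vanishing. }
    enough (H t < 0) by (unfold H in *; lra).
    apply Rlt_le_trans with (H (t + 1)); [apply Hinc; lra|].
    apply (vanishing_nondecr_nonpos H 0); [|exact Hv|lra].
    intros r s Hrs; destruct (Req_dec r s) as [->|]; [lra | left; apply Hinc; lra].
Qed.

Lemma moment_bounds (t : R) : 0 <= G t < u t ^ 2.
Proof.
  destruct (Rle_lt_dec 0 t); [apply moment_bounds_half; assumption|].
  rewrite <- moment_even, <- ground0_even; apply moment_bounds_half; lra.
Qed.

(** The coefficient in the derivative [(kap b - 2 pmon) u v] of the Wronskian divided by [b]. It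
    tends to 0 with [b] since [lambda1] has derivative 0 at 0. *)
Let kap (b : R) : R := - ((lambda1 k b - lam) / b) + b.
(** The Lipschitz constant of [lambda1] on [[-1, 1]] plus the bound 1 on [Rabs b]. *)
Let kap0 : R := 2 * 1 + 2 * pair_bound k C * C ^ 2 + 1.
(** Large enough for the tail, where the factor is [kap0 + 2], and for [[0, T]], where a constant
    bound is divided by [u v >= / C ^ 2]. *)
Let cK : R := (kap0 + 2) * (1 + pair_bound k C * C ^ 2).

Lemma pair_bound_nonneg : 0 <= pair_bound k C.
Proof. apply (dominated_nonneg _ _ (pair_dominated _ _ _ _ _ _ _ _ _ HC ground0_state ground0_state)). Qed.

Lemma shift_bound_ge1 : 1 <= kap0.
Proof. pose proof pair_bound_nonneg; assert (0 < C ^ 2) by (apply pow_lt; lra); unfold kap0; nra. Qed.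

Lemma quotient_constant_ge : kap0 + 2 <= cK /\ (kap0 + 2) * pair_bound k C * C ^ 2 <= cK.
Proof.
  pose proof pair_bound_nonneg; pose proof shift_bound_ge1; assert (0 < C ^ 2) by (apply pow_lt; lra).
  assert (0 <= pair_bound k C * C ^ 2) by nra. unfold cK; split; nra.
Qed.

(** * Difference quotients of the ground state at alpha = 0 *)

Section Quotient.
Variables (b : R) (v v1 : R -> R).
Hypothesis Hb : Rabs b <= 1.
Hypothesis Hb0 : b <> 0.
Hypothesis Hv : state k T C b v v1.

(** This is [u^2 ((v/u)/b)'], equally [u^2 (w/u)'] for the difference quotient [w = (v - u)/b]. *)
Let K (t : R) : R := (u t * v1 t - u1 t * v t) / b.

Lemma shift_bound : Rabs (kap b) <= kap0.
Proof.
  pose proof (lambda1_lipschitz _ _ _ _ _ _ _ _ _ radius_ge1 HC ground0_state Hv 1 ltac:(rewrite Rabs_R0; lra) Hb) as HL.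
  fold lam in HL; rewrite Rminus_0_r in HL.
  unfold kap; eapply Rle_trans; [apply Rabs_triang|].
  rewrite Rabs_Ropp; unfold kap0; apply Rplus_le_compat; [|exact Hb].
  unfold Rdiv; rewrite Rabs_mult, Rabs_inv.
  pose proof (Rabs_pos_lt b Hb0).
  apply Rmult_le_reg_r with (Rabs b); [assumption|].
  rewrite Rmult_assoc, Rinv_l, Rmult_1_r by lra; exact HL.
Qed.

Lemma quotient_derive (t : R) : is_derive K t (kap b * (u t * v t) - 2 * (pmon k t * (u t * v t))).
Proof.
  pose proof (pair_wronskian_derive _ _ _ _ _ _ _ _ _ ground0_state Hv t) as H; cbv beta in H.
  apply is_derive_ext with (fun t => / b * (u t * v1 t - u1 t * v t)).
  { intros s; apply Rmult_comm. }
  eapply is_derive_eq; [apply is_derive_scal, H|].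
  fold lam; unfold scal, kap; simpl; unfold mult; simpl; field; exact Hb0.
Qed.

Lemma quotient_vanishing : vanishing K.
Proof.
  intros eps He.
  destruct (pair_wronskian_vanishing _ _ _ _ _ _ _ _ _ radius_ge1 ground0_state Hv (eps * Rabs b)) as [N HN].
  { apply Rmult_lt_0_compat; [lra | apply Rabs_pos_lt, Hb0]. }
  exists N; intros t Ht; specialize (HN t Ht).
  unfold K, Rdiv; rewrite Rabs_mult, Rabs_inv.
  pose proof (Rabs_pos_lt b Hb0).
  apply Rmult_le_reg_r with (Rabs b); [assumption|].
  rewrite Rmult_assoc, Rinv_l, Rmult_1_r by lra; exact HN.
Qed.

Lemma pair_vanishing : vanishing (fun t => u t * v t).
Proof.
  apply vanishing_of_exp with (pair_bound k C) 0; [apply pair_bound_nonneg|].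
  intros t Ht; rewrite <- (Rabs_pos_eq t) at 3 by exact Ht.
  apply (pair_dominated _ _ _ _ _ _ _ _ _ HC ground0_state Hv).
Qed.

Lemma pair_pos (t : R) : 0 < v t.
Proof. apply (state_ground _ _ _ _ _ _ Hv). Qed.

(* Beyond [T], [-(u v)'] dominates [pmon u v] by [ground0_slope_lt], hence also a multiple of [|K'|]. *)
Lemma quotient_tail_bound (t : R) : T <= t -> Rabs (K t) <= (kap0 + 2) * (u t * v t).
Proof.
  pose proof radius_ge1 as HT; pose proof shift_bound_ge1 as Hk1.
  pose proof shift_bound as Hkap; apply Rabs_le_between in Hkap.
  (* The two signs give the two sides of the absolute value. Each combination does not decrease and
     vanishes at +oo, so it is nonpositive. *)
  assert (Hgen : forall s, s = 1 \/ s = -1 -> forall t, T <= t -> s * K t + - ((kap0 + 2) * (u t * v t)) <= 0).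
  { intros s Hs r Hr.
    apply (vanishing_nondecr_nonpos (fun t => s * K t + - ((kap0 + 2) * (u t * v t))) T); [| |exact Hr].
    - intros x z Hxz.
      apply (le_of_derive_nonneg (fun t => s * K t + - ((kap0 + 2) * (u t * v t)))
        (fun t => s * (kap b * (u t * v t) - 2 * (pmon k t * (u t * v t)))
                  - (kap0 + 2) * (u1 t * v t + u t * v1 t))); [lra| |].
      + intros w _; destruct (ground0_sol w), (ground_sol _ _ _ _ _ (state_ground _ _ _ _ _ _ Hv) w).
        pose proof (quotient_derive w); der; ring.
      + intros w Hw.
        pose proof (ground0_slope_lt w ltac:(lra)) as H1; pose proof (pmon_ge1 w ltac:(lra)) as H2.
        pose proof (ground_right _ _ _ _ _ (state_ground _ _ _ _ _ _ Hv) w ltac:(lra)) as H3.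
        pose proof (ground0_pos w) as H4; pose proof (pair_pos w) as H5.
        set (Q := u w * v w); assert (HQ : 0 < Q) by (unfold Q; nra).
        assert (H6 : u1 w * v w + u w * v1 w <= - (pmon k w * Q)) by (unfold Q; nra).
        assert (H7 : (kap0 + 2) * (u1 w * v w + u w * v1 w) <= (kap0 + 2) * - (pmon k w * Q))
          by (apply Rmult_le_compat_l; lra).
        assert (H8 : kap0 * Q <= kap0 * (pmon k w * Q)) by (apply Rmult_le_compat_l; nra).
        assert (H9 : - (kap0 * Q) <= kap b * Q <= kap0 * Q) by (split; nra).
        assert (H10 : 0 <= pmon k w * Q) by nra.
        destruct Hs as [-> | ->]; lra.
    - apply vanishing_plus.
      + destruct Hs as [-> | ->].
        * apply vanishing_ext with K; [intros; ring | apply quotient_vanishing].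
        * apply vanishing_ext with (fun t => - K t); [intros; ring | apply vanishing_opp, quotient_vanishing].
      + apply vanishing_opp; intros eps He.
        destruct (pair_vanishing (eps / (kap0 + 2))) as [N HN]; [apply Rdiv_lt_0_compat; lra|].
        exists N; intros w Hw; specialize (HN w Hw).
        rewrite Rabs_mult, (Rabs_pos_eq (kap0 + 2)) by lra.
        apply Rle_trans with ((kap0 + 2) * (eps / (kap0 + 2))); [apply Rmult_le_compat_l; lra|].
        right; field; lra. }
  intros Ht; pose proof (Hgen 1 (or_introl eq_refl) t Ht); pose proof (Hgen (-1) (or_intror eq_refl) t Ht).
  apply Rabs_le; lra.
Qed.

(** The comparison with [u v] compensates the negative powers of [u] in the integrals below. On
    [[0, T]] it follows from a bound integrated from +oo, as [u v] stays away from 0 there. *)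
Lemma quotient_half_bound (t : R) : 0 <= t -> Rabs (K t) <= cK * (u t * v t).
Proof.
  intros Ht; pose proof quotient_constant_ge as [H1 H2]; pose proof (ground0_pos t); pose proof (pair_pos t).
  assert (Huv : 0 < u t * v t) by nra.
  destruct (Rle_lt_dec T t) as [HTt|HTt].
  { eapply Rle_trans; [apply quotient_tail_bound, HTt|]; apply Rmult_le_compat_r; lra. }
  pose proof shift_bound_ge1 as Hk1; pose proof pair_bound_nonneg as Hpb.
  assert (HK : Rabs (K t) <= (kap0 + 2) * pair_bound k C * exp (- t)).
  { apply (vanishing_exp_bound K _ _ quotient_derive); [|apply quotient_vanishing|exact Ht].
    intros s Hs.
    pose proof (proj2 (pair_dominated _ _ _ _ _ _ _ _ _ HC ground0_state Hv) s) as D1.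
    pose proof (proj2 (pair_pmon_dominated _ _ _ _ _ _ _ _ _ HC ground0_state Hv) s) as D2.
    cbv beta in D1, D2; rewrite (Rabs_pos_eq s Hs) in D1, D2.
    unfold Rminus; eapply Rle_trans; [apply Rabs_triang|].
    rewrite Rabs_Ropp, (Rabs_mult (kap b)), (Rabs_mult 2), (Rabs_pos_eq 2) by lra.
    assert (Rabs (kap b) * Rabs (u s * v s) <= kap0 * (pair_bound k C * exp (- s))).
    { apply Rmult_le_compat; auto using Rabs_pos; apply shift_bound. }
    lra. }
  assert (He : exp (- t) <= 1) by (rewrite <- exp_0; apply exp_mono; lra).
  assert (Hlow : 1 <= C ^ 2 * (u t * v t)).
  { pose proof (state_ge _ _ _ _ _ _ ground0_state t ltac:(pose proof radius_ge1; lra)) as Hu'.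
    pose proof (state_ge _ _ _ _ _ _ Hv t ltac:(pose proof radius_ge1; lra)) as Hv'.
    assert (HiC : 0 < / C) by (apply Rinv_0_lt_compat; lra).
    apply Rle_trans with (C ^ 2 * (/ C * / C)); [right; field; lra|].
    apply Rmult_le_compat_l; [apply pow2_ge_0 | apply Rmult_le_compat; lra]. }
  assert (H3 : 0 <= (kap0 + 2) * pair_bound k C) by nra.
  apply Rle_trans with ((kap0 + 2) * pair_bound k C * C ^ 2 * (u t * v t)).
  - eapply Rle_trans; [exact HK|].
    replace ((kap0 + 2) * pair_bound k C * C ^ 2 * (u t * v t)) with
      ((kap0 + 2) * pair_bound k C * (C ^ 2 * (u t * v t))) by ring.
    apply Rmult_le_compat_l; lra.
  - apply Rmult_le_compat_r; lra.
Qed.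

End Quotient.

Let K (b t : R) : R := (u t * U1 b t - u1 t * U b t) / b.

(** For negative [t] both [t] and [b] are reflected: the Wronskian and the divisor [b] change sign
    together. *)
Lemma quotient_bound (b t : R) : Rabs b <= 1 -> b <> 0 -> Rabs (K b t) <= cK * (u t * U b t).
Proof.
  intros Hb Hb0; destruct (Rle_lt_dec 0 t) as [Ht|Ht].
  - exact (quotient_half_bound b _ _ Hb Hb0 (HU b Hb) t Ht).
  - pose proof (quotient_half_bound (- b) _ _ ltac:(rewrite Rabs_Ropp; exact Hb) ltac:(lra)
      (state_even _ _ _ _ _ _ Hk (HU b Hb)) (- t) ltac:(lra)) as H.
    cbv beta in H; rewrite ground0_even, ground0_slope_odd, Ropp_involutive in H.
    replace ((u t * - U1 b t - - u1 t * U b t) / - b) with (K b t) in H; [exact H|].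
    unfold K; field; exact Hb0.
Qed.

Lemma punctured_near : locally' 0 (fun b => Rabs b <= 1 /\ b <> 0).
Proof.
  apply (locally'_near 0 1); [lra|]; intros b Hb Hne; rewrite Rminus_0_r in Hb; split; [lra | exact Hne].
Qed.

Lemma states_converge_0 : locally_uniform (locally' 0) U u.
Proof.
  apply (states_converge k 1 T C U U1 radius_ge1 HC HU); rewrite Rabs_R0; lra.
Qed.

Lemma shift_small (eps : R) : 0 < eps -> locally' 0 (fun b => Rabs (kap b) <= eps).
Proof.
  intros He; pose proof (lambda1_derive_0 k Hk) as Hd; apply is_derive_Reals in Hd.
  destruct (Hd (eps / 2) ltac:(lra)) as [d Hd'].
  apply (locally'_near 0 (Rmin d (eps / 2))); [apply Rmin_pos; [apply cond_pos | lra]|].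
  intros b Hb Hne; rewrite Rminus_0_r in Hb.
  pose proof (Rmin_l d (eps / 2)); pose proof (Rmin_r d (eps / 2)).
  specialize (Hd' b Hne ltac:(lra)); rewrite Rplus_0_l, Rminus_0_r in Hd'.
  unfold kap; eapply Rle_trans; [apply Rabs_triang|]; rewrite Rabs_Ropp; fold lam in Hd'; lra.
Qed.

Lemma state_le_C (b t : R) : Rabs b <= 1 -> 0 < U b t <= C.
Proof.
  intros Hb; split; [apply (state_ground _ _ _ _ _ _ (HU b Hb))|].
  eapply Rle_trans; [apply (state_le _ _ _ _ _ _ (HU b Hb))|].
  rewrite <- (Rmult_1_r C) at 2; apply Rmult_le_compat_l; [lra|].
  rewrite <- exp_0; apply exp_mono; pose proof (Rabs_pos t); lra.
Qed.

(** At a far point [N1] both [K b] and [G] are small, uniformly in [b]. Towards the left their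
    difference varies little, since the derivatives differ by
    [kap b * (u U_b) - 2 pmon u (U_b - u)], which tends to 0 uniformly on [[-N1, N1]]. *)
Lemma quotient_converge : locally_uniform (locally' 0) K G.
Proof.
  intros N eps He.
  assert (HcK : 1 <= cK) by (pose proof (proj1 quotient_constant_ge); pose proof shift_bound_ge1; lra).
  assert (HC2 : 0 < C ^ 2) by (apply pow_lt; lra).
  destruct (exp_small (cK * C ^ 2) (eps / 3) ltac:(nra) ltac:(lra)) as [N0 [HN0 HN0']].
  set (N1 := Rmax N N0).
  assert (HN1 : N <= N1 /\ N0 <= N1) by (split; [apply Rmax_l | apply Rmax_r]).
  specialize (HN0' N1 (proj2 HN1)).
  destruct (continuous_bounded (pmon k) (- N1) N1 (pmon_continuous k)) as [B [HB0 HB]].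
  (* The bound on the derivative of [K b - G] per unit of [eta], times more than the length of
     [[-N1, N1]]. *)
  set (Z := (C ^ 2 + 2 * B * C) * (2 * N1 + 1)).
  assert (HZ : 0 < Z).
  { unfold Z; apply Rmult_lt_0_compat; [|lra]; assert (0 <= 2 * B * C) by nra; lra. }
  set (eta := eps / 3 / Z).
  assert (Heta : 0 < eta) by (apply Rdiv_lt_0_compat; lra).
  generalize (filter_and _ _ punctured_near (filter_and _ _ (shift_small eta Heta) (states_converge_0 N1 eta Heta))).
  apply filter_imp; intros b [[Hb Hb0] [Hkap HUb]] t Ht.
  assert (Habs0 : Rabs 0 <= 1) by (rewrite Rabs_R0; lra).
  pose proof (lipschitz_of_derive (fun t => K b t - G t)
    (fun t => kap b * (u t * U b t) - 2 * (pmon k t * (u t * U b t)) - - f0 t) t N1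
    ((C ^ 2 + 2 * B * C) * eta) ltac:(lra)) as HL.
  assert (HKN : Rabs (K b N1) <= eps / 3).
  { eapply Rle_trans; [apply quotient_bound; assumption|]; eapply Rle_trans; [|exact HN0'].
    rewrite Rmult_assoc; apply Rmult_le_compat_l; [lra|].
    destruct (state_le_C b N1 Hb) as [Hp1 Hp2].
    pose proof (state_le _ _ _ _ _ _ ground0_state N1) as Hu'; rewrite Rabs_pos_eq in Hu' by lra.
    pose proof (ground0_pos N1).
    apply Rle_trans with ((C * exp (- N1)) * C); [apply Rmult_le_compat; lra | right; ring]. }
  assert (HGN : Rabs (G N1) <= eps / 3).
  { destruct (moment_bounds N1) as [G1 G2]; rewrite Rabs_pos_eq by exact G1.
    pose proof (state_le _ _ _ _ _ _ ground0_state N1) as Hu'; rewrite Rabs_pos_eq in Hu' by lra.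
    pose proof (ground0_pos N1); destruct (state_le_C 0 N1 Habs0) as [_ Hp2]; fold u in Hp2.
    apply Rle_trans with (C ^ 2 * exp (- N1)).
    - apply Rle_trans with (u N1 * u N1); [lra|].
      apply Rle_trans with ((C * exp (- N1)) * C); [apply Rmult_le_compat; lra | right; ring].
    - eapply Rle_trans; [|exact HN0'].
      pose proof (exp_pos (- N1)); rewrite (Rmult_assoc cK), <- (Rmult_1_l (C ^ 2 * _)) at 1.
      apply Rmult_le_compat_r; [|exact HcK]; apply Rmult_le_pos; lra. }
  assert (HLip : Rabs (K b N1 - G N1 - (K b t - G t)) <= eps / 3).
  { eapply Rle_trans; [apply HL|].
    - intros s _; pose proof (quotient_derive b _ _ Hb0 (HU b Hb) s); pose proof (moment_derive s).
      apply is_derive_Rminus; assumption.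
    - intros s Hs; unfold f0.
      specialize (HUb s ltac:(lra)); specialize (HB s ltac:(lra)).
      replace (kap b * (u s * U b s) - 2 * (pmon k s * (u s * U b s)) - - (2 * (pmon k s * (u s * u s))))
        with (kap b * (u s * U b s) - 2 * pmon k s * u s * (U b s - u s)) by ring.
      unfold Rminus at 1; eapply Rle_trans; [apply Rabs_triang|].
      rewrite Rabs_Ropp, !Rabs_mult, (Rabs_pos_eq 2) by lra.
      destruct (state_le_C b s Hb) as [Hp1 Hp2]; destruct (state_le_C 0 s Habs0) as [Hp3 Hp4].
      fold u in Hp3, Hp4.
      rewrite (Rabs_pos_eq (u s)), (Rabs_pos_eq (U b s)) by lra.
      assert (E1 : Rabs (kap b) * (u s * U b s) <= eta * (C * C)).
      { apply Rmult_le_compat; [apply Rabs_pos | nra | exact Hkap | apply Rmult_le_compat; lra]. }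
      assert (E2 : 2 * Rabs (pmon k s) * u s * Rabs (U b s - u s) <= 2 * B * C * eta).
      { pose proof (Rabs_pos (pmon k s)); pose proof (Rabs_pos (U b s - u s)).
        apply Rmult_le_compat; [nra | lra | | exact HUb].
        apply Rmult_le_compat; lra. }
      lra.
    - apply Rle_trans with ((C ^ 2 + 2 * B * C) * eta * (2 * N1 + 1)).
      + apply Rmult_le_compat_l; [|lra].
        apply Rmult_le_pos; [|lra]; assert (0 <= 2 * B * C) by nra; lra.
      + right; unfold eta, Z; field.
        assert (0 <= 2 * B * C) by nra; split; lra. }
  apply Rabs_le_between in HKN, HGN, HLip; apply Rabs_le; lra.
Qed.

(** The weight that multiplies [b v K] in the derivative of [G (v/u)^2]. By [G < u^2] it is at most
    [2 / u]. *)
Let h (t : R) : R := 2 * G t / u t ^ 3.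

Lemma weight_continuous (t : R) : continuous h t.
Proof.
  apply (ex_derive_continuous h); eexists; unfold h.
  destruct (ground0_sol t); pose proof (moment_derive t).
  apply is_derive_Rdiv; [apply Rgt_not_eq, pow_lt, ground0_pos | |].
  - repeat der_step.
  - repeat der_step.
Qed.

Lemma states_continuous (b t : R) : Rabs b <= 1 -> continuous (U b) t.
Proof. intros Hb; apply (state_continuous _ _ _ _ _ _ (HU b Hb)). Qed.

Lemma quotient_continuous (b t : R) : Rabs b <= 1 -> b <> 0 -> continuous (K b) t.
Proof.
  intros Hb Hb0; apply (ex_derive_continuous (K b)); eexists.
  apply (quotient_derive b _ _ Hb0 (HU b Hb)).
Qed.

Lemma moment_continuous (t : R) : continuous G t.
Proof. apply (ex_derive_continuous G); eexists; apply moment_derive. Qed.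

(** The factor [u] in the bound on [w] cancels [2 / u], leaving a multiple of [U b ^ 2]. A general
    [w] covers both [K b] and, at [b = 0], the limit [G], with the same constant. *)
Lemma second_order_dominated (w : R -> R) (b : R) : Rabs b <= 1 -> (forall t, continuous w t) ->
  (forall t, Rabs (w t) <= cK * (u t * U b t)) ->
  dominated (fun t => h t * (U b t * w t)) (2 * cK * pair_bound k C).
Proof.
  intros Hb Hwc Hw; split.
  - intros t; apply (continuous_mult h (fun t => U b t * w t)); [apply weight_continuous|].
    apply (continuous_mult (U b) w); [apply states_continuous, Hb | apply Hwc].
  - intros t.
    pose proof (proj2 (pair_dominated _ _ _ _ _ _ _ _ _ HC (HU b Hb) (HU b Hb)) t) as D1; cbv beta in D1.
    destruct (moment_bounds t) as [G1 G2]; pose proof (ground0_pos t) as Hp.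
    destruct (state_le_C b t Hb) as [Hp1 _].
    pose proof (proj1 quotient_constant_ge); pose proof shift_bound_ge1.
    assert (Hu3 : 0 < u t ^ 3) by (apply pow_lt, Hp).
    assert (Hh : Rabs (h t) <= 2 / u t).
    { unfold h, Rdiv; rewrite Rabs_pos_eq.
      - apply Rle_trans with (2 * u t ^ 2 * / u t ^ 3); [|right; field; lra].
        apply Rmult_le_compat_r; [left; apply Rinv_0_lt_compat, Hu3 | lra].
      - apply Rmult_le_pos; [lra | left; apply Rinv_0_lt_compat, Hu3]. }
    rewrite !Rabs_mult, (Rabs_pos_eq (U b t)) by lra.
    apply Rle_trans with (2 / u t * (U b t * (cK * (u t * U b t)))).
    + apply Rmult_le_compat; [apply Rabs_pos | | exact Hh |].
      * apply Rmult_le_pos; [lra | apply Rabs_pos].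
      * apply Rmult_le_compat_l; [lra | apply Hw].
    + replace (2 / u t * (U b t * (cK * (u t * U b t)))) with (2 * cK * (U b t * U b t)) by (field; lra).
      rewrite Rabs_pos_eq in D1 by nra.
      rewrite (Rmult_assoc (2 * cK) (pair_bound k C)); apply Rmult_le_compat_l; [nra | exact D1].
Qed.

Lemma Rabs_0_le_1 : Rabs 0 <= 1.
Proof. rewrite Rabs_R0; lra. Qed.

Lemma second_order_dominated_near (b : R) : Rabs b <= 1 -> b <> 0 ->
  dominated (fun t => h t * (U b t * K b t)) (2 * cK * pair_bound k C).
Proof.
  intros Hb Hb0; apply second_order_dominated; auto; [intros; apply quotient_continuous | intros; apply quotient_bound]; auto.
Qed.

Lemma second_order_dominated_limit : dominated (fun t => h t * (u t * G t)) (2 * cK * pair_bound k C).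
Proof.
  apply (second_order_dominated G 0 Rabs_0_le_1 moment_continuous).
  intros t; destruct (moment_bounds t); rewrite Rabs_pos_eq by assumption; fold u.
  pose proof (proj1 quotient_constant_ge); pose proof shift_bound_ge1; pose proof (ground0_pos t); nra.
Qed.

(* [(G (v/u)^2)' = -2 pmon v^2 + b h v K] for [v = U b], since [(v/u)' = b K / u^2]. *)
Lemma pmon_integral (b : R) : Rabs b <= 1 -> b <> 0 ->
  2 * integral (fun t => pmon k t * (U b t * U b t)) =
  b * integral (fun t => h t * (U b t * K b t)).
Proof.
  intros Hb Hb0.
  pose proof (HU b Hb) as Hs.
  pose proof (pair_pmon_dominated _ _ _ _ _ _ _ _ _ HC Hs Hs) as D1.
  pose proof (second_order_dominated_near b Hb Hb0) as D2.
  pose proof (dominated_scal _ _ b D2) as D3; pose proof (dominated_scal _ _ 2 D1) as D4.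
  (* As [0 <= G < u^2], the boundary term is at most [U b ^ 2] and so vanishes at both ends. *)
  assert (Hbound : forall t, Rabs (G t * U b t ^ 2 / u t ^ 2) <= pair_bound k C * exp (- Rabs t)).
  { intros t; pose proof (proj2 (pair_dominated _ _ _ _ _ _ _ _ _ HC Hs Hs) t) as Hd; cbv beta in Hd.
    destruct (moment_bounds t) as [G1 G2]; pose proof (ground0_pos t) as Hp.
    assert (Hu2 : 0 < u t ^ 2) by (apply pow_lt, Hp).
    eapply Rle_trans; [|exact Hd].
    rewrite (Rabs_pos_eq (U b t * U b t)) by nra.
    rewrite Rabs_pos_eq.
    - apply Rmult_le_reg_r with (u t ^ 2); [exact Hu2|].
      replace (G t * U b t ^ 2 / u t ^ 2 * u t ^ 2) with (G t * U b t ^ 2) by (field; lra).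
      pose proof (pow2_ge_0 (U b t)); nra.
    - apply Rmult_le_pos; [apply Rmult_le_pos; [exact G1 | apply pow2_ge_0]|].
      left; apply Rinv_0_lt_compat, Hu2. }
  assert (HI : integral (fun t => b * (h t * (U b t * K b t)) - 2 * (pmon k t * (U b t * U b t))) = 0).
  { apply (integral_derive_0 (fun t => G t * U b t ^ 2 / u t ^ 2) _ _ (dominated_minus _ _ _ _ D3 D4)).
    - intros t; destruct (ground0_sol t), (ground_sol _ _ _ _ _ (state_ground _ _ _ _ _ _ Hs) t).
      pose proof (moment_derive t); pose proof (ground0_pos t).
      der; [apply Rgt_not_eq; apply Rmult_lt_0_compat; lra|].
      unfold f0, h, K; field; split; lra.
    - apply vanishing_of_exp with (pair_bound k C) 0; [apply pair_bound_nonneg|].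
      intros t Ht; rewrite <- (Rabs_pos_eq t) at 4 by exact Ht; apply Hbound.
    - apply vanishing_of_exp with (pair_bound k C) 0; [apply pair_bound_nonneg|].
      intros t Ht; rewrite <- (Rabs_pos_eq t) at 4 by exact Ht; rewrite <- (Rabs_Ropp t); apply Hbound. }
  rewrite (integral_minus _ _ _ _ D3 D4), (integral_scal _ _ _ D1), (integral_scal _ _ _ D2) in HI; lra.
Qed.

Let I2 : R := integral (fun t => u t * u t).
Let J2 : R := integral (fun t => h t * (u t * G t)).

Lemma ground0_norm_pos : 0 < I2.
Proof. exact (pair_integral_pos _ _ _ _ _ _ _ _ _ radius_ge1 HC ground0_state ground0_state). Qed.

(* [h u G = 2 G^2 / u^2 < 2 u^2] *)
Lemma second_order_term_lt : J2 < 2 * I2.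
Proof.
  pose proof (pair_dominated _ _ _ _ _ _ _ _ _ HC ground0_state ground0_state) as D1.
  pose proof (dominated_scal _ _ 2 D1) as D2; pose proof second_order_dominated_limit as D3.
  assert (Hpos : forall t, 0 < 2 * (u t * u t) - h t * (u t * G t)).
  { intros t; destruct (moment_bounds t) as [G1 G2]; pose proof (ground0_pos t).
    assert (Hu2 : 0 < u t ^ 2) by (apply pow_lt; assumption).
    replace (2 * (u t * u t) - h t * (u t * G t)) with (2 * ((u t ^ 2) ^ 2 - G t ^ 2) * / u t ^ 2)
      by (unfold h; field; lra).
    apply Rmult_lt_0_compat; [nra | apply Rinv_0_lt_compat, Hu2]. }
  pose proof (dominated_minus _ _ _ _ D2 D3) as D4.
  destruct (continuous_pos_lower_bound _ (-1) 1 (proj1 D4) (fun t _ => Hpos t)) as [m [Hm0 Hm]].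
  assert (HI : 2 * m <= integral (fun t => 2 * (u t * u t) - h t * (u t * G t)))
    by exact (integral_lower _ _ m D4 (fun t => Rlt_le _ _ (Hpos t)) Hm).
  rewrite (integral_minus _ _ _ _ D2 D3), (integral_scal _ _ _ D1) in HI.
  fold I2 J2 in HI; lra.
Qed.

(** Since the first derivative vanishes at 0, its slope at [b] is [lambda1' b / b]. [pmon_integral]
    extracts a factor [b] from the moment of [pmon], so the division is exact and the remaining
    integrals converge by domination. *)
Lemma lambda1_second_derive_0 : is_derive (Derive (lambda1 k)) 0 (2 - J2 / I2).
Proof.
  apply is_derive_of_slope.
  pose proof ground0_norm_pos as HI.
  assert (FL : Filter (locally' 0)) by apply locally'_filter.
  apply is_lim_ext_loc with (fun b => 2 -
    integral (fun t => h t * (U b t * K b t)) / integral (fun t => U b t * U b t)).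
  - assert (Hn : locally' 0 (fun b => Rabs b < 1 /\ b <> 0)).
    { apply (locally'_near 0 1); [lra|]; intros b Hb Hne; rewrite Rminus_0_r in Hb; auto. }
    revert Hn; apply filter_imp; intros b [Hb Hb0].
    assert (Hb' : Rabs b <= 1) by lra.
    rewrite (is_derive_unique _ _ _ (lambda1_derive_0 k Hk)).
    rewrite (is_derive_unique _ _ _ (lambda1_derive k 1 T C U U1 radius_ge1 HC HU b Hb)).
    pose proof (pmon_integral b Hb' Hb0) as Hp.
    pose proof (pair_integral_pos _ _ _ _ _ _ _ _ _ radius_ge1 HC (HU b Hb') (HU b Hb')) as HIb.
    set (J := integral (fun t => pmon k t * (U b t * U b t))) in *.
    set (I := integral (fun t => U b t * U b t)) in *.
    replace J with (b * integral (fun t => h t * (U b t * K b t)) / 2) by lra.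
    field; lra.
  - apply is_lim_minus'; [apply is_lim_const|].
    assert (Huu : locally_uniform (locally' 0) (fun b t => U b t * U b t) (fun t => u t * u t)).
    { apply locally_uniform_mult; auto using ground0_continuous, states_converge_0. }
    apply is_lim_quotient; [| |lra].
    + apply (integral_limit (locally' 0) (fun b t => h t * (U b t * K b t)) _ (2 * cK * pair_bound k C)).
      * generalize punctured_near; apply filter_imp; intros b [Hb Hb0]; apply second_order_dominated_near; auto.
      * apply second_order_dominated_limit.
      * apply (locally_uniform_mult (locally' 0) (fun _ => h)).
        -- apply weight_continuous.
        -- intros t; apply (continuous_mult u G); [apply ground0_continuous | apply moment_continuous].
        -- apply locally_uniform_const, FL.
        -- apply locally_uniform_mult; auto using ground0_continuous, moment_continuous, states_converge_0, quotient_converge.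
    + apply (integral_limit (locally' 0) (fun b t => U b t * U b t) _ (pair_bound k C)).
      * generalize punctured_near; apply filter_imp; intros b [Hb Hb0].
        exact (pair_dominated _ _ _ _ _ _ _ _ _ HC (HU b Hb) (HU b Hb)).
      * exact (pair_dominated _ _ _ _ _ _ _ _ _ HC ground0_state ground0_state).
      * exact Huu.
Qed.

Lemma second_derivative_pos : exists l, 0 < l /\ is_derive (Derive (lambda1 k)) 0 l.
Proof.
  exists (2 - J2 / I2); split; [|apply lambda1_second_derive_0].
  pose proof ground0_norm_pos; pose proof second_order_term_lt.
  enough (J2 / I2 < 2) by lra.
  apply Rmult_lt_reg_r with I2; [assumption|].
  unfold Rdiv; rewrite Rmult_assoc, Rinv_l by lra; lra.
Qed.

End SecondDerivative.

Theorem theorem1p2 (k : nat) (hk : (2 <= k)%nat) (hev : Nat.Even k) :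
  (forall alpha, ex_derive (lambda1 k) alpha) /\
  is_derive (lambda1 k) 0 0 /\
  (exists l, 0 < l /\ is_derive (Derive (lambda1 k)) 0 l).
Proof.
  split; [apply lambda1_ex_derive|]; split; [apply lambda1_derive_0, hev|].
  destruct (states_choice k 1 ltac:(lra)) as [C [U [U1 [HC HU]]]].
  apply (second_derivative_pos k C U U1); auto; lia.
Qed.
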